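(* Let $w=(w_1,\dots,w_n)$ with $w_t\ge0$ and $\sum_tw_t=1$, and let $X_1,\dots,X_n\in\mathbb{P}_d$. For every Horn tuple $(I_1,\dots,I_n;K)$ in dimension $d$, $$\prod_{k\in K}\lambda_k^\uparrow\bigl(G_n(w;X_1,\dots,X_n)\bigr)\ge\prod_{t=1}^n\Bigl(\prod_{i_t\in I_t}\lambda_{i_t}^\uparrow(X_t)\Bigr)^{w_t}.$$ Equivalently, there exist $d\times d$ unitaries $U_1,\dots,U_n$ such that $$\log\bigl(G_n(w;X_1,\dots,X_n)\bigr)\ge\sum_tw_tU_t\log(X_t)U_t^\dagger,$$ and in fact equality holds here. In particular, for every $X,Y\in\mathbb{P}_d$ and $0\le\alpha\le1$ there exist unitaries $U,V$ such that $$\log(X\#_\alpha Y)=(1-\alpha)U\log(X)U^\dagger+\alpha V\log(Y)V^\dagger.$$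
   Context: $\mathbb{P}_d$ is the set of $d\times d$ positive definite complex matrices; matrix inequalities are in the Loewner order; $\lambda_1^\uparrow(A)\le\lambda_2^\uparrow(A)\le\cdots$ are the eigenvalues of a Hermitian matrix $A$ in increasing order. The weighted geometric mean is $X\#_\alpha Y=X^{1/2}(X^{-1/2}YX^{-1/2})^\alpha X^{1/2}$. With $\delta(X,Y)=\|\log(X^{-1/2}YX^{-1/2})\|_2$ (Hilbert–Schmidt norm), $(\mathbb{P}_d,\delta)$ is a Hadamard space, and the weighted Karcher mean is the unique minimizer $$G_n(w;X_1,\dots,X_n)=\operatorname*{arg\,min}_{M\in\mathbb{P}_d}\sum_{i=1}^nw_i\,\delta^2(M,X_i).$$ $[d]=\{1,\dots,d\}$; $\mathrm{Gr}(r,d)$ is the set of $r$-dimensional subspaces of $\mathbb{C}^d$. For $I=\{i_1<\dots<i_r\}\subset[d]$, $I^\vee=\{d+1-i_r<\dots<d+1-i_1\}$. For a complete flag $E_\bullet=(E_1\subset\cdots\subset E_d=\mathbb{C}^d)$, $$\Omega_I(E_\bullet)=\{L\in\mathrm{Gr}(r,d):\dim(L\cap E_{i_q})\ge q\text{ for }q=1,\dots,r\}.$$ An $(n+1)$-tuple $(I_1,\dots,I_n;K)$ of $r$-subsets of $[d]$ is a Horn tuple of rank $r$ in dimension $d$ if $$\Omega_{I_1^\vee}(E_\bullet^{(1)})\cap\cdots\cap\Omega_{I_n^\vee}(E_\bullet^{(n)})\cap\Omega_K(G_\bullet)\ne\varnothing$$ for every choice of complete flags $E_\bullet^{(1)},\dots,E_\bullet^{(n)},G_\bullet$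 in $\mathbb{C}^d$. A Horn tuple in dimension $d$ is one of any rank $1\le r\le d$. *)

(* Defs.v *)
From HB Require Import structures.
From mathcomp Require Export all_boot all_order all_algebra.
From mathcomp Require Export complex.
From mathcomp Require Export boolp classical_sets reals exp.

Set Implicit Arguments.
Unset Strict Implicit.
Unset Printing Implicit Defensive.

Import Order.TTheory GRing.Theory Num.Theory.
Local Open Scope ring_scope.
Local Open Scope complex_scope.
Local Open Scope sesquilinear_scope.

Section PositiveMatrices.
Variables (R : realType) (d : nat).
Local Notation C := R[i].
Implicit Types A B M N X Y : 'M[C]_d.

(* In R[i], [0 <= z] and [0 < z] entail that z is real. *)
Definition posdefmx A : Prop :=
  A \is hermsymmx /\
  forall v : 'cV[C]_d, v != 0 -> 0 < (v^t* *m A *m v) 0 0.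

Definition possemidefmx A : Prop :=
  A \is hermsymmx /\ forall v : 'cV[C]_d, 0 <= (v^t* *m A *m v) 0 0.

Definition loewner_le A B : Prop := possemidefmx (B - A).

(* The eigenvalues of a Hermitian matrix are real, so that taking real parts
   loses nothing; the index k : 'I_d counts from 0. *)
Definition eigvals_up A : seq R :=
  sort <=%R [seq complex.Re (spectral_diag A 0 i) | i <- enum 'I_d].

Definition lambda_up A (k : 'I_d) : R := (eigvals_up A)`_k.

(* Functional calculus f(A) for a Hermitian matrix A: by [orthomx_spectralP],
   A = invmx P *m diag_mx (spectral_diag A) *m P with P := spectralmx A unitary.
   The values on matrices that are not Hermitian are irrelevant. *)
Definition mxfun (f : R -> R) A : 'M[C]_d :=
  invmx (spectralmx A)
    *m diag_mx (\row_i (f (complex.Re (spectral_diag A 0 i)))%:C)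
    *m spectralmx A.

Definition mxlog A : 'M[C]_d := mxfun (@ln R) A.

Definition mxpow A (a : R) : 'M[C]_d := mxfun (fun x => x `^ a) A.

Definition geomean (a : R) X Y : 'M[C]_d :=
  mxpow X (2^-1)
    *m mxpow (mxpow X (- 2^-1) *m Y *m mxpow X (- 2^-1)) a
    *m mxpow X (2^-1).

Definition hsnorm A : R := Num.sqrt (complex.Re (\tr (A^t* *m A))).

Definition pd_dist X Y : R :=
  hsnorm (mxlog (mxpow X (- 2^-1) *m Y *m mxpow X (- 2^-1))).

Definition karcher_cost n (w : 'I_n -> R) (X : 'I_n -> 'M[C]_d) M : R :=
  \sum_(t < n) w t * pd_dist M (X t) ^+ 2.

Definition karcher_argmin n (w : 'I_n -> R) (X : 'I_n -> 'M[C]_d)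
    : set 'M[C]_d :=
  [set M | posdefmx M /\
     forall N, posdefmx N -> karcher_cost w X M <= karcher_cost w X N].

(* For a probability vector w and positive definite X_t, [karcher_argmin w X]
   is a singleton, since the positive definite matrices form a Hadamard space
   under [pd_dist]; [xget] then returns its element, and the default value 1 is
   only used outside this case. *)
Definition karcher_mean n (w : 'I_n -> R) (X : 'I_n -> 'M[C]_d) : 'M[C]_d :=
  xget 1%:M (karcher_argmin w X).

End PositiveMatrices.

Section HornTuples.
Variables (R : realType) (d : nat).
Local Notation V := 'cV[R[i]]_d.

(* [E i] is the member of dimension i + 1 of the flag. *)
Definition complete_flag (E : 'I_d -> {vspace V}) : Prop :=
  (forall i, \dim (E i) = i.+1) /\
  (forall i j : 'I_d, (i <= j)%N -> (E i <= E j)%VS).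

(* [enum_val] lists the elements of I in increasing order; with indices counted
   from 0, the condition "dim >= q" for q = 1, ..., r becomes "q < dim" for
   q = 0, ..., r - 1. *)
Definition schubert (I : {set 'I_d}) (E : 'I_d -> {vspace V})
    (L : {vspace V}) : Prop :=
  \dim L = #|I| /\
  forall q : 'I_#|I|, (q < \dim (L :&: E (enum_val q)))%N.

(* i |-> d + 1 - i on {1, ..., d} is [rev_ord] on {0, ..., d - 1}. *)
Definition dual_set (I : {set 'I_d}) : {set 'I_d} :=
  [set rev_ord i | i in I]%SET.

Definition horn_tuple_of_rank n (r : nat)
    (I : 'I_n -> {set 'I_d}) (K : {set 'I_d}) : Prop :=
  [/\ forall t, #|I t| = r, #|K| = r &
      forall (E : 'I_n -> 'I_d -> {vspace V}) (G : 'I_d -> {vspace V}),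
        (forall t, complete_flag (E t)) -> complete_flag G ->
        exists L : {vspace V},
          (forall t, schubert (dual_set (I t)) (E t) L) /\ schubert K G L].

Definition horn_tuple n (I : 'I_n -> {set 'I_d}) (K : {set 'I_d}) : Prop :=
  exists r : nat, (1 <= r <= d)%N /\ horn_tuple_of_rank r I K.

End HornTuples.

Arguments horn_tuple R {d n} I K.

(* Main.v *)
(* It suffices to write log G = sum_t w_t U_t log(X_t) U_t^*: the Horn
   inequalities then follow by testing this equation on a subspace in the
   intersection of the Schubert varieties of the eigenflags (Hersch-Zwahlen).

   Write X_t = T exp(H_t) T^* and G = T T^*; the Karcher equation, which is the
   first-order condition for the minimizer, says sum_t w_t H_t = 0. Since
   ln det(Q^* exp(H) Q) >= tr(Q^* H Q) for an orthonormal frame Q, every subspace L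
   satisfies
     sum_t w_t ln det(X_t^-1 | L) >= ln det(G^-1 | L).
   Bounding both sides by eigenvalues, according to the position of L with respect
   to the eigenflags, shows that the eigenflags of the X_t^-1 (weights
   -w_t log lambda) and of G (weights log lambda) form a semistable configuration:
   the sum of their Busemann functions on the cone of positive definite matrices
   has nonnegative slope in every direction at infinity. Minimizing this sum plus
   epsilon times a coercive function with bounded gradient gives, as epsilon tends
   to 0, a sequence of points where its gradient tends to 0 (Kempf-Ness). The
   gradient at a point has the form U_0 log(G)' U_0^* - sum_t w_t U_t log(X_t)' U_t^*,
   where ' denotes the diagonal matrix of the eigenvalues and the U are unitary, so
   that compactness of the unitary group yields the equation.

   X #_alpha Y satisfies the Karcher equation with T = X^(1/2) exp(alpha Z / 2),
   where exp(Z) = X^(-1/2) Y X^(-1/2). *)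

(* Semistability only makes the slopes at infinity nonnegative, so the infimum of the sum of
   Busemann functions may fail to be attained; this is why epsilon enters and why the final equation
   is a limit of approximate ones. Limits are taken along one ultrafilter on [nat] finer than the
   eventual filter. Every sequence of unitaries and every bounded sequence of exponents then
   converges, all at once, without extraction of subsequences. Points of the cone are therefore
   carried by spectral data, a unitary and a vector of logarithms of eigenvalues, which have limits
   separately. First-order conditions come from one-sided expansions a + s b + O(s^2). The minimizer
   is perturbed by exp(sK), where K is the Hermitian matrix that has to vanish, with the sign that
   makes the derivative a negative multiple of tr(K^* K); minimality forces K = 0. The perturbed
   functions are not differentiated themselves: they are bounded above by traces of products of
   exponentials that agree with them to first order. For the squared distance, where the matrix
   logarithm would be the difficulty, the bound is a corrected Klein inequality. *)
Require Import Defs.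
From mathcomp Require Import fingroup perm filter topology normedtype sequences.
From mathcomp Require Import zify ring lra.

Set Implicit Arguments.
Unset Strict Implicit.
Unset Printing Implicit Defensive.

Import Order.TTheory GRing.Theory Num.Theory.
Import numFieldNormedType.Exports.
Local Open Scope ring_scope.
Local Open Scope complex_scope.
Local Open Scope sesquilinear_scope.

(** * Matrices over R[i] *)

Section Basics.
Variable R : realType.
Local Notation C := R[i].
Local Notation Re := (@complex.Re R).
Local Notation Im := (@complex.Im R).

Lemma adjE m n (A : 'M[C]_(m, n)) i j : A^t* i j = (A j i)^*%C.
Proof. by rewrite !mxE. Qed.

Lemma adjM m n p (A : 'M[C]_(m, n)) (B : 'M[C]_(n, p)) :
  (A *m B)^t* = B^t* *m A^t*.
Proof. by rewrite trmx_mul map_mxM. Qed.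

Lemma adjD m n (A B : 'M[C]_(m, n)) : (A + B)^t* = A^t* + B^t*.
Proof. by rewrite linearD map_mxD. Qed.

Lemma adjZ m n (a : C) (A : 'M[C]_(m, n)) : (a *: A)^t* = a^*%C *: A^t*.
Proof. by apply/matrixP => i j; rewrite !mxE rmorphM. Qed.

Lemma adjZr m n (a : R) (A : 'M[C]_(m, n)) : (a%:C *: A)^t* = a%:C *: A^t*.
Proof. by rewrite adjZ conjc_real. Qed.

Lemma adj1 n : (1%:M : 'M[C]_n)^t* = 1%:M.
Proof. by rewrite trmx1 map_mx1. Qed.

Lemma adj_sum I (r : seq I) P m n (F : I -> 'M[C]_(m, n)) :
  (\sum_(i <- r | P i) F i)^t* = \sum_(i <- r | P i) (F i)^t*.
Proof.
by elim/big_rec2: _ => [|i A B _ <-]; rewrite ?adjD // trmx0 map_mx0.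
Qed.

Lemma Re_sum I (r : seq I) P (F : I -> C) :
  Re (\sum_(i <- r | P i) F i) = \sum_(i <- r | P i) Re (F i).
Proof. by elim/big_rec2: _ => // i x y _ <-; case: (F i) y => ? ? []. Qed.

Lemma ReD (x y : C) : Re (x + y) = Re x + Re y.
Proof. by case: x y => ? ? []. Qed.

Lemma ImD (x y : C) : Im (x + y) = Im x + Im y.
Proof. by case: x y => ? ? []. Qed.

Lemma ReN (x : C) : Re (- x) = - Re x.
Proof. by case: x. Qed.

Lemma ReM (x y : C) : Re (x * y) = Re x * Re y - Im x * Im y.
Proof. by case: x y => ? ? []. Qed.

Lemma ImM (x y : C) : Im (x * y) = Re x * Im y + Im x * Re y.
Proof. by case: x y => ? ? []. Qed.

Lemma ReZ (a : R) (x : C) : Re (a%:C * x) = a * Re x.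
Proof. by rewrite ReM /= mul0r subr0. Qed.

Lemma Re_conj (x : C) : Re x^*%C = Re x.
Proof. by case: x. Qed.

Lemma Im_conj (x : C) : Im x^*%C = - Im x.
Proof. by case: x. Qed.

Lemma eqC (x y : C) : Re x = Re y -> Im x = Im y -> x = y.
Proof. by case: x y => ? ? [] /= ? ? -> ->. Qed.

Definition nsq (z : C) : R := Re z ^+ 2 + Im z ^+ 2.

Lemma nsqE z : (nsq z)%:C = z^*%C * z.
Proof.
apply: eqC; rewrite ?ReM ?ImM Re_conj Im_conj /nsq /=; ring.
Qed.

Lemma nsqE' z : (nsq z)%:C = z * z^*%C.
Proof. by rewrite mulrC nsqE. Qed.

Lemma nsq_ge0 z : 0 <= nsq z.
Proof. by rewrite addr_ge0 ?sqr_ge0. Qed.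

Lemma nsq_eq0 z : nsq z = 0 -> z = 0.
Proof.
move/eqP; rewrite paddr_eq0 ?sqr_ge0 // !sqrf_eq0 => /andP[/eqP h1 /eqP h2].
exact: eqC.
Qed.

Lemma nsq_conj z : nsq z^*%C = nsq z.
Proof. by rewrite /nsq Re_conj Im_conj sqrrN. Qed.

Lemma nsqM x y : nsq (x * y) = nsq x * nsq y.
Proof. rewrite /nsq ReM ImM; ring. Qed.

Lemma nsq_gt0 z : z != 0 -> 0 < nsq z.
Proof.
by move=> z0; rewrite lt_def nsq_ge0 andbT; apply: contra z0 => /eqP/nsq_eq0 ->.
Qed.

Lemma nsq1 : nsq 1 = 1.
Proof. by rewrite /nsq /= expr1n expr0n addr0. Qed.

Lemma nsq_real (a : R) : nsq a%:C = a ^+ 2.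
Proof. by rewrite /nsq /= expr0n addr0. Qed.

Lemma Cr_sum I (r : seq I) P (F : I -> R) :
  (\sum_(i <- r | P i) F i)%:C = \sum_(i <- r | P i) (F i)%:C.
Proof. exact: (rmorph_sum (@real_complex_def R _)). Qed.

Lemma Cr_prod I (r : seq I) P (F : I -> R) :
  (\prod_(i <- r | P i) F i)%:C = \prod_(i <- r | P i) (F i)%:C.
Proof. exact: (rmorph_prod (@real_complex_def R _)). Qed.

Lemma CrM (x y : R) : (x * y)%:C = x%:C * y%:C.
Proof. exact: (rmorphM (@real_complex_def R _)). Qed.

Lemma CrD (x y : R) : (x + y)%:C = x%:C + y%:C.
Proof. exact: (rmorphD (@real_complex_def R _)). Qed.

Lemma CrN (x : R) : (- x)%:C = - x%:C.
Proof. exact: (rmorphN (@real_complex_def R _)). Qed.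

Lemma tr_sum (J : finType) n (F : J -> 'M[C]_n) :
  \tr (\sum_i F i) = \sum_i \tr (F i).
Proof. exact: linear_sum. Qed.

Lemma trN n (A : 'M[C]_n) : \tr (- A) = - \tr A.
Proof. exact: linearN. Qed.

Definition rdiag n (a : 'I_n -> R) : 'M[C]_n := diag_mx (\row_i (a i)%:C).

Lemma rdiagE n (a : 'I_n -> R) i j : rdiag a i j = (a i)%:C *+ (i == j).
Proof. by rewrite !mxE; case: eqP => // <-. Qed.

Lemma rdiagM n (a b : 'I_n -> R) :
  rdiag a *m rdiag b = rdiag (fun i => a i * b i).
Proof.
rewrite mulmx_diag; congr diag_mx; apply/rowP => i.
by rewrite !mxE CrM.
Qed.

Lemma rdiagD n (a b : 'I_n -> R) :
  rdiag a + rdiag b = rdiag (fun i => a i + b i).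
Proof. by apply/matrixP => i j; rewrite !mxE -mulrnDl CrD. Qed.

Lemma rdiagN n (a : 'I_n -> R) : - rdiag a = rdiag (fun i => - a i).
Proof. by apply/matrixP => i j; rewrite !mxE -mulNrn CrN. Qed.

Lemma rdiagZ n (c : R) (a : 'I_n -> R) :
  c%:C *: rdiag a = rdiag (fun i => c * a i).
Proof. by apply/matrixP => i j; rewrite !mxE mulrnAr CrM. Qed.

Lemma rdiag1 n : rdiag (fun _ : 'I_n => 1) = 1%:M.
Proof. by apply/matrixP => i j; rewrite !mxE. Qed.

Lemma rdiag_ext n (a b : 'I_n -> R) : a =1 b -> rdiag a = rdiag b.
Proof. by move=> e; congr diag_mx; apply/rowP => i; rewrite !mxE e. Qed.

Lemma rdiag_const n (c : R) : rdiag (fun _ : 'I_n => c) = c%:C%:M.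
Proof. by apply/matrixP => i j; rewrite !mxE. Qed.

Lemma adj_rdiag n (a : 'I_n -> R) : (rdiag a)^t* = rdiag a.
Proof.
apply/matrixP => i j; rewrite adjE !rdiagE eq_sym.
by case: eqP => [->|_]; rewrite ?mulr1n ?mulr0n ?conjc_real // conjc0.
Qed.

Lemma det_rdiag n (a : 'I_n -> R) : \det (rdiag a) = (\prod_i a i)%:C.
Proof. by rewrite det_diag Cr_prod; apply: eq_bigr => i _; rewrite mxE. Qed.

Lemma tr_rdiag n (a : 'I_n -> R) : \tr (rdiag a) = (\sum_i a i)%:C.
Proof. by rewrite mxtrace_diag Cr_sum; apply: eq_bigr => i _; rewrite mxE. Qed.

Lemma tr_qf_rdiag m n (N : 'M[C]_(m, n)) (a : 'I_m -> R) :
  \tr (N^t* *m rdiag a *m N) = (\sum_i \sum_j nsq (N i j) * a i)%:C.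
Proof.
rewrite mxtrace_mulC mulmxA Cr_sum; apply: eq_bigr => i _.
rewrite mul_mx_diag mxE [in LHS]mxE mulr_suml Cr_sum; apply: eq_bigr => j _.
by rewrite adjE mxE CrM nsqE'.
Qed.

Lemma tr_adjM m n (N : 'M[C]_(m, n)) :
  \tr (N^t* *m N) = (\sum_i \sum_j nsq (N i j))%:C.
Proof.
rewrite -[N^t*]mulmx1 -rdiag1 tr_qf_rdiag; congr (_ %:C).
by apply: eq_bigr => i _; apply: eq_bigr => j _; rewrite mulr1.
Qed.

Lemma adjM_eq0 m n (N : 'M[C]_(m, n)) : Re (\tr (N^t* *m N)) <= 0 -> N = 0.
Proof.
rewrite tr_adjM /= => h.
have /eqP : \sum_i \sum_j nsq (N i j) = 0.
  apply/eqP; rewrite eq_le h /=.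
  by apply: sumr_ge0 => i _; apply: sumr_ge0 => j _; exact: nsq_ge0.
rewrite psumr_eq0 => [/allP h1|i _]; last by apply: sumr_ge0 => j _; exact: nsq_ge0.
apply/matrixP => i j; rewrite mxE; apply: nsq_eq0; apply/eqP.
have := h1 i; rewrite mem_index_enum => /(_ isT).
rewrite psumr_eq0 => [/allP h2|k _]; last exact: nsq_ge0.
by have := h2 j; rewrite mem_index_enum => /(_ isT).
Qed.

Lemma unitP n (V : 'M[C]_n) : V \is unitarymx ->
  V *m V^t* = 1%:M /\ V^t* *m V = 1%:M.
Proof. by move=> /unitarymxP h; split => //; apply: mulmx1C. Qed.

Lemma unit_adj n (V : 'M[C]_n) : V \is unitarymx -> V^t* \is unitarymx.
Proof. by rewrite trmxC_unitary. Qed.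

Lemma unitary_of_iso n (V : 'M[C]_n) : V^t* *m V = 1%:M -> V \is unitarymx.
Proof. by move=> h; apply/unitarymxP; apply: mulmx1C. Qed.

Lemma hermP n (A : 'M[C]_n) : A \is hermsymmx <-> A^t* = A.
Proof.
split; first by move=> /is_hermitianmxP; rewrite expr0 scale1r.
by move=> h; apply/is_hermitianmxP; rewrite expr0 scale1r.
Qed.

(** Entry (i, j) of the hypothesis says that [W i j] vanishes unless a j = b i, and then f (a j) = f
    (b i) as well. *)
Lemma rdiag_intertwine n (W : 'M[C]_n) (a b : 'I_n -> R) (f : R -> R) :
  W *m rdiag a = rdiag b *m W ->
  W *m rdiag (fun i => f (a i)) = rdiag (fun i => f (b i)) *m W.
Proof.
move=> /matrixP WE; apply/matrixP => i j; have := WE i j.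
rewrite !mul_mx_diag !mul_diag_mx !mxE.
have [->|Wn0] := eqVneq (W i j) 0; first by rewrite !mul0r !mulr0.
by rewrite mulrC => /(mulIf Wn0) [->]; rewrite mulrC.
Qed.

(** The functional calculus is defined through one chosen diagonalization; this frees it from the
    choice. The product of the two unitaries intertwines the two diagonal matrices, hence also their
    images under f. *)
Lemma mxfunE n (V : 'M[C]_n) (a : 'I_n -> R) (f : R -> R) :
  V \is unitarymx ->
  mxfun f (V *m rdiag a *m V^t*) = V *m rdiag (fun i => f (a i)) *m V^t*.
Proof.
move=> Vu; have [V1 V2] := unitP Vu.
set A := V *m _ *m _.
have Ah : A \is hermsymmx by apply/hermP; rewrite /A !adjM trmxCK adj_rdiag mulmxA.
have [P1 P2] := unitP (spectral_unitarymx A).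
have PE := invmx_unitary (spectral_unitarymx A).
have e := orthomx_spectralP (hermitian_normalmx Ah).
have dr := hermitian_spectral_diag_real Ah.
set b := fun i => Re (spectral_diag A 0 i).
have bE : diag_mx (spectral_diag A) = rdiag b.
  congr diag_mx; apply/rowP => i; rewrite mxE /b RRe_real //.
  by move/mxOverP : dr; apply.
rewrite /mxfun PE -/(rdiag (fun i => f (b i))).
rewrite PE bE in e.
set P := spectralmx A in e P1 P2 *.
pose W := P *m V.
have WE : W *m rdiag a = rdiag b *m W.
  transitivity (P *m A *m V).
    by rewrite /W /A !mulmxA -[_ *m V^t* *m V]mulmxA V2 mulmx1.
    by rewrite {1}e !mulmxA P1 mul1mx -mulmxA.
have WfE : W *m rdiag (fun i => f (a i)) = rdiag (fun i => f (b i)) *m W.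
  exact: rdiag_intertwine.
have WV : W *m V^t* = P by rewrite /W -mulmxA V1 mulmx1.
have PW : P^t* *m W = V by rewrite /W mulmxA P2 mul1mx.
clearbody W; rewrite -{1}PW -[_ *m rdiag (fun i => f (a i))]mulmxA WfE.
by rewrite -!mulmxA WV.
Qed.

Lemma spectral_perm n (V : 'M[C]_n) (a : 'I_n -> R) (p : 'S_n) :
  V \is unitarymx ->
  col_perm p V \is unitarymx /\
  V *m rdiag a *m V^t* =
  col_perm p V *m rdiag (fun i => a (p i)) *m (col_perm p V)^t*.
Proof.
move=> Vu; have [V1 _] := unitP Vu; split.
  apply/unitarymxP; rewrite -V1; apply/matrixP => i j; rewrite !mxE.
  rewrite [RHS](reindex_inj (@perm_inj _ p)) /=.
  by apply: eq_bigr => k _; rewrite !mxE.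
apply/matrixP => i j; rewrite !mxE [LHS](reindex_inj (@perm_inj _ p)) /=.
by apply: eq_bigr => k _; rewrite !mul_mx_diag !mxE.
Qed.

Lemma herm_lambda_up n (A : 'M[C]_n) : A \is hermsymmx ->
  exists2 V : 'M[C]_n, V \is unitarymx & A = V *m rdiag (lambda_up A) *m V^t*.
Proof.
move=> Ah.
have PE := invmx_unitary (spectral_unitarymx A).
have e := orthomx_spectralP (hermitian_normalmx Ah).
have dr := hermitian_spectral_diag_real Ah.
set b := fun i => Re (spectral_diag A 0 i).
have bE : diag_mx (spectral_diag A) = rdiag b.
  congr diag_mx; apply/rowP => i; rewrite mxE /b RRe_real //.
  by move/mxOverP : dr; apply.
rewrite PE bE in e.
pose s := [tuple b i | i < n].
have sE : eigvals_up A = sort <=%R s by rewrite /eigvals_up.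
have /tuple_permP [p ep] : perm_eq (sort <=%R s) s by rewrite perm_sort.
have [h1 h2] := spectral_perm b p (unit_adj (spectral_unitarymx A)).
exists (col_perm p ((spectralmx A)^t*)); first exact: h1.
rewrite trmxCK -e in h2.
apply: (etrans h2); congr (_ *m _ *m _); apply: rdiag_ext => i.
rewrite /lambda_up sE ep (nth_map i) ?size_enum_ord // nth_ord_enum.
by rewrite tnth_mktuple.
Qed.

Lemma lambda_up_homo n (A : 'M[C]_n) (i j : 'I_n) :
  (i <= j)%N -> lambda_up A i <= lambda_up A j.
Proof.
move=> ij; apply: (sorted_leq_nth le_trans le_refl) => //.
- exact/sort_sorted/le_total.
- by rewrite inE size_sort size_map size_enum_ord.
- by rewrite inE size_sort size_map size_enum_ord.
Qed.

Lemma herm_desc n (A : 'M[C]_n) : A \is hermsymmx ->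
  exists (V : 'M[C]_n) (a : 'I_n -> R), [/\ V \is unitarymx,
    forall i j : 'I_n, (i <= j)%N -> a j <= a i & A = V *m rdiag a *m V^t*].
Proof.
move=> Ah.
have /herm_lambda_up [V Vu e] : - A \is hermsymmx.
  by apply/hermP; move/hermP : Ah => Ah; rewrite -scaleN1r adjZ rmorphN rmorph1 Ah.
exists V, (fun i => - lambda_up (- A) i); split; first exact: Vu.
  by move=> i j ij; rewrite lerN2 lambda_up_homo.
by rewrite -rdiagN mulmxN mulNmx -e opprK.
Qed.

End Basics.

(** * Positive definite matrices *)

Section Positive.
Variable R : realType.
Local Notation C := R[i].
Local Notation Re := (@complex.Re R).

Lemma spec_mul n (V : 'M[C]_n) (a b : 'I_n -> R) : V \is unitarymx ->
  V *m rdiag a *m V^t* *m (V *m rdiag b *m V^t*) =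
  V *m rdiag (fun i => a i * b i) *m V^t*.
Proof.
move=> Vu; have [V1 V2] := unitP Vu.
by rewrite -rdiagM !mulmxA -[_ *m V^t* *m V]mulmxA V2 mulmx1.
Qed.

Lemma spec_ext n (V : 'M[C]_n) (a b : 'I_n -> R) : a =1 b ->
  V *m rdiag a *m V^t* = V *m rdiag b *m V^t*.
Proof. by move=> ab; rewrite (rdiag_ext ab). Qed.

Lemma inv_unique n (A B : 'M[C]_n) : A *m B = 1%:M -> invmx A = B.
Proof.
move=> e; have [uA _] := mulmx1_unit e.
by rewrite -[LHS]mulmx1 -e mulmxA mulVmx // mul1mx.
Qed.

(** The one-parameter group s |-> exp(s A) with A = V diag(h) V^*, that is, a geodesic of the cone
    through 1. Square roots, inverses and powers are all values of it, so that later proofs often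
    generalize over [ray V h] and keep only its group law, its value at 0 and self-adjointness. *)
Definition ray n (V : 'M[C]_n) (h : 'I_n -> R) (s : R) : 'M[C]_n :=
  V *m rdiag (fun i => expR (s * h i)) *m V^t*.

Lemma ray0 n (V : 'M[C]_n) h : V \is unitarymx -> ray V h 0 = 1%:M.
Proof.
move=> Vu; rewrite /ray (@rdiag_ext _ _ _ (fun=> 1)) => [|i].
  by rewrite rdiag1 mulmx1 (unitP Vu).1.
by rewrite mul0r expR0.
Qed.

Lemma rayM n (V : 'M[C]_n) h u v : V \is unitarymx ->
  ray V h u *m ray V h v = ray V h (u + v).
Proof.
move=> Vu; apply: (etrans (spec_mul _ _ Vu)); apply: spec_ext => i.
by rewrite mulrDl expRD.
Qed.

Lemma ray_adj n (V : 'M[C]_n) h s : (ray V h s)^t* = ray V h s.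
Proof. by rewrite /ray !adjM trmxCK adj_rdiag mulmxA. Qed.

Lemma ray1 n (V : 'M[C]_n) h :
  ray V h 1 = V *m rdiag (fun i => expR (h i)) *m V^t*.
Proof. by apply: spec_ext => i; rewrite mul1r. Qed.

Lemma rayN1 n (V : 'M[C]_n) h :
  ray V h (-1) = V *m rdiag (fun i => expR (- h i)) *m V^t*.
Proof. by apply: spec_ext => i; rewrite mulN1r. Qed.

Lemma spec_exp_inv n (V : 'M[C]_n) (h : 'I_n -> R) : V \is unitarymx ->
  V *m rdiag (fun i => expR (h i)) *m V^t* *m
    (V *m rdiag (fun i => expR (- h i)) *m V^t*) = 1%:M.
Proof. by move=> Vu; rewrite -ray1 -rayN1 (rayM _ _ _ Vu) subrr ray0. Qed.

Lemma invmx_ray n (V : 'M[C]_n) h : V \is unitarymx ->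
  invmx (V *m rdiag (fun i => expR (h i)) *m V^t*) = ray V h (-1).
Proof.
by move=> Vu; rewrite -ray1; apply: inv_unique; rewrite rayM // subrr ray0.
Qed.

Lemma mxpow_spec n (V : 'M[C]_n) h (a : R) : V \is unitarymx ->
  mxpow (V *m rdiag (fun i => expR (h i)) *m V^t*) a = ray V h a.
Proof.
move=> Vu; apply: (etrans (mxfunE (fun i => expR (h i)) _ Vu)).
by apply: spec_ext => i; rewrite -expRM mulrC.
Qed.

Lemma mxlog_spec n (V : 'M[C]_n) h : V \is unitarymx ->
  mxlog (V *m rdiag (fun i => expR (h i)) *m V^t*) = V *m rdiag h *m V^t*.
Proof.
move=> Vu; apply: (etrans (mxfunE (fun i => expR (h i)) _ Vu)).
by apply: spec_ext => i; rewrite expRK.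
Qed.

Lemma ltC_real (a : R) : (0 < a%:C) = (0 < a).
Proof. by rewrite -[0]/((0 : R)%:C) ltcR. Qed.

Lemma qf_rdiag m (v : 'cV[C]_m) (a : 'I_m -> R) :
  (v^t* *m rdiag a *m v) 0 0 = (\sum_i nsq (v i 0) * a i)%:C.
Proof.
rewrite -[LHS]trace_mx11 tr_qf_rdiag.
by congr (_ %:C); apply: eq_bigr => i _; rewrite big_ord1.
Qed.

Lemma pd_rdiag m (a : 'I_m -> R) : (forall i, 0 < a i) -> posdefmx (rdiag a).
Proof.
move=> a0; split; first by apply/hermP; rewrite adj_rdiag.
move=> v v0; rewrite qf_rdiag ltC_real.
have [i vi] : exists i, v i 0 != 0 by apply/cV0Pn.
rewrite (bigD1 i) //= ltr_pwDl ?mulr_gt0 ?nsq_gt0 //.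
by apply: sumr_ge0 => j _; rewrite mulr_ge0 ?nsq_ge0 // ltW.
Qed.

Lemma pd_cong n k (A : 'M[C]_n) (N : 'M[C]_(n, k)) (L : 'M[C]_(k, n)) :
  L *m N = 1%:M -> posdefmx A -> posdefmx (N^t* *m A *m N).
Proof.
move=> LN [/hermP Ah Ap]; split.
  by apply/hermP; rewrite !adjM trmxCK Ah mulmxA.
move=> v v0.
have := Ap (N *m v); rewrite adjM !mulmxA; apply.
by apply: contraNneq v0 => e; rewrite -[v]mul1mx -LN -mulmxA e mulmx0.
Qed.

Lemma pd_congu n (A N : 'M[C]_n) :
  N \in unitmx -> posdefmx A -> posdefmx (N^t* *m A *m N).
Proof. by move=> Nu; apply: (@pd_cong _ _ _ _ (invmx N)); rewrite mulVmx. Qed.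

Lemma pd_spec n (V : 'M[C]_n) (h : 'I_n -> R) : V \is unitarymx ->
  posdefmx (V *m rdiag (fun i => expR (h i)) *m V^t*).
Proof.
move=> Vu; have [V1 V2] := unitP Vu.
rewrite -{1}[V]trmxCK; apply: (@pd_cong _ _ _ _ V) => //.
by apply: pd_rdiag => i; exact: expR_gt0.
Qed.

Lemma ray_pd n (V : 'M[C]_n) h s : V \is unitarymx -> posdefmx (ray V h s).
Proof. exact: pd_spec. Qed.

Lemma pd1 n : posdefmx (1%:M : 'M[C]_n).
Proof. by rewrite -rdiag1; apply: pd_rdiag. Qed.

Lemma sandwich n k (V M : 'M[C]_n) (w : 'M[C]_(n, k)) : V^t* *m V = 1%:M ->
  (V *m w)^t* *m (V *m M *m V^t*) *m (V *m w) = w^t* *m M *m w.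
Proof.
move=> V2; rewrite adjM !mulmxA -[_ *m V^t* *m V]mulmxA V2 mulmx1.
by rewrite -[_ *m V^t* *m V]mulmxA V2 mulmx1.
Qed.

Lemma pd_eig_gt0 n (V : 'M[C]_n) (a : 'I_n -> R) i : V \is unitarymx ->
  posdefmx (V *m rdiag a *m V^t*) -> 0 < a i.
Proof.
move=> Vu; have [V1 V2] := unitP Vu => [[_ /(_ (V *m delta_mx i 0))]].
rewrite sandwich //.
rewrite qf_rdiag ltC_real (bigD1 i) //= mxE !eqxx nsq1 mul1r.
rewrite big1 ?addr0 => [|j ji]; last first.
  by rewrite mxE (negbTE ji) /nsq /= expr0n addr0 mul0r.
apply; apply/negP => /eqP e.
have /matrixP/(_ i 0) : V^t* *m (V *m delta_mx i 0 : 'cV_n) = 0 by rewrite e mulmx0.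
by rewrite mulmxA V2 mul1mx !mxE !eqxx => /eqP; rewrite oner_eq0.
Qed.

Lemma pd_desc n (A : 'M[C]_n) : posdefmx A ->
  exists (V : 'M[C]_n) (h : 'I_n -> R), [/\ V \is unitarymx,
    forall i j : 'I_n, (i <= j)%N -> h j <= h i &
    A = V *m rdiag (fun i => expR (h i)) *m V^t*].
Proof.
move=> pA; have [V [a [Vu ad e]]] := herm_desc pA.1.
have pV : posdefmx (V *m rdiag a *m V^t*) by rewrite -e.
have a0 i := pd_eig_gt0 i Vu pV.
exists V, (fun i => ln (a i)); split; first exact: Vu.
  by move=> i j ij; rewrite ler_ln ?posrE ?ad.
by rewrite e; apply: spec_ext => i; rewrite lnK ?posrE.
Qed.

Lemma det_spec n (V : 'M[C]_n) (a : 'I_n -> R) : V \is unitarymx ->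
  \det (V *m rdiag a *m V^t*) = (\prod_i a i)%:C.
Proof.
move=> Vu; have [V1 _] := unitP Vu.
by rewrite !det_mulmx mulrAC -det_mulmx V1 det1 mul1r det_rdiag.
Qed.

Lemma pd_det n (A : 'M[C]_n) : posdefmx A ->
  \det A = (Re (\det A))%:C /\ 0 < Re (\det A).
Proof.
move=> /pd_desc [V [h [Vu _ ->]]]; rewrite det_spec //; split => //=.
by apply: prodr_gt0 => i _; exact: expR_gt0.
Qed.

Lemma pd_unit n (A : 'M[C]_n) : posdefmx A -> A \in unitmx.
Proof.
move=> /pd_det [e h]; rewrite unitmxE unitfE e.
by apply/negP => /eqP [h0]; rewrite h0 ltxx in h.
Qed.

Definition ldet n (A : 'M[C]_n) : R := ln (Re (\det A)).

Lemma det_adj n (A : 'M[C]_n) : \det (A^t*) = (\det A)^*%C.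
Proof. by rewrite det_map_mx det_tr. Qed.

Lemma unitmx_adj n (A : 'M[C]_n) : A \in unitmx -> A^t* \in unitmx.
Proof.
move=> Au; have e : (invmx A)^t* *m A^t* = 1%:M by rewrite -adjM mulmxV // adj1.
by have [] := mulmx1_unit e.
Qed.

Lemma ldet_cong n (A T : 'M[C]_n) : posdefmx A -> T \in unitmx ->
  ldet (T^t* *m A *m T) = ldet A + ln (nsq (\det T)).
Proof.
move=> /pd_det [e h] Tu; rewrite /ldet !det_mulmx det_adj mulrC mulrA -nsqE'.
rewrite e -CrM /= mulrC lnM ?posrE //.
by apply: nsq_gt0; rewrite -unitfE -unitmxE.
Qed.

Lemma ldet_spec n (V : 'M[C]_n) (h : 'I_n -> R) : V \is unitarymx ->
  ldet (V *m rdiag (fun i => expR (h i)) *m V^t*) = \sum_i h i.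
Proof. by move=> Vu; rewrite /ldet det_spec //= -expR_sum expRK. Qed.

Lemma ldet1 n : ldet (1%:M : 'M[C]_n) = 0.
Proof. by rewrite /ldet det1 /= ln1. Qed.

(* Tangent-line bound for ln at the eigenvalues of the compression of A. *)
Lemma tr_log_le_ldet n k (V : 'M[C]_n) (h : 'I_n -> R) (Q : 'M[C]_(n, k)) :
  V \is unitarymx -> Q^t* *m Q = 1%:M ->
  Re (\tr (Q^t* *m (V *m rdiag h *m V^t*) *m Q)) <=
  ldet (Q^t* *m (V *m rdiag (fun i => expR (h i)) *m V^t*) *m Q).
Proof.
move=> Vu Q1; have [V1 V2] := unitP Vu.
set A := V *m rdiag (fun i => expR _) *m _.
have pA : posdefmx (Q^t* *m A *m Q) by apply: (pd_cong Q1); exact: pd_spec.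
have [W [m [Wu _ e]]] := pd_desc pA.
have [W1 W2] := unitP Wu.
rewrite e (ldet_spec m Wu).
have [N Ndef] : exists N, N = V^t* *m Q *m W by eexists.
have NE (b : 'I_n -> R) :
    N^t* *m rdiag b *m N = W^t* *m (Q^t* *m (V *m rdiag b *m V^t*) *m Q) *m W.
  by rewrite Ndef !adjM trmxCK !mulmxA.
have N1 j : \sum_i nsq (N i j) = 1.
  have /matrixP/(_ j j) : N^t* *m N = 1%:M.
    rewrite Ndef !adjM trmxCK !mulmxA -[_ *m V *m _]mulmxA V1 mulmx1.
    by rewrite -[_ *m Q^t* *m Q]mulmxA Q1 mulmx1.
  rewrite [RHS]mxE eqxx mulr1n [LHS]mxE => /(congr1 Re); rewrite /= => <-.
  by rewrite Re_sum; apply: eq_bigr => i _; rewrite adjE -nsqE.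
have N2 j : \sum_i nsq (N i j) * expR (h i) = expR (m j).
  have /matrixP/(_ j j) : N^t* *m rdiag (fun i => expR (h i)) *m N =
      rdiag (fun i => expR (m i)).
    by rewrite NE e !mulmxA W2 mul1mx -mulmxA W2 mulmx1.
  rewrite [RHS]rdiagE eqxx mulr1n => /(congr1 Re) /= <-.
  rewrite [in RHS]mxE Re_sum; apply: eq_bigr => i _.
  by rewrite mul_mx_diag mxE adjE mxE mulrAC -nsqE -CrM.
have -> : \tr (Q^t* *m (V *m rdiag h *m V^t*) *m Q) = \tr (N^t* *m rdiag h *m N).
  by rewrite NE [RHS]mxtrace_mulC [W *m (_ *m _)]mulmxA W1 mul1mx.
rewrite tr_qf_rdiag /= exchange_big /=; apply: ler_sum => j _.
suff : \sum_i nsq (N i j) * h i <=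
    \sum_i nsq (N i j) * (m j - 1 + expR (h i) * expR (- m j)).
  move/le_trans; apply.
  under eq_bigr do rewrite mulrDr mulrA.
  rewrite big_split /= -!mulr_suml N1 N2 mul1r expRxMexpNx_1; lra.
apply: ler_sum => i _; apply: ler_wpM2l; first exact: nsq_ge0.
have := expR_ge1Dx (h i - m j); rewrite expRD; lra.
Qed.

(** Polar decomposition: T is the square root of N^* N, and Q is N times the inverse of T. *)
Lemma on_frame n k (N : 'M[C]_(n, k)) (L : 'M[C]_(k, n)) : L *m N = 1%:M ->
  exists (Q : 'M[C]_(n, k)) (T : 'M[C]_k),
    [/\ Q^t* *m Q = 1%:M, T \in unitmx & N = Q *m T].
Proof.
move=> LN; have := pd_cong LN (pd1 n); rewrite mulmx1 => /pd_desc [W [h [Wu _ e]]].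
have [W1 W2] := unitP Wu.
have NN : N^t* *m N = ray W h 1 by rewrite ray1.
have SM u v := rayM h u v Wu; have S0 := ray0 h Wu; have Sad := ray_adj W h.
move: (ray W h) NN SM S0 Sad => S NN SM S0 Sad.
exists (N *m S (- 2^-1)), (S 2^-1); split.
- rewrite adjM Sad !mulmxA -[_ *m N^t* *m N]mulmxA NN !SM.
  by rewrite (_ : _ - 2^-1 = 0) ?S0 //; lra.
- by have [] := mulmx1_unit (etrans (SM 2^-1 (- 2^-1)) (etrans (congr1 S (subrr _)) S0)).
- by rewrite -mulmxA SM addNr S0 mulmx1.
Qed.

(** The difference of the two sides is the squared Hilbert-Schmidt norm of P M, where P = 1 - Q Q^*
    is an orthogonal projection. *)
Lemma iso_contr n k m (Q : 'M[C]_(n, k)) (M : 'M[C]_(n, m)) :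
  Q^t* *m Q = 1%:M ->
  Re (\tr ((Q^t* *m M)^t* *m (Q^t* *m M))) <= Re (\tr (M^t* *m M)).
Proof.
move=> Q1; pose P := 1%:M - Q *m Q^t*.
have PP : P^t* *m P = P.
  rewrite /P adjD adj1 -scaleN1r adjZ rmorphN1 adjM trmxCK scaleN1r.
  rewrite mulmxBl mul1mx mulmxBr mulmx1 mulmxA -[Q *m Q^t* *m Q]mulmxA Q1 mulmx1.
  by rewrite subrr subr0.
have : 0 <= Re (\tr ((P *m M)^t* *m (P *m M))).
  rewrite tr_adjM /=; apply: sumr_ge0 => i _; apply: sumr_ge0 => j _.
  exact: nsq_ge0.
rewrite adjM !mulmxA -[_ *m P^t* *m P]mulmxA PP.
rewrite /P mulmxBr mulmx1 mulmxBl linearB /= ReD ReN subr_ge0.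
by rewrite adjM trmxCK !mulmxA.
Qed.

(** N is unchanged by the projection B B^* onto its row space, so its squared norm is that of N B;
    contractivity bounds this by the squared norm of the orthonormal frame B, which is the rank. *)
Lemma contr_tr_le_rank m n (N : 'M[C]_(m, n)) :
  (forall p (B : 'M[C]_(n, p)),
     Re (\tr ((N *m B)^t* *m (N *m B))) <= Re (\tr (B^t* *m B))) ->
  Re (\tr (N^t* *m N)) <= (\rank N)%:R.
Proof.
move=> Nc.
have rf := row_base_free N.
have [B [T [B1 Tu e]]] : exists (B : 'M[C]_(n, \rank N)) (T : 'M[C]_(\rank N)),
    [/\ B^t* *m B = 1%:M, T \in unitmx & (row_base N)^t* = B *m T].
  case/row_freeP: rf => D hD.
  by apply: (@on_frame _ _ _ (D^t*)); rewrite -adjM hD adj1.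
have NB : N *m B *m B^t* = N.
  have NE : N = col_base N *m T^t* *m B^t*.
    by rewrite -mulmxA -adjM -e trmxCK mulmx_base.
  transitivity (col_base N *m T^t* *m B^t* *m B *m B^t*).
    by congr (_ *m _ *m _); exact: NE.
  by rewrite -[_ *m B^t* *m B]mulmxA B1 mulmx1 -NE.
have -> : Re (\tr (N^t* *m N)) = Re (\tr ((N *m B)^t* *m (N *m B))).
  have -> : \tr (N^t* *m N) = \tr (N^t* *m (N *m B *m B^t*)) by rewrite NB.
  by rewrite [N^t* *m _]mulmxA mxtrace_mulC [in RHS]adjM -[in RHS]mulmxA.
by apply: (le_trans (Nc _ B)); rewrite B1 mxtrace1 -(rmorph_nat (@real_complex_def R _)).
Qed.

Lemma block_tr_le_rank n k m (Q : 'M[C]_(n, k)) (Phi : 'M[C]_(n, m)) :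
  Q^t* *m Q = 1%:M -> Phi^t* *m Phi = 1%:M ->
  Re (\tr ((Q^t* *m Phi)^t* *m (Q^t* *m Phi))) <= (\rank (Q^t* *m Phi))%:R.
Proof.
move=> Q1 P1; apply: contr_tr_le_rank => p B; rewrite -mulmxA.
apply: (le_trans (iso_contr _ Q1)).
by rewrite adjM mulmxA -[_ *m Phi^t* *m Phi]mulmxA P1 mulmx1.
Qed.

(** Testing the hypothesis on the eigenvectors of Y shows that all its eigenvalues are at least
    1. *)
Lemma ldet_ge0 n (Y : 'M[C]_n) : posdefmx Y ->
  (forall v : 'cV[C]_n, Re ((v^t* *m v) 0 0) <= Re ((v^t* *m Y *m v) 0 0)) ->
  0 <= ldet Y.
Proof.
move=> /pd_desc [V [h [Vu _ ->]]] hv; have [V1 V2] := unitP Vu.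
rewrite ldet_spec //; apply: sumr_ge0 => i _.
have := hv (V *m delta_mx i 0).
rewrite sandwich // adjM -mulmxA (mulmxA _ V) V2 mul1mx.
rewrite -{1}[(delta_mx i 0)^t*]mulmx1 -rdiag1 !qf_rdiag /=.
have H (b : 'I_n -> R) : \sum_j nsq ((delta_mx i 0 : 'cV[C]_n) j 0) * b j = b i.
  rewrite (bigD1 i) //= mxE !eqxx nsq1 mul1r big1 ?addr0 // => j ji.
  by rewrite mxE (negbTE ji) /nsq /= expr0n addr0 mul0r.
by rewrite !H -{1}(@expR0 R) ler_expR.
Qed.

End Positive.

(** * Ultralimits and first-order expansions *)

Section Limits.
Variable R : realType.
Local Notation C := R[i].
Local Notation Re := (@complex.Re R).
Local Notation Im := (@complex.Im R).
Local Open Scope classical_set_scope.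

Variable U : set_system nat.
Hypothesis UF : UltraFilter U.
Hypothesis UI : \oo `<=` U.

(** Convergence along U. Since U is an ultrafilter, boundedness alone gives a limit ([rcv_bounded]);
    since it refines the eventual filter, ordinary limits are kept ([rcv_inv_nat]). *)
Definition rcv (u : nat -> R) (l : R) : Prop := u @ U --> l.

Lemma rcv_cst (l : R) : rcv (fun=> l) l.
Proof. exact: cvg_cst. Qed.

Lemma rcvD u v l m : rcv u l -> rcv v m -> rcv (fun n => u n + v n) (l + m).
Proof. exact: cvgD. Qed.

Lemma rcvM u v l m : rcv u l -> rcv v m -> rcv (fun n => u n * v n) (l * m).
Proof. exact: cvgM. Qed.

Lemma rcvN u l : rcv u l -> rcv (fun n => - u n) (- l).
Proof. exact: cvgN. Qed.

Lemma rcv_cont f u l : {for l, continuous f} -> rcv u l ->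
  rcv (fun n => f (u n)) (f l).
Proof. by move=> fc ul; exact: continuous_cvg. Qed.

Lemma rcv_exp u l : rcv u l -> rcv (fun n => expR (u n)) (expR l).
Proof. by apply: rcv_cont; exact: continuous_expR. Qed.

Lemma rcv_ln u l : 0 < l -> rcv u l -> rcv (fun n => ln (u n)) (ln l).
Proof. by move=> l0; apply: rcv_cont; exact: continuous_ln. Qed.

Lemma rcv_sum (I : finType) (u : I -> nat -> R) (l : I -> R) :
  (forall i, rcv (u i) (l i)) ->
  rcv (fun n => \sum_i u i n) (\sum_i l i).
Proof.
move=> h; elim: (index_enum I) => [|i r hy].
  by under eq_fun do rewrite big_nil; rewrite big_nil; exact: rcv_cst.
by under eq_fun do rewrite big_cons; rewrite big_cons; apply: rcvD.
Qed.

Lemma rcv_le u l m : rcv u l -> U [set n | u n <= m] -> l <= m.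
Proof.
move=> ul h; apply: (@closed_cvg _ _ U _ u [set x | x <= m]) => //.
Qed.

Lemma rcv_ge u l m : rcv u l -> U [set n | m <= u n] -> m <= l.
Proof.
move=> /rcvN ul h; rewrite -lerN2; apply: (rcv_le ul).
by apply: filterS h => n /=; rewrite lerN2.
Qed.

Lemma ultraT (P : nat -> Prop) : (forall n, P n) -> U [set n | P n].
Proof. by move=> h; apply: filterS filterT => n _; exact: h. Qed.

Lemma U_large (N : nat) : U [set n | (N <= n)%N].
Proof. by apply: UI; exists N. Qed.

Lemma rcv_uniq u l m : rcv u l -> rcv u m -> l = m.
Proof. by move=> h1 h2; exact: (cvg_unique (@norm_hausdorff _ _) h1 h2). Qed.

Lemma ultra_fmap (T : Type) (u : nat -> T) : UltraFilter (u @ U).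
Proof.
split; first exact: fmap_proper_filter.
move=> G GP uG; apply/seteqP; split => // A GA.
have [//|UA] := in_ultra_setVsetC (u @^-1` A) UF.
have GnA : G (~` A) by exact: uG.
by have /filter_ex [x [? ?]] : G (A `&` ~` A) by exact: filterI.
Qed.

Lemma rcv_bounded u (m : R) : (forall n, `|u n| <= m) -> exists l, rcv u l.
Proof.
move=> h; have := @segment_compact R (- m) m; rewrite compact_ultra.
have h' : (u @ U) `[- m, m]%classic.
  by apply: (@filterS _ U _ setT) filterT => n _ /=; rewrite in_itv /= -ler_norml.
move=> hc; have [l [_ ul]] := hc (u @ U) (ultra_fmap u) h'; by exists l.
Qed.

Lemma rcv_inv_nat : rcv (fun n => n.+1%:R^-1) 0.
Proof.
have := @cvg_harmonic R; rewrite /rcv => h.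
by apply: cvg_trans h; exact: (cvg_app _ UI).
Qed.

Definition ccv (u : nat -> C) (l : C) : Prop :=
  rcv (fun n => Re (u n)) (Re l) /\ rcv (fun n => Im (u n)) (Im l).

Lemma ccv_cst l : ccv (fun=> l) l.
Proof. by split; exact: rcv_cst. Qed.

Lemma ccvD u v l m : ccv u l -> ccv v m -> ccv (fun n => u n + v n) (l + m).
Proof.
move=> [h1 h2] [h3 h4]; split.
  by under eq_fun do rewrite ReD; rewrite ReD; exact: rcvD.
by under eq_fun do rewrite ImD; rewrite ImD; exact: rcvD.
Qed.

Lemma ccvM u v l m : ccv u l -> ccv v m -> ccv (fun n => u n * v n) (l * m).
Proof.
move=> [h1 h2] [h3 h4]; split.
  under eq_fun do rewrite ReM; rewrite ReM.
  by apply: rcvD; [exact: rcvM | apply: rcvN; exact: rcvM].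
by under eq_fun do rewrite ImM; rewrite ImM; apply: rcvD; exact: rcvM.
Qed.

Lemma ccv_conj u l : ccv u l -> ccv (fun n => (u n)^*%C) l^*%C.
Proof.
move=> [h1 h2]; split; first by under eq_fun do rewrite Re_conj; rewrite Re_conj.
by under eq_fun do rewrite Im_conj; rewrite Im_conj; exact: rcvN.
Qed.

Lemma ccv_real u l : rcv u l -> ccv (fun n => (u n)%:C) l%:C.
Proof. by split => //=; exact: rcv_cst. Qed.

Lemma ccv_sum (I : finType) (u : I -> nat -> C) (l : I -> C) :
  (forall i, ccv (u i) (l i)) -> ccv (fun n => \sum_i u i n) (\sum_i l i).
Proof.
move=> h; elim: (index_enum I) => [|i r hy].
  by under eq_fun do rewrite big_nil; rewrite big_nil; exact: ccv_cst.
by under eq_fun do rewrite big_cons; rewrite big_cons; apply: ccvD.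
Qed.

Lemma ccv_prod (I : finType) (u : I -> nat -> C) (l : I -> C) :
  (forall i, ccv (u i) (l i)) -> ccv (fun n => \prod_i u i n) (\prod_i l i).
Proof.
move=> h; elim: (index_enum I) => [|i r hy].
  by under eq_fun do rewrite big_nil; rewrite big_nil; exact: ccv_cst.
by under eq_fun do rewrite big_cons; rewrite big_cons; apply: ccvM.
Qed.

Lemma ccv_uniq u l m : ccv u l -> ccv u m -> l = m.
Proof. by move=> [? ?] [? ?]; apply: eqC; apply: rcv_uniq; eassumption. Qed.

Definition mcv m n (A : nat -> 'M[C]_(m, n)) (L : 'M[C]_(m, n)) : Prop :=
  forall i j, ccv (fun k => A k i j) (L i j).

Lemma mcv_cst m n (L : 'M[C]_(m, n)) : mcv (fun=> L) L.
Proof. by move=> i j; exact: ccv_cst. Qed.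

Lemma mcvM m n p (A : nat -> 'M[C]_(m, n)) (B : nat -> 'M[C]_(n, p)) L M :
  mcv A L -> mcv B M -> mcv (fun k => A k *m B k) (L *m M).
Proof.
move=> h1 h2 i j; under eq_fun do rewrite mxE; rewrite mxE.
by apply: ccv_sum => k; exact: ccvM.
Qed.

Lemma mcv_adj m n (A : nat -> 'M[C]_(m, n)) L :
  mcv A L -> mcv (fun k => (A k)^t*) (L^t*).
Proof.
by move=> h i j; under eq_fun do rewrite adjE; rewrite adjE; exact: ccv_conj.
Qed.

Lemma mcvZ m n (c : R) (A : nat -> 'M[C]_(m, n)) L :
  mcv A L -> mcv (fun k => c%:C *: A k) (c%:C *: L).
Proof.
move=> h i j; under eq_fun do rewrite mxE; rewrite mxE.
by apply: ccvM => //; exact: ccv_cst.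
Qed.

Lemma mcv_sum (I : finType) m n (A : I -> nat -> 'M[C]_(m, n)) L :
  (forall i, mcv (A i) (L i)) -> mcv (fun k => \sum_i A i k) (\sum_i L i).
Proof.
move=> h i j; under eq_fun do rewrite summxE; rewrite summxE.
by apply: ccv_sum => k; exact: h.
Qed.

Lemma mcv_rdiag n (a : nat -> 'I_n -> R) l :
  (forall i, rcv (a^~ i) (l i)) -> mcv (fun k => rdiag (a k)) (rdiag l).
Proof.
move=> h i j; under eq_fun do rewrite rdiagE; rewrite rdiagE.
by case: (i == j); [exact: ccv_real | exact: ccv_cst].
Qed.

Lemma mcv_det n (A : nat -> 'M[C]_n) L :
  mcv A L -> ccv (fun k => \det (A k)) (\det L).
Proof.
move=> h; rewrite /determinant; apply: ccv_sum => s.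
by apply: ccvM; [exact: ccv_cst | apply: ccv_prod => i; exact: h].
Qed.

Lemma mcv_uniq m n (A : nat -> 'M[C]_(m, n)) L M : mcv A L -> mcv A M -> L = M.
Proof. by move=> h1 h2; apply/matrixP => i j; exact: ccv_uniq. Qed.

(** Compactness of the unitary group: the columns have norm 1, so the entries are bounded and
    converge, and V V^* = 1 passes to the limit. *)
Lemma mcv_unitary n (V : nat -> 'M[C]_n) : (forall k, V k \is unitarymx) ->
  exists2 L, L \is unitarymx & mcv V L.
Proof.
move=> Vu.
have bnd k i j : nsq (V k i j) <= 1.
  have [_ /matrixP/(_ j j)] := unitP (Vu k).
  rewrite [RHS]mxE eqxx mulr1n [LHS]mxE => /(congr1 Re).
  rewrite Re_sum (bigD1 i) //= adjE -nsqE /= => <-.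
  rewrite lerDl; apply: sumr_ge0 => l _; rewrite adjE -nsqE /=; exact: nsq_ge0.
have sq (x y : R) : x ^+ 2 + y ^+ 2 <= 1 -> `|x| <= 1.
  move=> h; rewrite -(@ler_pXn2r _ 2) ?nnegrE // expr1n real_normK ?num_real //.
  by have := sqr_ge0 y; lra.
have /choice [L hL] : forall ij : 'I_n * 'I_n, exists l, ccv (fun k => V k ij.1 ij.2) l.
  move=> [i j] /=.
  have [x hx] : exists x, rcv (fun k => Re (V k i j)) x.
    by apply: (@rcv_bounded _ 1) => k; apply: sq (bnd k i j).
  have [y hy] : exists x, rcv (fun k => Im (V k i j)) x.
    apply: (@rcv_bounded _ 1) => k.
    by apply: (sq _ (Re (V k i j))); rewrite addrC; exact: bnd.
  by exists (x +i* y).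
have VL : mcv V (\matrix_(i, j) L (i, j)) by move=> i j; rewrite mxE; exact: (hL (i, j)).
exists (\matrix_(i, j) L (i, j)) => //; apply/unitarymxP.
apply: (mcv_uniq (mcvM VL (mcv_adj VL))).
under eq_fun do rewrite (unitP (Vu _)).1; exact: mcv_cst.
Qed.

Lemma rcv_vec n (h : nat -> 'I_n -> R) (m : R) :
  (forall k i, `|h k i| <= m) -> exists l, forall i, rcv (h^~ i) (l i).
Proof.
move=> hm; have /choice [l hl] : forall i, exists x, rcv (h^~ i) x.
  by move=> i; apply: (@rcv_bounded _ m) => k.
by exists l.
Qed.

End Limits.

Lemma exists_ultra : exists U : set_system nat, UltraFilter U /\ (\oo `<=` U)%classic.
Proof. by have [U [? ?]] := ultraFilterLemma (@eventually_filter); exists U. Qed.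

(** The direct method. The last hypothesis packages compactness of the sublevel sets and continuity
    of f, so that no topology on T is required and T may consist of tuples of spectral data. *)
Lemma attain_min (R : realType) (U : set_system nat) (T : Type) (D : T -> Prop)
    (f : T -> R) :
  UltraFilter U -> (\oo `<=` U)%classic -> (exists x, D x) ->
  (forall x : nat -> T, (forall n, D (x n)) -> (exists m, forall n, f (x n) <= m) ->
     exists2 y, D y & rcv U (fun n => f (x n)) (f y)) ->
  exists2 y, D y & forall x, D x -> f y <= f x.
Proof.
move=> UF UI [x0 Dx0] H.
(* A sequence of points with f (x n) <= - n has values bounded above, so the hypothesis would give
   these values a finite limit. *)
have lb : exists m, forall x, D x -> m <= f x.
  apply: contrapT => /forallNP nb.
  have /choice [x hx] : forall n : nat, exists x, D x /\ f x <= - n%:R.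
    move=> n; have /existsNP [x /not_implyP [Dx /negP]] := nb (- n%:R).
    by rewrite -ltNge => /ltW ?; exists x.
  have [|y Dy hy] := H x (fun n => (hx n).1).
    by exists 0 => n; rewrite (le_trans (hx n).2) // oppr_le0.
  have [N hN] : exists N : nat, - f y < N%:R.
    exists (Num.truncn `|f y|).+1; apply: (le_lt_trans (ler_norm _)).
    by rewrite normrN truncnS_gt.
  suff : f y <= - N%:R by lra.
  apply: (rcv_le UF hy); apply: filterS (U_large UI N) => n /= Nn.
  by rewrite (le_trans (hx n).2) // lerN2 ler_nat.
pose S := [set r | exists2 x, D x & r = f x]%classic.
have Si : has_inf S.
  split; first by exists (f x0), x0.
  by case: lb => m hm; exists m => _ [x Dx ->]; exact: hm.
have /choice [x hx] : forall n : nat, exists x, D x /\ f x < inf S + n.+1%:R^-1.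
  move=> n; have [|r [x Dx ->] hr] := @inf_adherent R S n.+1%:R^-1 _ Si.
    by rewrite invr_gt0.
  by exists x.
have [|y Dy hy] := H x (fun n => (hx n).1).
  exists (inf S + 1) => n; rewrite ltW // (lt_le_trans (hx n).2) // lerD2l.
  by rewrite invf_le1 // ler1n.
exists y => // z Dz.
apply: (@le_trans _ _ (inf S)); last by apply: ge_inf; [exact: Si.2 | exists z].
have h0 : rcv U (fun n => f (x n) - n.+1%:R^-1) (f y - 0).
  by apply: rcvD => //; apply: rcvN; exact: rcv_inv_nat.
rewrite -[f y]subr0; apply: (rcv_le UF h0); apply: ultraT => n.
by rewrite lerBlDr ltW //; exact: (hx n).2.
Qed.

(** * One-sided first-order expansions at 0 *)

Section Jets.
Variable R : realType.
Local Notation C := R[i].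
Local Notation Re := (@complex.Re R).
Local Notation Im := (@complex.Im R).

(** A right derivative at 0 with a quadratic remainder on the whole of [0, 1]: enough to read off
    the sign of the derivative at a minimum, and stable under sums and products by elementary
    estimates. *)
Definition rjet (f : R -> R) (a b : R) : Prop :=
  exists K, forall s, 0 <= s <= 1 -> `|f s - (a + s * b)| <= K * s ^+ 2.

Lemma rjet_affine a b : rjet (fun s => a + s * b) a b.
Proof. by exists 0 => s _; rewrite subrr normr0 mul0r. Qed.

Lemma rjet_cst a : rjet (fun=> a) a 0.
Proof. by exists 0 => s _; rewrite mulr0 addr0 subrr normr0 mul0r. Qed.

Lemma rjet_eq (f : R -> R) a b a' b' :
  rjet f a b -> a = a' -> b = b' -> rjet f a' b'.
Proof. by move=> h <- <-. Qed.

Lemma rjetD f g a b c d :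
  rjet f a b -> rjet g c d -> rjet (fun s => f s + g s) (a + c) (b + d).
Proof.
move=> [K hK] [K' hK']; exists (K + K') => s hs.
have -> : f s + g s - (a + c + s * (b + d)) =
  (f s - (a + s * b)) + (g s - (c + s * d)) by ring.
by rewrite (le_trans (ler_normD _ _)) // mulrDl lerD ?hK ?hK'.
Qed.

Lemma rjetN f a b : rjet f a b -> rjet (fun s => - f s) (- a) (- b).
Proof.
move=> [K hK]; exists K => s hs.
have -> : - f s - (- a + s * - b) = - (f s - (a + s * b)) by ring.
by rewrite normrN hK.
Qed.

Lemma rjetM f g a b c d : rjet f a b -> rjet g c d ->
  rjet (fun s => f s * g s) (a * c) (a * d + b * c).
Proof.
move=> [K hK] [K' hK'].
(* One summand for each of the four error terms in the expansion of f s * g s below; the last one is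
   of order s^4 and is reduced to s^2 by s <= 1. *)
exists (`|b * d| + K * (`|c| + `|d|) + K' * (`|a| + `|b|) + K * K') => s hs.
set e := f s - (a + s * b); set e' := g s - (c + s * d).
have [he he'] : `|e| <= K * s ^+ 2 /\ `|e'| <= K' * s ^+ 2 by split; [exact: hK|exact: hK'].
have -> : f s * g s - (a * c + s * (a * d + b * c)) =
   s ^+ 2 * (b * d) + e * (c + s * d) + e' * (a + s * b) + e * e'.
  by rewrite /e /e'; ring.
have bd (x y : R) : `|x + s * y| <= `|x| + `|y|.
  rewrite (le_trans (ler_normD _ _)) // lerD2l normrM ger0_norm; last by lra.
  by rewrite ler_piMl //; lra.
have s20 : 0 <= s ^+ 2 by exact: sqr_ge0.
have s21 : s ^+ 2 <= 1 by move: hs => /andP[? ?]; rewrite exprn_ile1.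
apply: le_trans (ler_normD _ _) _; rewrite [leRHS]mulrDl; apply: lerD.
  apply: le_trans (ler_normD _ _) _; rewrite [leRHS]mulrDl; apply: lerD.
    apply: le_trans (ler_normD _ _) _; rewrite [leRHS]mulrDl; apply: lerD.
      by rewrite normrM ger0_norm // mulrC.
    by rewrite normrM mulrAC; apply: ler_pM.
  by rewrite normrM mulrAC; apply: ler_pM.
have p0 : 0 <= (K * s ^+ 2) * (K' * s ^+ 2).
  by apply: mulr_ge0; [exact: le_trans he|exact: le_trans he'].
rewrite normrM; apply: (@le_trans _ _ ((K * s ^+ 2) * (K' * s ^+ 2))).
  exact: ler_pM.
have [s0|s0] := eqVneq s 0; first by rewrite s0 expr0n /= !mulr0.
have s2p : 0 < s ^+ 2 by rewrite lt_def s20 expf_neq0.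
move: p0; have -> : (K * s ^+ 2) * (K' * s ^+ 2) = s ^+ 2 * (K * K' * s ^+ 2).
  by ring.
by rewrite pmulr_rge0 // => p0; rewrite ler_piMl.
Qed.

Lemma rjet_sum (J : finType) (f : J -> R -> R) (a b : J -> R) :
  (forall i, rjet (f i) (a i) (b i)) ->
  rjet (fun s => \sum_i f i s) (\sum_i a i) (\sum_i b i).
Proof.
move=> h; elim: (index_enum J) => [|i r hy].
  by under eq_fun do rewrite big_nil; rewrite !big_nil; exact: rjet_cst.
by under eq_fun do rewrite big_cons; rewrite !big_cons; apply: rjetD.
Qed.

Lemma rjet_exp t : rjet (fun s => expR (s * t)) 1 t.
Proof.
exists (t ^+ 2 * expR `|t|) => s /andP[s0 s1].
set x := s * t; have h1 := expR_ge1Dx x; have h2 := expR_ge1Dx (- x).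
have ep := expR_gt0 x; have e1 := expRxMexpNx_1 x.
rewrite ger0_norm; last lra.
have h3 : expR x - 1 <= x * expR x by nra.
have -> : t ^+ 2 * expR `|t| * s ^+ 2 = x ^+ 2 * expR `|t| by rewrite /x; ring.
have e0 : 1 <= expR `|t| by rewrite -[1](@expR0 R) ler_expR.
have ex : expR x <= expR `|t|.
  rewrite ler_expR /x (le_trans (ler_norm _)) // normrM ger0_norm //.
  by rewrite ler_piMl.
have h4 : expR x - 1 - x <= x * (expR x - 1) by nra.
have x2 := sqr_ge0 x.
have [xp|xn] := leP 0 x.
  have : expR x - 1 - x <= x ^+ 2 * expR x by nra.
  nra.
have : expR x - 1 - x <= x ^+ 2 by nra.
nra.
Qed.

Lemma rjet_ge0 f b : rjet f 0 b -> (forall s, 0 < s <= 1 -> 0 <= f s) -> 0 <= b.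
Proof.
move=> [K hK] f0; rewrite leNgt; apply/negP => b0.
have K0 : 0 <= K.
  have /hK : 0 <= (1 : R) <= 1 by rewrite ler01 lexx.
  by rewrite expr1n mulr1; apply: le_trans.
(* With this s one has K s < - b, so that the linear term s b outweighs the remainder K s^2 and f s
   would be negative. *)
pose s := - b / (- b + K + 1).
have dp : 0 < - b + K + 1 by lra.
have sp : 0 < s by rewrite /s divr_gt0 //; lra.
have s1 : s <= 1 by rewrite /s ler_pdivrMr //; lra.
have sE : s * (- b + K + 1) = - b by rewrite /s mulfVK // gt_eqF.
have /f0 h1 : 0 < s <= 1 by rewrite sp.
have /hK /ler_normlP [_] : 0 <= s <= 1 by rewrite ltW.
rewrite add0r => h2.
have : s * (- b) <= s * (K * s) by nra.
rewrite ler_pM2l // => h3; nra.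
Qed.

Definition cjet (f : R -> C) (a b : C) : Prop :=
  rjet (fun s => Re (f s)) (Re a) (Re b) /\ rjet (fun s => Im (f s)) (Im a) (Im b).

Lemma cjet_cst a : cjet (fun=> a) a 0.
Proof. by split; exact: rjet_cst. Qed.

Lemma cjetD f g a b c d :
  cjet f a b -> cjet g c d -> cjet (fun s => f s + g s) (a + c) (b + d).
Proof.
move=> [h1 h2] [h3 h4]; split.
  by under eq_fun do rewrite ReD; rewrite !ReD; exact: rjetD.
by under eq_fun do rewrite ImD; rewrite !ImD; exact: rjetD.
Qed.

Lemma cjetM f g a b c d : cjet f a b -> cjet g c d ->
  cjet (fun s => f s * g s) (a * c) (a * d + b * c).
Proof.
move=> [h1 h2] [h3 h4]; split.
  under eq_fun do rewrite ReM; rewrite !(ReM, ReD).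
  have := rjetD (rjetM h1 h3) (rjetN (rjetM h2 h4)).
  by congr rjet; ring.
under eq_fun do rewrite ImM; rewrite !(ImM, ImD).
have := rjetD (rjetM h1 h4) (rjetM h2 h3).
by congr rjet; ring.
Qed.

Lemma cjet_real f a b : rjet f a b -> cjet (fun s => (f s)%:C) a%:C b%:C.
Proof. by split => //=; exact: rjet_cst. Qed.

Lemma cjet_sum (I : finType) (f : I -> R -> C) (a b : I -> C) :
  (forall i, cjet (f i) (a i) (b i)) ->
  cjet (fun s => \sum_i f i s) (\sum_i a i) (\sum_i b i).
Proof.
move=> h; elim: (index_enum I) => [|i r hy].
  by under eq_fun do rewrite big_nil; rewrite !big_nil; exact: cjet_cst.
by under eq_fun do rewrite big_cons; rewrite !big_cons; apply: cjetD.
Qed.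

Definition mjet m n (A : R -> 'M[C]_(m, n)) (A0 A1 : 'M[C]_(m, n)) : Prop :=
  forall i j, cjet (fun s => A s i j) (A0 i j) (A1 i j).

Lemma mjet_cst m n (A : 'M[C]_(m, n)) : mjet (fun=> A) A 0.
Proof. by move=> i j; rewrite mxE; exact: cjet_cst. Qed.

Lemma mjetM m n p (A : R -> 'M[C]_(m, n)) (B : R -> 'M[C]_(n, p)) A0 A1 B0 B1 :
  mjet A A0 A1 -> mjet B B0 B1 ->
  mjet (fun s => A s *m B s) (A0 *m B0) (A0 *m B1 + A1 *m B0).
Proof.
move=> h1 h2 i j; under eq_fun do rewrite mxE; rewrite !mxE -big_split /=.
by apply: cjet_sum => k; exact: cjetM.
Qed.

Lemma mjet_tr n (A : R -> 'M[C]_n) A0 A1 :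
  mjet A A0 A1 -> rjet (fun s => Re (\tr (A s))) (Re (\tr A0)) (Re (\tr A1)).
Proof.
move=> h; suff [] : cjet (fun s => \tr (A s)) (\tr A0) (\tr A1) by [].
by apply: cjet_sum => i; exact: h.
Qed.

Lemma mjet_exp n (Z : 'M[C]_n) (t : 'I_n -> R) : Z \is unitarymx ->
  mjet (fun s => Z *m rdiag (fun i => expR (s * t i)) *m Z^t*)
    1%:M (Z *m rdiag t *m Z^t*).
Proof.
move=> Zu; have [Z1 Z2] := unitP Zu.
have h : mjet (fun s => rdiag (fun i => expR (s * t i))) 1%:M (rdiag t).
  move=> i j; under eq_fun do rewrite rdiagE; rewrite rdiagE mxE.
  by case: (i == j); [apply: cjet_real; exact: rjet_exp | exact: cjet_cst].
have := mjetM (mjetM (mjet_cst Z) h) (mjet_cst (Z^t*)).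
by rewrite mulmx0 mul0mx mulmx1 Z1 addr0 add0r.
Qed.

End Jets.

(** * Log-determinants along geodesic rays *)

(* Row i is kept when it is not in the span of the rows above it. *)
Lemma greedy_rows (F : fieldType) n k (N : 'M[F]_(n, k)) : \rank N = k ->
  exists f : 'I_k -> 'I_n, [/\ injective f, rowsub f N \in unitmx &
    forall j, (\rank ((pid_mx j : 'M_(j, n)) *m N) <= #|[pred q | f q < j]|)%N].
Proof.
move=> rN.
pose Sp j := (\sum_(l < n | (l < j)%N) <<row l N>>)%MS.
pose S := [set i : 'I_n | ~~ (row i N <= Sp i)%MS].
pose SpS j := (\sum_(l < n | (l \in S) && (l < j)%N) <<row l N>>)%MS.
have claim1 j : (j <= n)%N -> (Sp j <= SpS j)%MS.
  elim: j => [_|j IH jn]; first by apply/sumsmx_subP => l.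
  apply/sumsmx_subP => l; rewrite ltnS leq_eqVlt => /orP[/eqP lj|lj]; last first.
    have h0 : (<<row l N>> <= Sp j)%MS by exact: (sumsmx_sup l).
    apply: (submx_trans h0).
    apply: (submx_trans (IH (ltnW jn))).
    apply/sumsmx_subP => m /andP[mS mj].
    by apply: (sumsmx_sup m) => //; rewrite mS ltnS ltnW.
  have [lS|lS] := boolP (l \in S).
    by apply: (sumsmx_sup l) => //; rewrite lS lj ltnSn.
  move: lS; rewrite inE negbK => h.
  rewrite genmxE; apply: (submx_trans h); rewrite lj.
  apply: (submx_trans (IH (ltnW jn))).
  apply/sumsmx_subP => m /andP[mS mj].
  by apply: (sumsmx_sup m) => //; rewrite mS ltnS ltnW.
have claim2 j : (\rank (SpS j) <= #|[set i in S | (i < j)%N]|)%N.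
  rewrite -sum1_card (eq_bigl (fun l => (l \in S) && (l < j)%N)) => [|l].
    rewrite /SpS; elim/big_rec2: _ => [|l c B _ h]; first by rewrite mxrank0.
    apply: (leq_trans (mxrank_adds_leqif _ _)); apply: leq_add => //.
    by rewrite mxrank_gen; exact: rank_leq_row.
  by rewrite inE.
have claim3 j : (j <= n)%N -> (#|[set i in S | (i < j)%N]| <= \rank (Sp j))%N.
  elim: j => [_|j IH jn].
    by rewrite (_ : [set i in S | _]%SET = finset.set0) ?cards0 //; apply/setP => i; rewrite !inE andbF.
  have := IH (ltnW jn) => {}IH.
  have sub : (Sp j <= Sp j.+1)%MS.
    apply/sumsmx_subP => m mj; apply: (sumsmx_sup m) => //.
    by rewrite ltnS ltnW.
  pose l := Ordinal jn.
  have [lS|lS] := boolP (l \in S); last first.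
    apply: (leq_trans _ (leq_trans IH (mxrankS sub))); apply: subset_leq_card.
    apply/fintype.subsetP => i; rewrite !inE ltnS leq_eqVlt => /andP[iS /orP[/eqP ij|->]].
      by move: lS; rewrite (_ : l = i) ?inE ?iS //; exact/val_inj.
    by rewrite iS.
  have lt : (Sp j < Sp j.+1)%MS.
    rewrite /ltmx sub /=; apply: contraL lS => h; rewrite inE negbK.
    apply: (submx_trans _ h).
    have : (<<row l N>> <= Sp j.+1)%MS by apply: (sumsmx_sup l) => /=.
    by rewrite genmxE.
  apply: (leq_trans _ (rank_ltmx lt)).
  have -> : [set i in S | (i < j.+1)%N] = l |: [set i in S | (i < j)%N].
    apply/setP => i; rewrite !inE ltnS leq_eqVlt -(inj_eq val_inj) /= .
    have [ij|ij] := eqVneq (i : nat) j => //=.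
    by move: lS; rewrite (_ : l = i) ?inE ?andbT //; exact/val_inj.
  rewrite cardsU1 (leq_trans (leq_add (leq_b1 _) IH)) //.
have NSp j : ((pid_mx j : 'M_(j, n)) *m N <= Sp j)%MS.
  apply/row_subP => a; rewrite row_mul mulmx_sum_row summx_sub // => l _.
  rewrite !mxE; case: eqP => [e|_]; last by rewrite scale0r sub0mx.
  rewrite ltn_ord scale1r.
  have : (<<row l N>> <= Sp j)%MS by apply: (sumsmx_sup l) => //; rewrite -e.
  by rewrite genmxE.
have NSpn : (N <= Sp n)%MS by have := NSp n; rewrite pid_mx_1 mul1mx.
have SpN j : (Sp j <= N)%MS.
  by apply/sumsmx_subP => l _; rewrite genmxE row_sub.
have cS : #|S| = k.
  have e : [set i in S | (i < n)%N] = S.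
    by apply/setP => i; rewrite !inE ltn_ord andbT.
  apply/eqP; rewrite eqn_leq -{1}rN -{2}e.
  rewrite (leq_trans (leq_trans _ (claim3 n (leqnn _))) (mxrankS (SpN n))) ?e //=.
  rewrite -{1}rN -{1}e; apply: leq_trans (claim2 n).
  by apply: mxrankS; apply: (submx_trans NSpn); exact: claim1.
pose f (q : 'I_k) : 'I_n := enum_val (cast_ord (esym cS) q).
have finj : injective f by move=> a b /enum_val_inj /cast_ord_inj.
have fS q : f q \in S by exact: enum_valP.
have fs i : i \in S -> exists q, f q = i.
  move=> iS; exists (cast_ord cS (enum_rank_in iS i)).
  by rewrite /f cast_ordK enum_rankK_in.
exists f; split => //.
- rewrite -row_full_unit -col_leq_rank -{1}rN; apply: mxrankS.
  apply: (submx_trans NSpn); apply: (submx_trans (claim1 n (leqnn _))).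
  apply/sumsmx_subP => i /andP[/fs [q <-] _]; rewrite genmxE.
  by rewrite -row_rowsub row_sub.
- move=> j; have [jn|jn] := leqP j n; last first.
    rewrite (eq_card (B := predT)) ?card_ord; last first.
      by move=> q; rewrite !inE (ltn_trans (ltn_ord _) jn).
    by rewrite -[X in (_ <= X)%N]rN mxrankM_maxr.
  apply: (leq_trans (mxrankS (NSp j))).
  apply: (leq_trans (mxrankS (claim1 j jn))); apply: (leq_trans (claim2 j)).
  rewrite -(card_imset _ finj); apply: subset_leq_card; apply/fintype.subsetP => i.
  rewrite inE => /andP[/fs [q <-] h]; apply: imset_f; exact: h.
Qed.

Section Busemann.
Variable R : realType.
Local Notation C := R[i].
Local Notation Re := (@complex.Re R).

(** Summation by parts: with w vanishing at both ends, the sum equals that of (h i - h i.+1) * w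
    i.+1. The induction keeps the boundary term of the partial sums. *)
Lemma abel_ge0 d (h : 'I_d -> R) (w : nat -> R) :
  (forall i j : 'I_d, (i <= j)%N -> h j <= h i) -> (forall j, (j <= d)%N -> 0 <= w j) ->
  w 0 = 0 -> w d = 0 -> 0 <= \sum_(i < d) h i * (w i.+1 - w i).
Proof.
case: d h => [|d] h hd w0 w00 wd; first by rewrite big_ord0.
pose hh j := h (inord j).
have -> : \sum_(i < d.+1) h i * (w i.+1 - w i) = \sum_(i < d.+1) hh i * (w i.+1 - w i).
  by apply: eq_bigr => i _; rewrite /hh inord_val.
have H m : (m <= d)%N -> hh m * w m.+1 <= \sum_(i < m.+1) hh i * (w i.+1 - w i).
  elim: m => [_|m IH md]; first by rewrite big_ord1 w00 subr0.
  rewrite big_ord_recr /=; have := IH (ltnW md).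
  have : hh m.+1 <= hh m by apply: hd; rewrite !inordK // ltnS // ltnW.
  have := w0 m.+1 (leqW md); nra.
by have := H d (leqnn _); rewrite wd mulr0.
Qed.

Lemma tr_log_le_ldet_ray n k (V : 'M[C]_n) (h : 'I_n -> R) (u : R) (Q : 'M[C]_(n, k)) :
  V \is unitarymx -> Q^t* *m Q = 1%:M ->
  u * Re (\tr (Q^t* *m (V *m rdiag h *m V^t*) *m Q)) <=
  ldet (Q^t* *m ray V h u *m Q).
Proof.
move=> Vu Q1; apply: le_trans (tr_log_le_ldet (fun i => u * h i) Vu Q1).
by rewrite -rdiagZ -scalemxAr -scalemxAl -scalemxAr -scalemxAl mxtraceZ ReZ.
Qed.

(* Moving along the ray by s and renormalizing the frame reduces the tangent
   inequality at s to the one at 0. *)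
Lemma ldet_ray_tangent n k (V : 'M[C]_n) (h : 'I_n -> R) (N : 'M[C]_(n, k))
    (L : 'M[C]_(k, n)) (s : R) : V \is unitarymx -> L *m N = 1%:M ->
  exists t, forall u, ldet (N^t* *m ray V h s *m N) + u * t <=
    ldet (N^t* *m ray V h (s + u) *m N).
Proof.
move=> Vu LN.
have SM u v := rayM h u v Vu; have S0 := ray0 h Vu; have Sad := ray_adj V h.
have Sp u := ray_pd h u Vu; have LD u k' (Q : 'M_(n, k')) := tr_log_le_ldet_ray h u Vu (Q := Q).
move: (ray V h) SM S0 Sad Sp LD => S SM S0 Sad Sp LD.
have [|Q [T [Q1 Tu e]]] := @on_frame _ _ _ (S (s / 2) *m N) (L *m S (- (s / 2))).
  by rewrite mulmxA -[_ *m S _ *m S _]mulmxA SM addNr S0 mulmx1.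
have key u : ldet (N^t* *m S (s + u) *m N) =
    ldet (Q^t* *m S u *m Q) + ln (nsq (\det T)).
  rewrite -(ldet_cong (pd_cong Q1 (Sp u)) Tu); congr ldet.
  have -> : s + u = s / 2 + u + s / 2 by lra.
  rewrite -!SM; transitivity ((S (s / 2) *m N)^t* *m S u *m (S (s / 2) *m N)).
    by rewrite adjM Sad !mulmxA.
  by rewrite e adjM !mulmxA.
exists (Re (\tr (Q^t* *m (V *m rdiag h *m V^t*) *m Q))) => u.
have key0 : ldet (N^t* *m S s *m N) = ln (nsq (\det T)).
  by have := key 0; rewrite addr0 S0 mulmx1 Q1 ldet1 add0r.
rewrite key key0 addrC lerD2r; exact: LD.
Qed.

Lemma tangent_convex (F : R -> R) (s t tau : R) :
  (forall u, F s + u * tau <= F (s + u)) -> 0 <= s <= t ->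
  t * F s <= (t - s) * F 0 + s * F t.
Proof.
move=> H /andP[s0 st]; have := H (- s); have := H (t - s).
by rewrite subrr (addrC s) subrK; nra.
Qed.

Lemma ldet_ray_convex n k (V : 'M[C]_n) (h : 'I_n -> R) (N : 'M[C]_(n, k))
    (L : 'M[C]_(k, n)) (s t : R) : V \is unitarymx -> L *m N = 1%:M ->
  0 <= s <= t ->
  t * ldet (N^t* *m ray V h s *m N) <=
  (t - s) * ldet (N^t* *m N) + s * ldet (N^t* *m ray V h t *m N).
Proof.
move=> Vu LN st; have [tau H] := ldet_ray_tangent h s Vu LN.
have F0 : ldet (N^t* *m ray V h 0 *m N) = ldet (N^t* *m N).
  by rewrite (ray0 h Vu) mulmx1.
by rewrite -F0; exact: (tangent_convex (F := fun u => ldet (N^t* *m ray V h u *m N)) H st).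
Qed.

(** The bracketed sum bounds from below the slope at infinity: each exponent is counted as often as
    the rank of the leading rows of V^* N jumps there. A k by k minor on well-chosen rows already
    grows at least at this rate, and the change of frame that normalizes this minor costs only a
    constant. *)
Lemma ldet_ray_lower n k (V : 'M[C]_n) (h : 'I_n -> R) (N : 'M[C]_(n, k)) :
  V \is unitarymx -> N^t* *m N = 1%:M ->
  (forall i j : 'I_n, (i <= j)%N -> h j <= h i) ->
  exists K, forall s, 0 <= s ->
    s * (\sum_(i < n) h i *
      ((\rank ((pid_mx i.+1 : 'M_(i.+1, n)) *m (V^t* *m N)))%:R -
       (\rank ((pid_mx i : 'M_(i, n)) *m (V^t* *m N)))%:R)) - K
    <= ldet (N^t* *m ray V h s *m N).
Proof.
move=> Vu N1 hd; have [V1 V2] := unitP Vu.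
have [N' N'E] : exists N', N' = V^t* *m N by eexists.
have N'1 : N'^t* *m N' = 1%:M.
  by rewrite N'E adjM trmxCK !mulmxA -[_ *m V *m _]mulmxA V1 mulmx1.
have rN' : \rank N' = k.
  apply/eqP; rewrite eqn_leq rank_leq_col /= -{1}(@mxrank1 C k) -N'1.
  exact: mxrankM_maxr.
have [f [finj Cu hf]] := greedy_rows rN'.
pose r j : R := (\rank ((pid_mx j : 'M_(j, n)) *m N'))%:R.
rewrite -N'E.
(* The surplus of chosen rows among the first j over the rank of the first j rows: nonnegative by
   the choice of f, and zero for j = 0 and j = n. Summation by parts then compares the two sums of
   exponents. *)
pose w j : R := #|[pred q | (f q < j)%N]|%:R - r j.
have wE : \sum_(i < n) h i * (w i.+1 - w i) =
    \sum_q h (f q) - \sum_(i < n) h i * (r i.+1 - r i).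
  have -> : \sum_q h (f q) = \sum_(i < n) h i *
     (#|[pred q | (f q < i.+1)%N]|%:R - #|[pred q | (f q < i)%N]|%:R).
    transitivity (\sum_(i < n) \sum_(q | f q == i) h (f q)).
      by rewrite (exchange_big_dep xpredT) //=; apply: eq_bigr => q _; rewrite (big_pred1 (f q)) // => i; rewrite eq_sym.
    apply: eq_bigr => i _.
    transitivity (\sum_(q | f q == i) h i); first by apply: eq_bigr => q /eqP ->.
    rewrite [LHS]sumr_const -[LHS]mulr_natr; congr (_ * _).
    apply/eqP; rewrite eq_sym subr_eq -natrD eqr_nat; apply/eqP.
    rewrite -cardUI [X in (_ + X)%N]eq_card0 ?addn0 => [|q]; last first.
      by apply/negbTE/negP => /andP[/eqP e1]; rewrite /in_mem /= e1 ltnn.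
    by apply: eq_card => q; rewrite /in_mem /= ltnS leq_eqVlt.
  by rewrite -sumrB; apply: eq_bigr => i _; rewrite /w; ring.
have w0 : 0 <= \sum_(i < n) h i * (w i.+1 - w i).
  apply: abel_ge0 => //.
  - by move=> j _; rewrite subr_ge0 ler_nat hf.
  - rewrite /w /r eq_card0 //; rewrite (_ : _ *m _ = 0) ?mxrank0 ?subrr //.
    by apply/matrixP => -[].
  - rewrite /w /r pid_mx_1 mul1mx rN' (eq_card (B := predT)) ?card_ord ?subrr //.
    by move=> q; rewrite !inE ltn_ord.
(* K0 spans the same columns as N' but has the identity on the chosen rows; the determinant of C0 is
   where the constant comes from. *)
set C0 := rowsub f N' in Cu.
have [K0 K0E] : exists K0, K0 = N' *m invmx C0 by eexists.
have K0f : rowsub f K0 = 1%:M.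
  by rewrite K0E -mul_rowsub_mx mulmxV.
exists (- ln (nsq (\det C0))) => s s0.
have NK : N' = K0 *m C0 by rewrite K0E mulmxKV.
pose E := rdiag (fun i : 'I_n => expR (s * h i)).
have pE : posdefmx E by apply: pd_rdiag => i; exact: expR_gt0.
have pK : posdefmx (K0^t* *m E *m K0).
  apply: (@pd_cong _ _ _ _ _ (C0 *m N'^t*)) => //.
  by rewrite K0E mulmxA -[C0 *m _ *m N']mulmxA N'1 mulmx1 mulmxV.
have -> : ldet (N^t* *m ray V h s *m N) =
    ldet (K0^t* *m E *m K0) + ln (nsq (\det C0)).
  rewrite -(ldet_cong pK Cu); congr ldet.
  transitivity (N'^t* *m E *m N'); last by rewrite NK adjM !mulmxA.
  by rewrite N'E /ray adjM trmxCK !mulmxA.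
rewrite opprK lerD2r.
(* Scaling by D cancels the growth on the chosen rows, which alone then contribute the identity to
   the form; the other rows only add to it, so that [ldet_ge0] applies. *)
pose D := rdiag (fun q : 'I_k => expR (- (s * h (f q)) / 2)).
have Du : D \in unitmx by apply: pd_unit; apply: pd_rdiag => i; exact: expR_gt0.
have : 0 <= ldet (D^t* *m (K0^t* *m E *m K0) *m D).
  apply: ldet_ge0; first exact: pd_congu.
  move=> v.
  have [x xE] : exists x, x = K0 *m (D *m v) by eexists.
  have -> : v^t* *m (D^t* *m (K0^t* *m E *m K0) *m D) *m v = x^t* *m E *m x.
    by rewrite xE !adjM !mulmxA.
  rewrite -{1}[v^t*]mulmx1 -rdiag1 !qf_rdiag /=.
  have xf q : x (f q) 0 = (expR (- (s * h (f q)) / 2))%:C * v q 0.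
    have : rowsub f x = D *m v by rewrite xE -mul_rowsub_mx K0f mul1mx.
    by move/matrixP/(_ q 0); rewrite mxE mul_diag_mx !mxE.
  have -> : \sum_q nsq (v q 0) * 1 = \sum_q nsq (x (f q) 0) * expR (s * h (f q)).
    apply: eq_bigr => q _; rewrite xf nsqM mulr1 nsq_real.
    rewrite mulrAC -expRM_natl -expRD.
    by rewrite (_ : _ + _ = 0) ?expR0 ?mul1r //; lra.
  rewrite -(big_imset (fun i => nsq (x i 0) * expR (s * h i)) (h := f) (A := predT)) /=; last first.
    by move=> ? ? _ _; exact: finj.
  rewrite [leRHS](bigID (fun i => i \in [set f q | q in predT])) /= lerDl.
  by apply: sumr_ge0 => i _; rewrite mulr_ge0 ?nsq_ge0 ?expR_ge0.
rewrite ldet_cong // det_rdiag nsq_real -expR_sum -expRM_natl expRK.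
rewrite -mulr_suml sumrN -mulr_sumr => hh.
have : s * \sum_(i < n) h i * (r i.+1 - r i) <= s * \sum_q h (f q).
  by apply: ler_wpM2l => //; move: w0; rewrite wE subr_ge0.
by lra.
Qed.

End Busemann.

(** * Approximate critical points of sums of Busemann functions *)

Section KempfNess.
Variable R : realType.
Local Notation C := R[i].
Local Notation Re := (@complex.Re R).

Lemma iso_sandwich n k (V : 'M[C]_n) (h : 'I_n -> R) s (N : 'M[C]_(n, k)) :
  V \is unitarymx -> N^t* *m N = 1%:M -> posdefmx (N^t* *m ray V h s *m N).
Proof. by move=> Vu N1; apply: (pd_cong N1); exact: ray_pd. Qed.

Lemma ldet_le_tr n (A : 'M[C]_n) : posdefmx A ->
  ldet A <= Re (\tr A) - n%:R.
Proof.
move=> /pd_desc [V [h [Vu _ ->]]]; have [V1 V2] := unitP Vu.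
rewrite ldet_spec // mxtrace_mulC mulmxA V2 mul1mx tr_rdiag /=.
have -> : n%:R = \sum_(i < n) (1 : R) by rewrite sumr_const card_ord.
rewrite -sumrB; apply: ler_sum => i _; have := expR_ge1Dx (h i); lra.
Qed.

Lemma rcv_ldet (U : set_system nat) n (A : nat -> 'M[C]_n) L :
  UltraFilter U -> posdefmx L -> mcv U A L -> rcv U (fun k => ldet (A k)) (ldet L).
Proof.
move=> UF /pd_det [_ h] /(mcv_det UF) [h1 _]; exact: rcv_ln.
Qed.

Variables (d : nat) (I : finType) (k : I -> nat) (N : forall x, 'M[C]_(d, k x)).
Variables (c : I -> R) (kap : R).
Hypothesis d0 : (0 < d)%N.
Hypothesis N1 : forall x, (N x)^t* *m N x = 1%:M.
Hypothesis c0 : forall x, 0 <= c x.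
Hypothesis total0 : \sum_x c x * (k x)%:R + kap * d%:R = 0.
Hypothesis semistable : forall j (Q : 'M[C]_(d, j)), Q^t* *m Q = 1%:M ->
  0 <= \sum_x c x * (\rank (Q^t* *m N x))%:R + kap * j%:R.

(* At the point V e^(sh) V^* of the cone, a sum of Busemann functions: each flag
   with decreasing weights contributes the log-determinants of its members. *)
Definition busemann (V : 'M[C]_d) (h : 'I_d -> R) (s : R) : R :=
  \sum_x c x * ldet ((N x)^t* *m ray V h s *m N x) + kap * \sum_i (s * h i).

Lemma busemann_convex V h s t : V \is unitarymx -> 0 <= s <= t ->
  t * busemann V h s <= s * busemann V h t.
Proof.
move=> Vu st; rewrite /busemann !mulrDr; apply: lerD; last first.
  by rewrite -!mulr_sumr; lra.
rewrite !mulr_sumr; apply: ler_sum => x _.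
have := ldet_ray_convex h Vu (N1 x) st; rewrite N1 ldet1 mulr0 add0r => hh.
by rewrite mulrCA [leRHS]mulrCA ler_wpM2l.
Qed.

(** Along a ray with decreasing exponents the relevant subspaces are the spans of the first columns
    of V. Semistability on these spans makes the total slope nonnegative by summation by parts. *)
Lemma busemann_lower V h : V \is unitarymx ->
  (forall i j : 'I_d, (i <= j)%N -> h j <= h i) ->
  exists K, forall s, 0 <= s -> - K <= busemann V h s.
Proof.
move=> Vu hd; have [V1 V2] := unitP Vu.
have /choice [K hK] := fun x => ldet_ray_lower Vu (N1 x) hd.
exists (\sum_x c x * K x) => s s0.
pose r x j : R := (\rank ((pid_mx j : 'M_(j, d)) *m (V^t* *m N x)))%:R.
(* The semistability expression for the span of the first j columns of V; [total0] is its vanishing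
   at j = d. *)
pose w j : R := \sum_x c x * r x j + kap * j%:R.
have w0 : 0 <= \sum_(i < d) h i * (w i.+1 - w i).
  apply: abel_ge0 => //.
  - move=> j jd; rewrite /w /r.
    have := @semistable j (V *m (pid_mx j : 'M_(j, d))^t*).
    rewrite adjM trmxCK => H.
    under eq_bigr do rewrite mulmxA; apply: H.
    rewrite !mulmxA -[_ *m V^t* *m V]mulmxA V2 mulmx1.
    rewrite tr_pid_mx map_pid_mx mul_pid_mx minnn (minn_idPr jd) //.
    by rewrite pid_mx_1.
  - rewrite /w mulr0 addr0 big1 // => x _; rewrite /r (_ : _ *m _ = 0) ?mxrank0 ?mulr0 //.
    by apply/matrixP => -[].
  - rewrite -total0 /w; congr (_ + _); apply: eq_bigr => x _; rewrite /r pid_mx_1 mul1mx.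
    congr (_ * _%:R); apply/eqP; rewrite eqn_leq rank_leq_col /=.
    have e : (N x)^t* *m V *m (V^t* *m N x) = 1%:M.
      by rewrite !mulmxA -[_ *m V *m _]mulmxA V1 mulmx1.
    by rewrite -{1}(@mxrank1 C (k x)) -e mxrankM_maxr.
have : \sum_x c x * (s * (\sum_(i < d) h i * (r x i.+1 - r x i)) - K x) <=
    \sum_x c x * ldet ((N x)^t* *m ray V h s *m N x).
  by apply: ler_sum => x _; apply: ler_wpM2l => //; exact: hK.
suff -> : \sum_x c x * (s * (\sum_(i < d) h i * (r x i.+1 - r x i)) - K x) =
    s * (\sum_(i < d) h i * (w i.+1 - w i)) - kap * (\sum_i (s * h i)) -
      \sum_x c x * K x.
  by rewrite /busemann; have := mulr_ge0 s0 w0; lra.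
under eq_bigr do rewrite mulrBr.
rewrite sumrB; congr (_ - _).
transitivity (s * (\sum_x c x * \sum_(i < d) h i * (r x i.+1 - r x i))).
  by rewrite mulr_sumr; apply: eq_bigr => x _; ring.
rewrite -mulr_sumr mulrCA -mulrBr; congr (_ * _).
under eq_bigr do rewrite mulr_sumr.
rewrite exchange_big mulr_sumr -sumrB; apply: eq_bigr => i _ /=.
transitivity (h i * (\sum_x c x * (r x i.+1) - \sum_x c x * r x i)).
  by rewrite -sumrB mulr_sumr; apply: eq_bigr => x _; ring.
by rewrite /w -natr1; ring.
Qed.

Lemma rcv_busemann (U : set_system nat) (V : nat -> 'M[C]_d) h s W g :
  UltraFilter U -> W \is unitarymx -> mcv U V W ->
  (forall i, rcv U (h^~ i) (g i)) ->
  rcv U (fun n => busemann (V n) (h n) s) (busemann W g s).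
Proof.
move=> UF Wu VW hg; apply: (rcvD UF).
  apply: (rcv_sum UF) => x; apply: (rcvM UF); first exact: rcv_cst.
  apply: rcv_ldet; first exact: iso_sandwich.
  apply: (mcvM UF); last exact: mcv_cst.
  apply: (mcvM UF); first exact: mcv_cst.
  apply: (mcvM UF); last exact: mcv_adj.
  apply: (mcvM UF) => //; apply: mcv_rdiag => i; apply: rcv_exp.
  by apply: (rcvM UF) => //; exact: rcv_cst.
apply: (rcvM UF); first exact: rcv_cst.
apply: (rcv_sum UF) => i.
by apply: (rcvM UF) => //; exact: rcv_cst.
Qed.

(** The trace of P plus the trace of its inverse, at a point P with eigenvalues e^(h i). Its
    logarithm is the coercive function: it dominates every |h i|, while its derivative in h i is at
    most 1 in absolute value. *)
Definition penalty (h : 'I_d -> R) : R := \sum_i (expR (h i) + expR (- h i)).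

Lemma penalty_gt0 h : 0 < penalty h.
Proof.
rewrite /penalty (bigD1 (Ordinal d0)) //=; apply: ltr_pwDl.
  by rewrite addr_gt0 ?expR_gt0.
by apply: sumr_ge0 => i _; rewrite addr_ge0 ?expR_ge0.
Qed.

Lemma norm_le_ln_penalty h i : `|h i| <= ln (penalty h).
Proof.
rewrite -ler_expR lnK ?posrE ?penalty_gt0 // /penalty (bigD1 i) //=.
apply: ler_wpDr; first by apply: sumr_ge0 => j _; rewrite addr_ge0 ?expR_ge0.
have := expR_ge0 (h i); have := expR_ge0 (- h i).
by have [_|_] := ger0P (h i); lra.
Qed.

(** The order of the exponents is a closed condition, so that a limit of directions is again one to
    which [busemann_lower] applies; every point of the cone has such data by [pd_desc]. *)
Definition admissible (x : 'M[C]_d * ('I_d -> R)) : Prop :=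
  x.1 \is unitarymx /\ forall i j : 'I_d, (i <= j)%N -> x.2 j <= x.2 i.

Definition objective (e : R) (x : 'M[C]_d * ('I_d -> R)) : R :=
  busemann x.1 x.2 1 + e * ln (penalty x.2).

Lemma admissible_lim (U : set_system nat) (x : nat -> 'M[C]_d * ('I_d -> R)) (m : R) :
  UltraFilter U -> (forall n, admissible (x n)) -> (forall n i, `|(x n).2 i| <= m) ->
  exists y, [/\ admissible y, mcv U (fun n => (x n).1) y.1 &
    forall i, rcv U (fun n => (x n).2 i) (y.2 i)].
Proof.
move=> UF xa xm.
have [W Wu xW] := mcv_unitary UF (fun n => (xa n).1).
have [g hg] := @rcv_vec _ _ UF _ (fun n => (x n).2) m xm.
exists (W, g); split => //; split => //= i j ij.
rewrite -subr_ge0; apply: (rcv_ge UF (rcvD UF (hg i) (rcvN UF (hg j)))).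
by apply: (ultraT UF) => n; rewrite subr_ge0; exact: (xa n).2.
Qed.

(** Points of a sublevel set escaping to infinity would, after normalization, have a limiting
    direction. By convexity the sum of Busemann functions would decrease along it at least linearly,
    at rate e / (2 d), against [busemann_lower]. *)
Lemma objective_coercive e m : 0 < e -> exists r, forall x, admissible x -> objective e x <= m ->
  forall i, `|x.2 i| <= r.
Proof.
move=> e0; apply: contrapT => /forallNP nr.
have /choice [x hx] : forall n : nat, exists x,
    [/\ admissible x, objective e x <= m & exists i, n%:R < `|x.2 i|].
  move=> n; have /existsNP [x /not_implyP [xa /not_implyP [xm]]] := nr n%:R.
  move/existsNP => [i /negP]; rewrite -ltNge => hi.
  by exists x; split => //; exists i.
have [U [UF UI]] := exists_ultra.
pose t n := \sum_i `|(x n).2 i|.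
have tn n : n%:R < t n.
  have [_ _ [i hi]] := hx n; apply: (lt_le_trans hi).
  by rewrite /t (bigD1 i) //= lerDl; apply: sumr_ge0.
have t0 n : 0 < t n by apply: le_lt_trans (tn n); rewrite ler0n.
(* The direction from 1 to the point x n, scaled so that the absolute values of its exponents sum to
   1; x n lies at time t n on the corresponding ray. *)
pose g n : 'M[C]_d * ('I_d -> R) := ((x n).1, fun i => (t n)^-1 * (x n).2 i).
have ga n : admissible (g n).
  have [[h1 h2] _ _] := hx n; split => //= i j ij.
  by rewrite ler_wpM2l ?h2 // invr_ge0 ltW.
have gm n i : `|(g n).2 i| <= 1.
  rewrite /= normrM normfV (gtr0_norm (t0 n)) mulrC ler_pdivrMr // mul1r.
  by rewrite /t (bigD1 i) //= lerDl; apply: sumr_ge0.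
have [[W h] [[Wu hd] /= gW gh]] := admissible_lim UF ga gm.
have [K hK] := busemann_lower Wu hd.
have busE n s : busemann (g n).1 (g n).2 (t n * s) = busemann (x n).1 (x n).2 s.
  rewrite /busemann /ray /=.
  have E i : t n * s * ((t n)^-1 * (x n).2 i) = s * (x n).2 i.
    by field; rewrite gt_eqF.
  under [in RHS]eq_bigr do under rdiag_ext do rewrite -E.
  by congr (_ + _ * _); apply: eq_bigr => i _.
have tp n : t n <= d%:R * ln (penalty (x n).2).
  rewrite /t -[d in d%:R]card_ord -sum1_card natr_sum mulr_suml.
  by apply: ler_sum => i _; rewrite mul1r norm_le_ln_penalty.
have dp : 0 < d%:R :> R by rewrite ltr0n.
have key s : 0 < s -> busemann W h s <= - (s * (e / (2 * d%:R))).
  move=> s0; have hcv := rcv_busemann (s := s) UF Wu gW gh.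
  apply: (rcv_le UF hcv).
  (* The first summand ensures s <= t n, as convexity requires; the second makes the level m at most
     half of the penalty bound e * t n / d. *)
  pose B := s + `|m| * (2 * d%:R / e).
  apply: filterS (U_large UI (Num.truncn B).+1) => n /= nB.
  have Bt : B <= t n.
    rewrite ltW // (lt_trans _ (tn n)) //; apply: (lt_le_trans (truncnS_gt B)).
    by rewrite ler_nat.
  have st : 0 <= s <= t n.
    rewrite ltW //= (le_trans _ Bt) // lerDl mulr_ge0 // divr_ge0 ?mulr_ge0 ?ltW //.
  have := busemann_convex (g n).2 (ga n).1 st.
  rewrite -{2}[t n]mulr1 busE => hc.
  have [_ hm _] := hx n; rewrite /objective in hm.
  have h1 : busemann (x n).1 (x n).2 1 <= m - e * (t n / d%:R).
    rewrite lerBrDr (le_trans _ hm) // lerD2l; apply: ler_wpM2l; first exact: ltW.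
    by rewrite ler_pdivrMr // mulrC.
  have h2 : m <= e / (2 * d%:R) * t n.
    have : `|m| * (2 * d%:R / e) <= t n by apply: le_trans Bt; rewrite lerDr ltW.
    rewrite mulrA ler_pdivrMr // => h2.
    rewrite (le_trans (ler_norm m)) //.
    by rewrite mulrAC ler_pdivlMr ?mulr_gt0 // [leRHS]mulrC.
  rewrite -(ler_pM2l (t0 n)) (le_trans hc) //.
  apply: (le_trans (ler_wpM2l (ltW s0) h1)).
  have -> : t n * - (s * (e / (2 * d%:R))) = s * (- (e / (2 * d%:R) * t n)) by ring.
  rewrite ler_pM2l //.
  have -> : e * (t n / d%:R) = 2 * (e / (2 * d%:R) * t n) by field; rewrite gt_eqF.
  by lra.
pose q := e / (2 * d%:R).
have q0 : 0 < q by rewrite divr_gt0 ?mulr_gt0.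
(* At this time the upper bound is - (|K| + 1), below the lower bound - K. *)
have s0 : 0 < (`|K| + 1) / q by rewrite divr_gt0 // ltr_wpDl.
have := le_trans (hK _ (ltW s0)) (key _ s0); rewrite -/q divfK ?gt_eqF //.
by have := ler_norm K; lra.
Qed.

Lemma objective_min e : 0 < e ->
  exists2 x, admissible x & forall y, admissible y -> objective e x <= objective e y.
Proof.
move=> e0; have [U [UF UI]] := exists_ultra.
apply: (attain_min UF UI).
  exists (1%:M, fun=> 0); split => //=; apply/unitarymxP; rewrite adj1 mulmx1 //.
move=> x xa [m hm]; have [r hr] := objective_coercive m e0.
have [y [ya h1 h2]] := admissible_lim UF xa (fun n => hr _ (xa n) (hm n)).
exists y => //; apply: (rcvD UF); first exact: (rcv_busemann UF ya.1 h1 h2).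
apply: (rcvM UF); first exact: rcv_cst.
apply: (rcv_ln UF); first exact: penalty_gt0.
by apply: (rcv_sum UF) => i; apply: (rcvD UF); apply: rcv_exp => //; exact: rcvN.
Qed.

(** With g = e^(h/2) V^*, the point of the cone is g^* g and its variations are g^* exp(sK) g. In an
    orthonormal frame Q x of the image of N x under g, the gradient of the corresponding
    log-determinant is the projection Q x (Q x)^* itself. *)
Lemma critical_point e V h (Q : forall x, 'M[C]_(d, k x)) (T : forall x, 'M[C]_(k x)) :
  0 < e -> V \is unitarymx ->
  (forall y, admissible y -> objective e (V, h) <= objective e y) ->
  (forall x, (Q x)^t* *m Q x = 1%:M) -> (forall x, T x \in unitmx) ->
  (forall x, rdiag (fun i => expR (h i / 2)) *m V^t* *m N x = Q x *m T x) ->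
  \sum_x (c x)%:C *: (Q x *m (Q x)^t*) + kap%:C%:M =
  rdiag (fun i => - (e / penalty h * (expR (h i) - expR (- h i)))).
Proof.
move=> e0 Vu hmin Q1 Tu gE; have [V1 V2] := unitP Vu.
have Z0 := penalty_gt0 h.
pose D u := rdiag (fun i => expR (u * h i)).
have DM u v : D u *m D v = D (u + v).
  by rewrite /D rdiagM; apply: rdiag_ext => i; rewrite -expRD mulrDl.
have D0 : D 0 = 1%:M.
  by rewrite -rdiag1; apply: rdiag_ext => i; rewrite mul0r expR0.
have Dad u : (D u)^t* = D u by exact: adj_rdiag.
pose b i := - (e / penalty h * (expR (h i) - expR (- h i))).
have Db : rdiag b = - ((e / penalty h)%:C *: (D 1 - D (-1))).
  rewrite -scalerN opprB addrC /D rdiagN rdiagD rdiagZ; apply: rdiag_ext => i.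
  by rewrite /b mul1r mulN1r -mulrN opprB addrC.
have rayD : ray V h 1 = V *m D 1 *m V^t* by [].
have Dh : rdiag (fun i => expR (h i / 2)) = D 2^-1.
  by apply: rdiag_ext => i; rewrite mulrC.
pose g := D 2^-1 *m V^t*; have gdef : g = D 2^-1 *m V^t* by [].
have gN x : g *m N x = Q x *m T x by rewrite -gE Dh.
clearbody g.
have trD1 : Re (\tr (D 1)) = \sum_i expR (h i).
  by rewrite tr_rdiag; apply: eq_bigr => i _; rewrite mul1r.
have trDN1 : Re (\tr (D (-1))) = \sum_i expR (- h i).
  by rewrite tr_rdiag; apply: eq_bigr => i _; rewrite mulN1r.
clearbody D.
pose gin := V *m D (- 2^-1); have gindef : gin = V *m D (- 2^-1) by [].
clearbody gin.
have gi : g *m gin = 1%:M.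
  by rewrite gdef gindef !mulmxA -[_ *m V^t* *m V]mulmxA V2 mulmx1 DM subrr.
have [gu _] := mulmx1_unit gi.
have h11 : 2^-1 + 2^-1 = 1 :> R by lra.
have gg : g *m g^t* = D 1.
  by rewrite gdef adjM trmxCK Dad !mulmxA -[_ *m V^t* *m V]mulmxA V2 mulmx1 DM h11.
have g'g : g^t* *m g = ray V h 1.
  by rewrite rayD gdef adjM trmxCK Dad !mulmxA -[_ *m D _ *m D _]mulmxA DM h11.
have ginin : gin^t* *m gin = D (-1).
  rewrite gindef adjM Dad !mulmxA -[_ *m V^t* *m V]mulmxA V2 mulmx1 DM.
  by rewrite -opprD h11.
have ldetM : ldet (ray V h 1) = ln (nsq (\det g)).
  by have := ldet_cong (pd1 R d) gu; rewrite mulmx1 g'g ldet1 add0r.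
have sumh1 : \sum_i 1 * h i = ln (nsq (\det g)).
  by rewrite -ldetM /ray ldet_spec.
clear rayD gdef gindef gE.
pose S := \sum_x (c x)%:C *: (Q x *m (Q x)^t*) + kap%:C%:M.
rewrite -/S -/b.
have Sad : S^t* = S.
  rewrite /S adjD adj_sum -[kap%:C%:M]rdiag_const adj_rdiag; congr (_ + _).
  by apply: eq_bigr => x _; rewrite adjZr adjM trmxCK.
(* K is minus the gradient of the objective; moving in its direction gives the derivative - tr(K^*
   K). *)
pose K := rdiag b - S; have Kdef : K = rdiag b - S by []; clearbody K.
have Kad : K^t* = K by rewrite Kdef -scaleN1r adjD adjZ rmorphN1 adj_rdiag Sad.
have [Z [t [Zu _ KE]]] := herm_desc ((hermP K).2 Kad).
have [Z1 Z2] := unitP Zu.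
have trK : Re (\tr K) = \sum_i t i.
  by rewrite KE mxtrace_mulC mulmxA Z2 mul1mx tr_rdiag.
pose E s := Z *m rdiag (fun i => expR (s * t i)) *m Z^t*.
have Epd s : posdefmx (E s) by exact: pd_spec.
have Ejet : mjet E 1%:M K by rewrite {1}KE; exact: mjet_exp.
have ENdef : (fun s => E (- s)) =
    fun s => Z *m rdiag (fun i => expR (s * - t i)) *m Z^t*.
  by apply/funext => s; apply: spec_ext => l; rewrite mulrN mulNr.
have ENjet : mjet (fun s => E (- s)) 1%:M (- K).
  by rewrite ENdef {1}KE -mulNmx -mulmxN rdiagN; exact: mjet_exp.
have EEN s : E s *m E (- s) = 1%:M.
  have -> : E (- s) = Z *m rdiag (fun i => expR (- (s * t i))) *m Z^t*.
    by apply: spec_ext => i; rewrite mulNr.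
  exact: spec_exp_inv.
have ldetE s : ldet (E s) = s * \sum_i t i.
  by rewrite mulr_sumr; exact: ldet_spec.
clear ENdef KE; clearbody E.
(* The first variation of the objective along g^* exp(sK) g. *)
pose Phi s := \sum_x c x * (Re (\tr ((Q x)^t* *m E s *m Q x)) - (k x)%:R) +
  kap * (s * \sum_i t i) +
  e / penalty h * (Re (\tr (E s *m D 1)) + Re (\tr (E (- s) *m D (-1))) - penalty h).
(* [Phi] bounds the increment of the objective from above, by ldet A <= tr A - n and by the tangent
   line of ln at [penalty h]. Both bounds are exact to first order at s = 0. The perturbed point is
   diagonalized anew with decreasing exponents, so that minimality applies to it. *)
have Phi0 s : 0 <= Phi s.
  have pM : posdefmx (g^t* *m E s *m g) by exact: pd_congu.
  have [V' [h' [V'u hd' ME]]] := pd_desc pM.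
  have [V'1 V'2] := unitP V'u.
  have ME1 : ray V' h' 1 = g^t* *m E s *m g.
    by rewrite ME; apply: spec_ext => i; rewrite mul1r.
  pose BS M := \sum_x c x * ldet ((N x)^t* *m M *m N x).
  have hobj : BS (ray V h 1) + kap * (\sum_i 1 * h i) + e * ln (penalty h) <=
      BS (ray V' h' 1) + kap * (\sum_i 1 * h' i) + e * ln (penalty h').
    exact: hmin (V', h') (conj V'u hd').
  have sumh : \sum_i 1 * h' i = s * (\sum_i t i) + \sum_i 1 * h i.
    transitivity (ldet (g^t* *m E s *m g)).
      by rewrite ME ldet_spec //; apply: eq_bigr => i _; rewrite mul1r.
    by rewrite (ldet_cong (Epd s) gu) ldetE sumh1.
  have hx x : ldet ((N x)^t* *m ray V' h' 1 *m N x) -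
      ldet ((N x)^t* *m ray V h 1 *m N x) <=
      Re (\tr ((Q x)^t* *m E s *m Q x)) - (k x)%:R.
    rewrite ME1 -g'g.
    have F A : (N x)^t* *m (g^t* *m A *m g) *m N x =
        (T x)^t* *m ((Q x)^t* *m A *m Q x) *m T x.
      transitivity ((g *m N x)^t* *m A *m (g *m N x)); first by rewrite adjM !mulmxA.
      by rewrite gN adjM !mulmxA.
    have pQ : posdefmx ((Q x)^t* *m E s *m Q x) := pd_cong (Q1 x) (Epd s).
    have F1 : (N x)^t* *m (g^t* *m g) *m N x = (T x)^t* *m T x.
      by have := F 1%:M; rewrite !mulmx1 Q1 mulmx1.
    have L1 : ldet ((T x)^t* *m T x) = ln (nsq (\det (T x))).
      by have := ldet_cong (pd1 R (k x)) (Tu x); rewrite mulmx1 ldet1 add0r.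
    rewrite F F1 L1 (ldet_cong pQ (Tu x)) addrK.
    exact: ldet_le_tr.
  have penE : penalty h' = Re (\tr (E s *m D 1)) + Re (\tr (E (- s) *m D (-1))).
    rewrite /penalty big_split /=; congr (_ + _).
      transitivity (Re (\tr (g^t* *m E s *m g))).
        by rewrite ME mxtrace_mulC mulmxA V'2 mul1mx tr_rdiag.
      by rewrite -mulmxA mxtrace_mulC -mulmxA gg.
    have iM : invmx (g^t* *m E s *m g) = gin *m E (- s) *m gin^t*.
      apply: inv_unique; rewrite !mulmxA -[_ *m g *m gin]mulmxA gi mulmx1.
      rewrite -[_ *m E s *m _]mulmxA EEN mulmx1 -adjM (mulmx1C gi).
      exact: adj1.
    transitivity (Re (\tr (invmx (g^t* *m E s *m g)))).
      by rewrite ME (invmx_ray h' V'u) rayN1 mxtrace_mulC mulmxA V'2 mul1mx tr_rdiag.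
    by rewrite iM mxtrace_mulC mulmxA ginin mxtrace_mulC.
  have hln : ln (penalty h') - ln (penalty h) <= (penalty h' - penalty h) / penalty h.
    have Z'0 := penalty_gt0 h'.
    rewrite -ln_div ?posrE // -{1}(subrK 1 (penalty h' / penalty h)) addrC.
    rewrite (le_trans (le_ln1Dx _)) //.
      by rewrite ltrBrDl subrr divr_gt0.
    by rewrite mulrBl divff ?gt_eqF.
  rewrite sumh in hobj; rewrite /Phi -penE.
  have hA : BS (ray V' h' 1) - BS (ray V h 1) <=
      \sum_x c x * (Re (\tr ((Q x)^t* *m E s *m Q x)) - (k x)%:R).
    rewrite /BS -sumrB; apply: ler_sum => x _; rewrite -mulrBr.
    exact: ler_wpM2l.
  have hP : e * (ln (penalty h') - ln (penalty h)) <= e / penalty h * (penalty h' - penalty h).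
    rewrite -mulrA [_^-1 * _]mulrC; apply: ler_wpM2l hln; exact: ltW.
  move: hobj hA hP; move: (BS (ray V h 1)) (BS (ray V' h' 1)); clear.
  move: (e / penalty h * _) (ln _) (ln _) (\sum_x _ * (_ - _)).
  move: (\sum_i t i) (\sum_i 1 * h i) => *; nra.
have PhiJ : rjet Phi 0 (Re (\tr (K *m (S - rdiag b)))).
  have J1 x : rjet (fun s => c x * (Re (\tr ((Q x)^t* *m E s *m Q x)) - (k x)%:R))
      0 (c x * Re (\tr (K *m (Q x *m (Q x)^t*)))).
    have J := mjet_tr (mjetM (mjetM (mjet_cst ((Q x)^t*)) Ejet) (mjet_cst (Q x))).
    have e1 : Re (\tr ((Q x)^t* *m 1%:M *m Q x)) = (k x)%:R.
      by rewrite mulmx1 Q1 mxtrace1 -(rmorph_nat (@real_complex_def R _)).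
    have e2 : Re (\tr ((Q x)^t* *m 1%:M *m 0 + ((Q x)^t* *m K + 0 *m 1%:M) *m Q x)) =
        Re (\tr (K *m (Q x *m (Q x)^t*))).
      by rewrite mulmx0 add0r mul0mx addr0 -mulmxA mxtrace_mulC -mulmxA.
    have := rjetM (rjet_cst (c x)) (rjetD (rjet_eq J e1 e2) (rjet_cst (- (k x)%:R))).
    by rewrite subrr mulr0 mul0r !addr0.
  have J2 : rjet (fun s => kap * (s * \sum_i t i)) 0 (kap * Re (\tr K)).
    have := rjetM (rjet_cst kap) (rjet_affine 0 (Re (\tr K))).
    by rewrite mulr0 mul0r addr0 trK; under eq_fun do rewrite add0r.
  have J3 : rjet (fun s => e / penalty h *
      (Re (\tr (E s *m D 1)) + Re (\tr (E (- s) *m D (-1))) - penalty h))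
      0 (e / penalty h * (Re (\tr (K *m D 1)) - Re (\tr (K *m D (-1))))).
    have JA := mjet_tr (mjetM Ejet (mjet_cst (D 1))).
    have JB := mjet_tr (mjetM ENjet (mjet_cst (D (-1)))).
    rewrite mul1mx mulmx0 add0r trD1 in JA.
    rewrite mul1mx mulmx0 add0r mulNmx linearN ReN trDN1 in JB.
    have := rjetM (rjet_cst (e / penalty h)) (rjetD (rjetD JA JB) (rjet_cst (- penalty h))).
    by rewrite -big_split /= -/(penalty h) subrr mulr0 mul0r !addr0.
  have J := rjetD (rjetD (rjet_sum J1) J2) J3.
  have -> : Re (\tr (K *m (S - rdiag b))) =
      \sum_x c x * Re (\tr (K *m (Q x *m (Q x)^t*))) + kap * Re (\tr K) +
      e / penalty h * (Re (\tr (K *m D 1)) - Re (\tr (K *m D (-1)))).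
    rewrite Db opprK /S !mulmxDr !mxtraceD !ReD; congr (_ + _ + _).
    - rewrite mulmx_sumr tr_sum Re_sum; apply: eq_bigr => x _.
      by rewrite -scalemxAr mxtraceZ ReZ.
    - by rewrite mul_mx_scalar mxtraceZ ReZ.
    - by rewrite -scalemxAr mxtraceZ ReZ mulmxBr mxtraceD ReD trN ReN.
  by apply: (rjet_eq J) => //; rewrite sumr_const mul0rn !addr0.
have := rjet_ge0 PhiJ (fun s _ => Phi0 s).
have -> : S - rdiag b = - K^t* by rewrite Kad Kdef opprB.
rewrite mulmxN linearN /= ReN oppr_ge0 mxtrace_mulC => /adjM_eq0.
by rewrite Kdef => /eqP; rewrite subr_eq0 => /eqP.
Qed.

(** The conclusion holds for all orthonormal frames Q x of the images, so that a caller may choose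
    frames compatible along a flag. The entries of b are bounded by e because |e^x - e^(-x)| is at
    most e^x + e^(-x), a summand of the penalty. *)
Theorem kempf_ness e : 0 < e -> exists (g : 'M[C]_d) (b : 'I_d -> R),
  [/\ g \in unitmx, forall i, `|b i| <= e &
   forall (Q : forall x, 'M[C]_(d, k x)) (T : forall x, 'M[C]_(k x)),
   (forall x, (Q x)^t* *m Q x = 1%:M) -> (forall x, T x \in unitmx) ->
   (forall x, g *m N x = Q x *m T x) ->
   \sum_x (c x)%:C *: (Q x *m (Q x)^t*) + kap%:C%:M = rdiag b].
Proof.
move=> e0; have [[V h] [/= Vu _] hmin] := objective_min e0.
exists (rdiag (fun i => expR (h i / 2)) *m V^t*).
exists (fun i => - (e / penalty h * (expR (h i) - expR (- h i)))); split.
- rewrite unitmx_mul; apply/andP; split; last exact/unitarymx_unit/unit_adj.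
  by apply: pd_unit; apply: pd_rdiag => i; exact: expR_gt0.
- move=> i; rewrite normrN normrM ger0_norm; last by rewrite divr_ge0 ?ltW // penalty_gt0.
  rewrite mulrAC ler_pdivrMr ?penalty_gt0 // ler_wpM2l ?(ltW e0) //.
  rewrite /penalty (bigD1 i) //= ler_wpDr //.
    by apply: sumr_ge0 => j _; rewrite addr_ge0 ?expR_ge0.
  by rewrite (le_trans (ler_normB _ _)) // !ger0_norm ?expR_ge0.
- by move=> Q T Q1 Tu gE; exact: (critical_point e0 Vu hmin Q1 Tu gE).
Qed.

End KempfNess.

(** * Weighted flags *)

Section Flags.
Variable R : realType.
Local Notation C := R[i].
Local Notation Re := (@complex.Re R).

Definition lead n m : 'M[C]_(n, m) := pid_mx m.

Lemma adj_lead n m : (lead n m)^t* = pid_mx m.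
Proof. by rewrite /lead tr_pid_mx map_pid_mx. Qed.

Lemma lead_iso n m : (m <= n)%N -> (lead n m)^t* *m lead n m = 1%:M.
Proof. by move=> mn; rewrite adj_lead mul_pid_mx minnn (minn_idPr mn) pid_mx_1. Qed.

Lemma lead_proj n m : lead n m *m (lead n m)^t* = pid_mx m :> 'M_n.
Proof. by rewrite adj_lead mul_pid_mx !minnn. Qed.

Lemma rowadjE m n p (A : 'M[C]_(m, n)) (B : 'M[C]_(p, n)) i j :
  (A *m B^t*) i j = (row i A *m (row j B)^t*) 0 0.
Proof. by rewrite !mxE; apply: eq_bigr => l _; rewrite !mxE. Qed.

(** Gram-Schmidt on the columns of A. Since B is upper triangular it preserves every leading
    coordinate subspace ([upper_lead]), so the one unitary U gives orthonormal frames of all members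
    of a flag at once. *)
Lemma qr n (A : 'M[C]_n) : exists (U B : 'M[C]_n),
  [/\ U \is unitarymx, A = U *m B & forall i j : 'I_n, (j < i)%N -> B i j = 0].
Proof.
pose S := schmidt (A^t*).
have Su : S \is unitarymx by exact: schmidt_unitarymx.
have [S1 S2] := unitP Su.
exists (S^t*), ((A^t* *m S^t*)^t*); split.
- exact: unit_adj.
- by rewrite adjM !trmxCK mulmxA S2 mul1mx.
- move=> i j ji; rewrite adjE.
  suff : row j (A^t*) *m (row i S)^t* = 0.
    by move/matrixP/(_ 0 0); rewrite -rowadjE [in RHS]mxE => ->; rewrite conjc0.
  apply/eqP; rewrite -sub_kermx; apply: (submx_trans (row_schmidt_sub _ j)).
  apply/sumsmx_subP => l lj; rewrite genmxE sub_kermx -/S.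
  have : S *m S^t* = 1%:M by [].
  move/matrixP/(_ l i); rewrite [1%:M _ _]mxE.
  have -> : (l == i) = false by apply/negbTE; apply: contraTneq ji => <-; rewrite -leqNgt.
  rewrite mulr0n rowadjE => h; apply/eqP/matrixP => a b.
  by rewrite !ord1 h mxE.
Qed.

Lemma upper_lead n m (B : 'M[C]_n) : (m <= n)%N ->
  (forall i j : 'I_n, (j < i)%N -> B i j = 0) ->
  B *m lead n m = lead n m *m ((lead n m)^t* *m B *m lead n m).
Proof.
move=> mn Bu; rewrite !mulmxA lead_proj -mulmxA.
have X0 (i : 'I_n) j : (m <= i)%N -> (B *m lead n m) i j = 0.
  move=> mi; rewrite mxE big1 // => l _; rewrite mxE.
  case: eqP => [e|]; last by rewrite mulr0.
  by rewrite Bu ?mul0r // e (leq_trans (ltn_ord j)).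
apply/matrixP => i j; rewrite [RHS]mxE (bigD1 i) //= big1 => [|l li]; last first.
  by rewrite mxE eq_sym -(inj_eq val_inj) /= in li *; rewrite (negbTE li) mul0r.
rewrite [pid_mx _ _ _]mxE eqxx addr0 /=; case: ltnP => mi; first by rewrite mul1r.
by rewrite mul0r X0.
Qed.

Section Gaps.
Variable d' : nat.
Local Notation d := d'.+1.

(** The truncation [minn] makes the last gap 0; the smallest value [y ord_max] is carried
    separately, as a multiple of the identity of either sign, while for decreasing y all gaps are
    nonnegative. *)
Definition gap (y : 'I_d -> R) (k : 'I_d) : R := y k - y (inord (minn k.+1 d')).

Lemma gap_ge0 (y : 'I_d -> R) k :
  (forall i j : 'I_d, (i <= j)%N -> y j <= y i) -> 0 <= gap y k.
Proof.
move=> yd; rewrite subr_ge0; apply: yd; rewrite inordK ?ltnS ?geq_minr //.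
by rewrite leq_min leqnSn -ltnS ltn_ord.
Qed.

Lemma sum_gap (y : 'I_d -> R) (i : 'I_d) :
  \sum_(k < d | (i <= k)%N) gap y k + y ord_max = y i.
Proof.
pose Y j := y (inord (minn j d')).
have YE (k : 'I_d) : Y k = y k.
  by rewrite /Y (minn_idPl _) ?inord_val // -ltnS.
have -> : \sum_(k < d | (i <= k)%N) gap y k = - \sum_(i <= k < d) (Y k.+1 - Y k).
  by rewrite -sumrN big_geq_mkord; apply: eq_bigr => k _; rewrite opprB YE.
rewrite telescope_sumr ?(ltnW (ltn_ord i)) // YE.
have -> : Y d = y ord_max.
  by rewrite /Y; congr y; apply/val_inj; rewrite /= inordK ?(minn_idPr _) // ltnS geq_minr.
by ring.
Qed.

Lemma rdiag_gap (y : 'I_d -> R) : rdiag y =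
  \sum_k (gap y k)%:C *: (lead d k.+1 *m (lead d k.+1)^t*) + (y ord_max)%:C%:M.
Proof.
apply/matrixP => i j; rewrite rdiagE mxE summxE [_%:M _ _]mxE.
rewrite (eq_bigr (fun k : 'I_d => ((gap y k) *+ (i <= k)%N)%:C *+ (i == j))); last first.
  move=> k _; rewrite lead_proj !mxE ltnS -(inj_eq val_inj).
  by case: eqP; case: (leqP i k) => _ _ /=; rewrite ?mulr1n ?mulr0n ?mulr1 ?mulr0.
case: (i == j); last by rewrite big1 ?addr0 // => k _; rewrite mulr0n.
rewrite !mulr1n -sum_gap CrD Cr_sum; congr (_ + _).
rewrite [LHS]big_mkcond; apply: eq_bigr => k _ /=.
by case: leqP; rewrite ?mulr1n ?mulr0n.
Qed.

(* The asymptotic slope of the Busemann function of the flag Phi with weights y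
   in the direction of the projection onto the column space of Q. *)
Definition flag_deg m (Phi : 'M[C]_d) (y : 'I_d -> R) (Q : 'M[C]_(d, m)) : R :=
  \sum_k gap y k * (\rank (Q^t* *m (Phi *m lead d k.+1)))%:R + y ord_max * m%:R.

Lemma spec_gap (Phi : 'M[C]_d) (y : 'I_d -> R) : Phi \is unitarymx ->
  Phi *m rdiag y *m Phi^t* =
  \sum_k (gap y k)%:C *: ((Phi *m lead d k.+1) *m (Phi *m lead d k.+1)^t*) +
  (y ord_max)%:C%:M.
Proof.
move=> Pu; have [P1 P2] := unitP Pu.
rewrite rdiag_gap mulmxDr mulmxDl mulmx_sumr mulmx_suml; congr (_ + _).
  apply: eq_bigr => k _; rewrite -scalemxAr -scalemxAl; congr (_ *: _).
  by rewrite adjM !mulmxA.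
by rewrite scalar_mxC -mulmxA P1 mulmx1.
Qed.

Lemma flag_iso m (Phi : 'M[C]_d) : Phi \is unitarymx -> (m <= d)%N ->
  (Phi *m lead d m)^t* *m (Phi *m lead d m) = 1%:M.
Proof.
move=> /unitP [P1 P2] md.
by rewrite adjM mulmxA -[_ *m Phi^t* *m Phi]mulmxA P2 mulmx1 lead_iso.
Qed.

(** Gap by gap: the trace of the product of two orthogonal projections is at most the rank of the
    corresponding block. *)
Lemma tr_le_flag_deg m (Phi : 'M[C]_d) (y : 'I_d -> R) (Q : 'M[C]_(d, m)) :
  Phi \is unitarymx -> (forall i j : 'I_d, (i <= j)%N -> y j <= y i) ->
  Q^t* *m Q = 1%:M ->
  Re (\tr (Q^t* *m (Phi *m rdiag y *m Phi^t*) *m Q)) <= flag_deg Phi y Q.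
Proof.
move=> Pu yd Q1; rewrite spec_gap // mulmxDr mulmxDl mxtraceD ReD; apply: lerD.
  rewrite mulmx_sumr mulmx_suml tr_sum Re_sum; apply: ler_sum => k _.
  rewrite -scalemxAr -scalemxAl mxtraceZ ReZ; apply: ler_wpM2l; first exact: gap_ge0.
  rewrite mulmxA -[_ *m Q]mulmxA mxtrace_mulC.
  have <- : (Q^t* *m (Phi *m lead d k.+1))^t* = (Phi *m lead d k.+1)^t* *m Q.
    by rewrite [LHS]adjM trmxCK.
  by apply: block_tr_le_rank => //; apply: flag_iso.
rewrite mul_mx_scalar -scalemxAl Q1 mxtraceZ ReZ mxtrace1.
by rewrite -(rmorph_nat (@real_complex_def R _)).
Qed.

(* Y^{1/2} preserves the flag, hence the ranks; on its image the trace of log Y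
   is bounded below by minus the log-determinant of the compressed inverse. *)
Lemma ldet_le_flag_deg m (Phi : 'M[C]_d) (y : 'I_d -> R) (Q : 'M[C]_(d, m)) :
  Phi \is unitarymx -> (forall i j : 'I_d, (i <= j)%N -> y j <= y i) ->
  Q^t* *m Q = 1%:M ->
  ldet (Q^t* *m (Phi *m rdiag (fun i => expR (y i)) *m Phi^t*) *m Q) <=
  flag_deg Phi y Q.
Proof.
move=> Pu yd Q1; have [P1 P2] := unitP Pu.
pose D s := rdiag (fun i => expR (s * y i)).
have Dlead s k : exists2 A : 'M[C]_k.+1, A \in unitmx &
      (k < d)%N -> D s *m lead d k.+1 = lead d k.+1 *m A.
    pose z := rdiag (fun i : 'I_k.+1 => expR (s * y (inord i))).
    exists z => [|kd].
      by apply: pd_unit; apply: pd_rdiag => i; exact: expR_gt0.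
    apply/matrixP => i j; rewrite mul_diag_mx mul_mx_diag !mxE.
    case: eqP => [ij|_]; last by rewrite mulr0 mul0r.
    by rewrite ij ltn_ord mulr1 mul1r -ij inord_val.
have PM u v := rayM y u v Pu; have P0 := ray0 y Pu; have Pad := ray_adj Phi y.
have P1E := ray1 Phi y; have PN1E := rayN1 Phi y; have Ppd u := ray_pd y u Pu.
have PPhi s k : ray Phi y s *m (Phi *m lead d k.+1) = Phi *m (D s *m lead d k.+1).
  by rewrite /ray !mulmxA -[_ *m Phi^t* *m Phi]mulmxA P2 mulmx1.
move: (ray Phi y) PM P0 Pad P1E PN1E Ppd PPhi => P PM P0 Pad P1E PN1E Ppd PPhi.
have [|Q2 [T [Q21 Tu QE]]] := @on_frame _ _ _ (P 2^-1 *m Q) (Q^t* *m P (- 2^-1)).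
  by rewrite mulmxA -[_ *m P _ *m P _]mulmxA PM addNr P0 mulmx1.
have pN : posdefmx (Q2^t* *m P (-1) *m Q2).
  exact: pd_cong Q21 (Ppd _).
rewrite -P1E; have h1 : ldet (Q^t* *m P 1 *m Q) = ln (nsq (\det T)).
  have -> : Q^t* *m P 1 *m Q = T^t* *m 1%:M *m T.
    have -> : 1 = 2^-1 + 2^-1 :> R by lra.
    rewrite -PM mulmx1 -[T^t*]mulmx1 -Q21.
    transitivity ((Q2 *m T)^t* *m (Q2 *m T)); last by rewrite adjM !mulmxA.
    by rewrite -QE adjM Pad !mulmxA.
  by rewrite (ldet_cong (pd1 R m) Tu) ldet1 add0r.
have h2 : ldet (Q2^t* *m P (-1) *m Q2) = - ln (nsq (\det T)).
  have := ldet_cong pN Tu.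
  have -> : T^t* *m (Q2^t* *m P (- 1) *m Q2) *m T = 1%:M.
    transitivity ((Q2 *m T)^t* *m P (-1) *m (Q2 *m T)); first by rewrite adjM !mulmxA.
    rewrite -QE adjM Pad !mulmxA -[_ *m P _ *m P _]mulmxA PM -[_ *m P _ *m P _]mulmxA PM.
    have -> : 2^-1 + (-1 + 2^-1) = 0 :> R by lra.
    by rewrite P0 mulmx1.
  by rewrite ldet1 => /esym/eqP; rewrite addr_eq0 => /eqP.
have h3 := tr_log_le_ldet (fun i => - y i) Pu Q21.
rewrite -PN1E -rdiagN mulmxN !mulNmx mulmxN mulNmx trN ReN h2 in h3.
have h4 := tr_le_flag_deg Pu yd Q21.
suff e : flag_deg Phi y Q = flag_deg Phi y Q2.
  by rewrite h1 e (le_trans _ h4) // -lerN2.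
suff er (k : 'I_d) : \rank (Q^t* *m (Phi *m lead d k.+1)) =
    \rank (Q2^t* *m (Phi *m lead d k.+1)).
  by rewrite /flag_deg; under eq_bigr do rewrite er.
have [A Au /(_ (ltn_ord k)) DA] := Dlead 2^-1 k.
have e : (P 2^-1 *m Q)^t* *m (Phi *m lead d k.+1) = Q^t* *m (Phi *m lead d k.+1) *m A.
  by rewrite adjM Pad -mulmxA PPhi DA !mulmxA.
have := congr1 (fun M => \rank M) e.
rewrite QE adjM -mulmxA (mxrankMfree _ (_ : row_free A)) ?row_free_unit // => <-.
apply/esym; rewrite (eqmxMfull _ (_ : row_full (T^t*))) // row_full_unit.
exact: unitmx_adj.
Qed.

End Gaps.
End Flags.

(** * Balanced configurations and the logarithm of a solution of the Karcher equation *)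

Section Balance.
Variable R : realType.
Local Notation C := R[i].
Local Notation Re := (@complex.Re R).
Variable d' : nat.
Local Notation d := d'.+1.

Lemma sum_gap_total (y : 'I_d -> R) :
  \sum_k gap y k * k.+1%:R + y ord_max * d%:R = \sum_i y i.
Proof.
have := congr1 (fun A => Re (\tr A)) (rdiag_gap y).
rewrite /= tr_rdiag mxtraceD ReD tr_sum Re_sum /= => ->; congr (_ + _).
  apply: eq_bigr => k _; rewrite mxtraceZ ReZ mxtrace_mulC lead_iso ?ltn_ord //.
  by rewrite mxtrace1 -(rmorph_nat (@real_complex_def R _)).
by rewrite -scalemx1 mxtraceZ ReZ mxtrace1 -(rmorph_nat (@real_complex_def R _)).
Qed.

(** The flags enter [kempf_ness] member by member, with the gaps as coefficients and the smallest
    values collected in [kap]. The QR decomposition of g Phi o gives frames Q x that are leading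
    columns of one unitary, so that the weighted projections reassemble by [spec_gap] into matrices
    with the prescribed spectra; the error 1 / (m + 1) is then sent to 0. *)
Theorem flag_balance (O : finType) (W : O -> R) (Phi : O -> 'M[C]_d)
    (y : O -> 'I_d -> R) :
  (forall o, 0 <= W o) -> (forall o, Phi o \is unitarymx) ->
  (forall o (i j : 'I_d), (i <= j)%N -> y o j <= y o i) ->
  \sum_o W o * (\sum_i y o i) = 0 ->
  (forall j (Q : 'M[C]_(d, j)), Q^t* *m Q = 1%:M ->
     0 <= \sum_o W o * flag_deg (Phi o) (y o) Q) ->
  exists U : O -> 'M[C]_d, (forall o, U o \is unitarymx) /\
    \sum_o (W o)%:C *: (U o *m rdiag (y o) *m (U o)^t*) = 0.
Proof.
move=> W0 Pu yd tot ss.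
pose k (x : O * 'I_d) : nat := x.2.+1.
pose N x : 'M[C]_(d, k x) := Phi x.1 *m lead R d (k x).
pose c (x : O * 'I_d) := W x.1 * gap (y x.1) x.2.
pose kap := \sum_o W o * y o ord_max.
have N1 x : (N x)^t* *m N x = 1%:M by apply: flag_iso => //; exact: ltn_ord.
have c0 x : 0 <= c x by apply: mulr_ge0 => //; apply: gap_ge0; exact: yd.
have total0 : \sum_x c x * (k x)%:R + kap * d%:R = 0.
  have -> : \sum_x c x * (k x)%:R = \sum_o \sum_i W o * gap (y o) i * i.+1%:R.
    by rewrite [RHS]pair_bigA.
  apply: etrans tot; rewrite /kap mulr_suml -big_split /=; apply: eq_bigr => o _.
  rewrite -(sum_gap_total (y o)) mulrDr mulr_sumr mulrA; congr (_ + _).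
  by apply: eq_bigr => i _; rewrite mulrA.
have semi j (Q : 'M[C]_(d, j)) : Q^t* *m Q = 1%:M ->
    0 <= \sum_x c x * (\rank (Q^t* *m N x))%:R + kap * j%:R.
  move=> Q1; have := ss j Q Q1; congr (_ <= _).
  have -> : \sum_x c x * (\rank (Q^t* *m N x))%:R = \sum_o \sum_i W o * gap (y o) i *
      (\rank (Q^t* *m (Phi o *m lead R d i.+1)))%:R.
    by rewrite [RHS]pair_bigA.
  rewrite /kap mulr_suml -big_split /=; apply: eq_bigr => o _.
  rewrite /flag_deg mulrDr mulr_sumr mulrA; congr (_ + _).
  by apply: eq_bigr => i _; rewrite mulrA.
have approx (m : nat) : exists U : O -> 'M[C]_d, (forall o, U o \is unitarymx) /\
    exists2 b : 'I_d -> R, (forall i, `|b i| <= m.+1%:R^-1) &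
    \sum_o (W o)%:C *: (U o *m rdiag (y o) *m (U o)^t*) = rdiag b.
  have e0 : 0 < m.+1%:R^-1 :> R by rewrite invr_gt0.
  have [g [b [gu bm H]]] := kempf_ness (ltn0Sn d') N1 c0 total0 semi e0.
  have /choice [UB hUB] : forall o, exists UB : 'M[C]_d * 'M[C]_d,
      [/\ UB.1 \is unitarymx, g *m Phi o = UB.1 *m UB.2 &
          forall i j : 'I_d, (j < i)%N -> UB.2 i j = 0].
    by move=> o; have [U [B [h1 h2 h3]]] := qr (g *m Phi o); exists (U, B).
  pose U o := (UB o).1; pose B o := (UB o).2.
  have Uu o : U o \is unitarymx by have [] := hUB o.
  exists U; split => //; exists b => //.
  pose Q x : 'M[C]_(d, k x) := U x.1 *m lead R d (k x).
  pose T x : 'M[C]_(k x) := (lead R d (k x))^t* *m B x.1 *m lead R d (k x).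
  have Q1 x : (Q x)^t* *m Q x = 1%:M by apply: flag_iso => //; exact: ltn_ord.
  have gN x : g *m N x = Q x *m T x.
    have [_ e hB] := hUB x.1.
    rewrite /N mulmxA e -mulmxA -/(B x.1) (upper_lead _ hB); last exact: ltn_ord.
    by rewrite /Q /T -/(U x.1) !mulmxA.
  have Tu x : T x \in unitmx.
    have e : (N x)^t* *m invmx g *m Q x *m T x = 1%:M.
      by rewrite -mulmxA -gN mulmxA -[_ *m _ *m g]mulmxA mulVmx // mulmx1 N1.
    by have [] := mulmx1_unit e.
  rewrite -(H Q T Q1 Tu gN).
  have -> : \sum_x (c x)%:C *: (Q x *m (Q x)^t*) = \sum_o \sum_i
      (W o * gap (y o) i)%:C *: ((U o *m lead R d i.+1) *m (U o *m lead R d i.+1)^t*).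
    by rewrite [RHS]pair_bigA.
  have -> : kap%:C%:M = \sum_o (W o)%:C *: ((y o ord_max)%:C%:M : 'M[C]_d).
    apply/matrixP => i j; rewrite mxE summxE /kap Cr_sum -sumrMnl.
    by apply: eq_bigr => o _; rewrite !mxE CrM mulrnAr.
  rewrite -big_split /=; apply: eq_bigr => o _.
  rewrite spec_gap // scalerDr scaler_sumr; congr (_ + _).
  by apply: eq_bigr => i _; rewrite scalerA -CrM.
have /choice [U hU] := approx.
have [F [UF UI]] := exists_ultra.
have /choice [L hL] : forall o, exists L, L \is unitarymx /\ mcv F (fun m => U m o) L.
  by move=> o; have [L h1 h2] := mcv_unitary UF (fun m => (hU m).1 o); exists L.
exists L; split; first by move=> o; have [] := hL o.
have cv : mcv F (fun m => \sum_o (W o)%:C *: (U m o *m rdiag (y o) *m (U m o)^t*))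
    (\sum_o (W o)%:C *: (L o *m rdiag (y o) *m (L o)^t*)).
  apply: (mcv_sum UF) => o; apply: (mcvZ UF); have [_ h] := hL o.
  apply: (mcvM UF); last exact: mcv_adj.
  by apply: (mcvM UF) => //; exact: mcv_cst.
have /choice [b hb] : forall m, exists b : 'I_d -> R,
    (forall i, `|b i| <= m.+1%:R^-1) /\
    \sum_o (W o)%:C *: (U m o *m rdiag (y o) *m (U m o)^t*) = rdiag b.
  by move=> m; have [_ [b h1 h2]] := hU m; exists b.
apply: (mcv_uniq UF cv).
have -> : (fun m => \sum_o (W o)%:C *: (U m o *m rdiag (y o) *m (U m o)^t*)) =
    fun m => rdiag (b m) by apply/funext => m; exact: (hb m).2.
have -> : (0 : 'M[C]_d) = rdiag (fun=> 0).
  by apply/matrixP => i j; rewrite rdiagE mxE mul0rn.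
apply: mcv_rdiag => i.
have hi := @rcv_inv_nat R _ UI.
have hiN := rcvN UF hi; rewrite oppr0 in hiN.
apply: (squeeze_cvgr _ hiN hi).
by apply: filterS filterT => m _ /=; rewrite -ler_norml; exact: (hb m).1.
Qed.

Lemma conj_cancel n (A M U : 'M[C]_n) : U^t* *m U = 1%:M ->
  A *m U^t* *m (U *m M *m U^t*) *m (A *m U^t*)^t* = A *m M *m A^t*.
Proof.
move=> U2; rewrite adjM trmxCK !mulmxA -[_ *m U^t* *m U]mulmxA U2 mulmx1.
by rewrite -[_ *m U^t* *m U]mulmxA U2 mulmx1.
Qed.

Lemma inv_congr n (T Ti A B : 'M[C]_n) : Ti *m T = 1%:M -> A *m B = 1%:M ->
  (Ti^t* *m A *m Ti) *m (T *m B *m T^t*) = 1%:M.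
Proof.
move=> TiT AB; rewrite !mulmxA -[_ *m Ti *m T]mulmxA TiT mulmx1.
rewrite -[_ *m A *m B]mulmxA AB mulmx1 -adjM (mulmx1C TiT).
exact: adj1.
Qed.

Theorem log_karcher n (w : 'I_n -> R) (T : 'M[C]_d) (Z : 'I_n -> 'M[C]_d)
    (z : 'I_n -> 'I_d -> R) :
  (forall t, 0 <= w t) -> \sum_t w t = 1 -> T \in unitmx ->
  (forall t, Z t \is unitarymx) ->
  \sum_t (w t)%:C *: (Z t *m rdiag (z t) *m (Z t)^t*) = 0 ->
  exists U : 'I_n -> 'M[C]_d, (forall t, U t \is unitarymx) /\
    mxlog (T *m T^t*) = \sum_t (w t)%:C *: (U t *m mxlog
      (T *m (Z t *m rdiag (fun i => expR (z t i)) *m (Z t)^t*) *m T^t*) *m (U t)^t*).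
Proof.
move=> w0 w1 Tu Zu kar.
pose Ti := invmx T.
have Tiu : Ti \in unitmx by rewrite unitmx_inv.
have TTi : T *m Ti = 1%:M by exact: mulmxV.
have TiT : Ti *m T = 1%:M by exact: mulVmx.
have TiT' : T^t* *m Ti^t* = 1%:M by rewrite -adjM TiT adj1.
clearbody Ti.
pose X t := T *m (Z t *m rdiag (fun i => expR (z t i)) *m (Z t)^t*) *m T^t*.
pose E t := Z t *m rdiag (fun i => expR (- z t i)) *m (Z t)^t*.
pose Y t := Ti^t* *m E t *m Ti.
have pE t : posdefmx (E t) by exact: (pd_spec (fun i => - z t i)).
have pY t : posdefmx (Y t) by exact: pd_congu.
have YX t : Y t *m X t = 1%:M.
  apply: inv_congr => //; rewrite -[RHS](spec_exp_inv (fun i => - z t i) (Zu t)).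
  by rewrite (@rdiag_ext _ _ (fun i => expR (z t i)) (fun i => expR (- - z t i))) => [|i];
    rewrite ?opprK.
have /choice [Py hPy] : forall t, exists Py : 'M[C]_d * ('I_d -> R),
    [/\ Py.1 \is unitarymx, forall i j : 'I_d, (i <= j)%N -> Py.2 j <= Py.2 i &
    Y t = Py.1 *m rdiag (fun i => expR (Py.2 i)) *m (Py.1)^t*].
  by move=> t; have [V [h [h1 h2 h3]]] := pd_desc (pY t); exists (V, h).
have logX t : mxlog (X t) = (Py t).1 *m rdiag (fun i => - (Py t).2 i) *m ((Py t).1)^t*.
  have [Pu _ e] := hPy t.
  have -> : X t = invmx (Y t) by rewrite (inv_unique (YX t)).
  rewrite e (invmx_ray _ Pu) rayN1; exact: (mxlog_spec (fun i => - (Py t).2 i) Pu).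
have pG : posdefmx (T *m T^t*).
  have := pd_congu (unitmx_adj Tu) (pd1 R d).
  by rewrite mulmx1 trmxCK.
have [P0 [g [P0u gd Ge]]] := pd_desc pG.
have logG : mxlog (T *m T^t*) = P0 *m rdiag g *m P0^t*.
  rewrite Ge; exact: mxlog_spec.
have iG : invmx (T *m T^t*) = Ti^t* *m Ti.
  apply: inv_unique; rewrite mulmxA -[_ *m T^t* *m _]mulmxA TiT' mulmx1.
  exact: TTi.
have iGe : Ti^t* *m Ti = P0 *m rdiag (fun i => expR (- g i)) *m P0^t*.
  by rewrite -iG Ge (invmx_ray g P0u) rayN1.
(* The left summand stands for the flag of G, with weight 1; the right one for the flags of the
   inverses of the X t, with weights w t. *)
pose O := ('I_1 + 'I_n)%type.
pose W (o : O) := match o with inl _ => 1 | inr t => w t end.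
pose Phi (o : O) := match o with inl _ => P0 | inr t => (Py t).1 end.
pose y (o : O) := match o with inl _ => g | inr t => (Py t).2 end.
have sumz : \sum_t w t * \sum_i z t i = 0.
  have h := congr1 (fun A => Re (\tr A)) kar; rewrite /= mxtrace0 tr_sum Re_sum /= in h.
  apply: etrans h; apply: eq_bigr => t _; have [_ Z2] := unitP (Zu t).
  by rewrite mxtraceZ ReZ mxtrace_mulC mulmxA Z2 mul1mx tr_rdiag.
pose lT := ln (nsq (\det T)).
have lTi : ln (nsq (\det Ti)) = - lT.
  apply/eqP; rewrite -addr_eq0 -lnM ?posrE ?nsq_gt0 -?unitfE -?unitmxE //.
  by rewrite -nsqM -det_mulmx TiT det1 nsq1 ln1.
have sumg : \sum_i g i = lT.
  transitivity (ldet (T *m T^t*)); first by rewrite Ge ldet_spec.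
  have := ldet_cong (pd1 R d) (unitmx_adj Tu).
  by rewrite mulmx1 trmxCK ldet1 add0r det_adj nsq_conj.
have sumy t : \sum_i (Py t).2 i = - (\sum_i z t i) - lT.
  transitivity (ldet (Y t)); first by have [Pu _ ->] := hPy t; rewrite ldet_spec.
  rewrite (ldet_cong (pE t) Tiu) lTi -sumrN; congr (_ + _).
  exact: (ldet_spec (fun i => - z t i) (Zu t)).
have [|||||U [Uu UE]] := @flag_balance O W Phi y.
- by case=> [?|t]; [exact: ler01 | exact: w0].
- by case=> [?|t]; [exact: P0u | case: (hPy t)].
- by case=> [?|t]; [exact: gd | case: (hPy t)].
- rewrite big_sumType big_ord1 /= mul1r sumg.
  under eq_bigr do rewrite sumy mulrDr mulrN mulrN.
  by rewrite big_split /= !sumrN sumz -mulr_suml w1 mul1r oppr0 add0r subrr.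
(* Here l is the log-determinant of the inverse of G compressed to Q. The degree of the flag of G is
   at least - l, that of Y t at least l - tau t, and the Karcher equation makes the weighted sum of
   the tau t vanish; the weights sum to 1, so the l cancel. *)
- move=> j Q Q1; rewrite big_sumType big_ord1 /= mul1r.
  have [|Q2 [S [Q21 Su QE]]] := @on_frame _ _ _ (Ti *m Q) (Q^t* *m T).
    by rewrite mulmxA -[_ *m T *m Ti]mulmxA TTi mulmx1.
  pose l := ln (nsq (\det S)).
  have F A : Q^t* *m (Ti^t* *m A *m Ti) *m Q = S^t* *m (Q2^t* *m A *m Q2) *m S.
    transitivity ((Ti *m Q)^t* *m A *m (Ti *m Q)); first by rewrite adjM !mulmxA.
    by rewrite QE adjM !mulmxA.
  have ha : - l <= flag_deg P0 g Q.
    apply: le_trans (tr_le_flag_deg P0u gd Q1).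
    have := tr_log_le_ldet (fun i => - g i) P0u Q1.
    rewrite -rdiagN mulmxN mulNmx mulmxN mulNmx trN ReN -iGe.
    have -> : Q^t* *m (Ti^t* *m Ti) *m Q = S^t* *m 1%:M *m S.
      by have := F 1%:M; rewrite !mulmx1 Q21 mulmx1.
    by rewrite (ldet_cong (pd1 R j) Su) ldet1 add0r lerNl.
  pose tau t := Re (\tr (Q2^t* *m (Z t *m rdiag (z t) *m (Z t)^t*) *m Q2)).
  have hc t : l - tau t <= flag_deg (Py t).1 (Py t).2 Q.
    have [Pu yd e] := hPy t.
    apply: le_trans (ldet_le_flag_deg Pu yd Q1); rewrite -e F.
    have pQ : posdefmx (Q2^t* *m E t *m Q2) by exact: (pd_cong Q21 (pE t)).
    rewrite (ldet_cong pQ Su) addrC lerD2r.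
    have := tr_log_le_ldet (fun i => - z t i) (Zu t) Q21.
    by rewrite -rdiagN mulmxN mulNmx mulmxN mulNmx trN ReN.
  have tau0 : \sum_t w t * tau t = 0.
    have h := congr1 (fun A => Re (\tr (Q2^t* *m A *m Q2))) kar.
    rewrite /= mulmx0 mul0mx mxtrace0 mulmx_sumr mulmx_suml tr_sum Re_sum /= in h.
    apply: etrans h; apply: eq_bigr => t _.
    by rewrite -scalemxAr -scalemxAl mxtraceZ ReZ.
  have : - l + \sum_t w t * (l - tau t) <=
      flag_deg P0 g Q + \sum_t w t * flag_deg (Py t).1 (Py t).2 Q.
    by apply: lerD => //; apply: ler_sum => t _; exact: ler_wpM2l.
  apply: le_trans; under eq_bigr do rewrite mulrBr.
  by rewrite sumrB tau0 -mulr_suml w1 mul1r subr0 addNr.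
pose U0 := U (inl ord0).
have [U01 U02] := unitP (Uu (inl ord0)).
(* P0 U0^* carries the term of G in the balanced equation to log G; the right factor makes the
   diagonal of minus the exponents of Y t out of log X t. *)
exists (fun t => P0 *m U0^t* *m (U (inr t) *m ((Py t).1)^t*)); split.
  move=> t; have [Pu _ _] := hPy t.
  exact: (mul_unitarymx (mul_unitarymx P0u (unit_adj (Uu _)))
    (mul_unitarymx (Uu _) (unit_adj Pu))).
have UE' : U0 *m rdiag g *m U0^t* =
    \sum_t (w t)%:C *: (U (inr t) *m rdiag (fun i => - (Py t).2 i) *m (U (inr t))^t*).
  move: UE; rewrite big_sumType big_ord1 /= scale1r => /eqP; rewrite addr_eq0 => /eqP ->.
  rewrite -sumrN; apply: eq_bigr => t _.
  by rewrite -rdiagN mulmxN mulNmx scalerN.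
rewrite logG.
rewrite -(conj_cancel P0 (rdiag g) U02) UE' mulmx_sumr mulmx_suml.
apply: eq_bigr => t _; rewrite -/(X t) logX; have [/unitP [Pu1 Pu2] _ _] := hPy t.
rewrite -scalemxAr -scalemxAl; congr (_ *: _).
rewrite [_ *m (U (inr t) *m (Py t).1^t*)]mulmxA (conj_cancel _ _ Pu2).
by rewrite [in RHS]adjM !mulmxA.
Qed.

End Balance.

(** * The Karcher mean *)

Section KarcherEquation.
Variable R : realType.
Local Notation C := R[i].
Local Notation Re := (@complex.Re R).
Variable d : nat.

(** Any A with A^* A equal to the inverse of M may replace the inverse square root of M: the two
    differ by a unitary left factor, which changes neither eigenvalues nor norm. *)
Lemma pd_dist_sq (M X A W : 'M[C]_d) (e : 'I_d -> R) :
  posdefmx M -> A^t* *m A = invmx M -> W \is unitarymx ->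
  A *m X *m A^t* = W *m rdiag (fun i => expR (e i)) *m W^t* ->
  pd_dist M X ^+ 2 = \sum_i e i ^+ 2.
Proof.
move=> pM AA Wu AXA; have [V [h [Vu _ ME]]] := pd_desc pM.
have [V1 V2] := unitP Vu.
have PM u v := rayM h u v Vu; have P0 := ray0 h Vu; have Pad := ray_adj V h.
have SE : mxpow M (- 2^-1) = ray V h (- 2^-1).
  by rewrite ME; exact: mxpow_spec.
have iM : invmx M = ray V h (-1) by rewrite ME; exact: invmx_ray.
rewrite /pd_dist SE; move: (ray V h) PM P0 Pad iM => P PM P0 Pad iM.
have hh : - 2^-1 + - 2^-1 = -1 :> R by lra.
pose O := A *m P 2^-1.
have Ou : O \is unitarymx.
  apply: unitary_of_iso; rewrite /O adjM Pad !mulmxA -[_ *m A^t* *m A]mulmxA AA iM !PM.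
  by rewrite -hh addrA subrr add0r addNr P0.
have [O1 O2] := unitP Ou.
have AE : A = O *m P (- 2^-1) by rewrite /O -mulmxA PM subrr P0 mulmx1.
clearbody O.
have e1 : P (- 2^-1) *m X *m P (- 2^-1) =
    (O^t* *m W) *m rdiag (fun i => expR (e i)) *m (O^t* *m W)^t*.
  transitivity (O^t* *m (A *m X *m A^t*) *m O).
    rewrite AE adjM Pad !mulmxA O2 mul1mx -!mulmxA O2 mulmx1.
    by [].
  by rewrite AXA adjM trmxCK !mulmxA.
have OWu : O^t* *m W \is unitarymx := mul_unitarymx (unit_adj Ou) Wu.
have [OW1 OW2] := unitP OWu.
rewrite /hsnorm e1 (mxlog_spec _ OWu) sqr_sqrtr; last first.
  by rewrite tr_adjM /=; apply: sumr_ge0 => i _; apply: sumr_ge0 => j _; exact: nsq_ge0.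
rewrite adjM trmxCK adjM adj_rdiag mulmxA (spec_mul _ _ OWu) mxtrace_mulC mulmxA OW2 mul1mx.
by rewrite tr_rdiag; apply: eq_bigr => i _; rewrite expr2.
Qed.

Lemma tr_two_conj (U V A B : 'M[C]_d) :
  \tr (U *m A *m U^t* *m (V *m B *m V^t*)) =
  \tr (B *m ((U^t* *m V)^t* *m A *m (U^t* *m V))).
Proof.
rewrite -[V *m B *m _]mulmxA mulmxA mxtrace_mulC adjM trmxCK.
by congr mxtrace; rewrite !mulmxA.
Qed.

Lemma tr_two_spec (U V : 'M[C]_d) (a b : 'I_d -> R) :
  Re (\tr (U *m rdiag a *m U^t* *m (V *m rdiag b *m V^t*))) =
  \sum_i \sum_j nsq ((U^t* *m V) i j) * (a i * b j).
Proof.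
rewrite tr_two_conj; move: (U^t* *m V) => N.
rewrite Re_sum exchange_big /=; apply: eq_bigr => j _.
rewrite mul_diag_mx mxE [(\row_i _) 0 j]mxE ReZ mxE Re_sum mulr_sumr.
apply: eq_bigr => i _; rewrite mul_mx_diag mxE adjE mxE mulrAC -nsqE -CrM /=.
by ring.
Qed.

Lemma unit_col_sum (N : 'M[C]_d) j : N \is unitarymx -> \sum_i nsq (N i j) = 1.
Proof.
move=> /unitP [_ /matrixP/(_ j j)].
rewrite [RHS]mxE eqxx mulr1n [LHS]mxE => /(congr1 Re); rewrite /= => <-.
by rewrite Re_sum; apply: eq_bigr => i _; rewrite adjE -nsqE.
Qed.

Lemma unit_row_sum (N : 'M[C]_d) i : N \is unitarymx -> \sum_j nsq (N i j) = 1.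
Proof.
move=> /unit_adj /unit_col_sum => /(_ i) <-; apply: eq_bigr => j _.
by rewrite adjE nsq_conj.
Qed.

(** With u = m - h one has m^2 = h^2 + 2 h u + u^2. The 4 in c pays for u^2. The |h| pays for
    replacing 2 h u by h (e^u - e^(-u)): according to the sign of h, the total error becomes twice
    |h| times e^u - 1 - u or e^(-u) - 1 + u, both nonnegative. *)
Lemma log_sq_scalar (m h c : R) : 4 + `|h| <= c ->
  m ^+ 2 <= h ^+ 2 + (expR m * (h * expR (- h)) - expR (- m) * (h * expR h)) +
    c * (expR m * expR (- h) + expR (- m) * expR h - 2).
Proof.
move=> hc; pose u := m - h.
have eu : expR m * expR (- h) = expR u by rewrite -expRD.
have eNu : expR (- m) * expR h = expR (- u) by rewrite -expRD; congr expR; rewrite /u; ring.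
have -> : expR m * (h * expR (- h)) - expR (- m) * (h * expR h) =
    h * (expR u - expR (- u)) by rewrite -eu -eNu; ring.
rewrite eu eNu.
have p0 := expR_ge1Dx u; have q0 := expR_ge1Dx (- u).
have hu : u ^+ 2 <= 4 * (expR u + expR (- u) - 2).
  pose a := expR (u / 2); pose b := expR (- (u / 2)).
  have ab : a * b = 1 by exact: expRxMexpNx_1.
  have aa : expR u = a ^+ 2 by rewrite expr2 -expRD; congr expR; lra.
  have bb : expR (- u) = b ^+ 2 by rewrite expr2 -expRD; congr expR; lra.
  have ha := expR_ge1Dx (u / 2); have hb := expR_ge1Dx (- (u / 2)).
  rewrite -/a in ha; rewrite -/b in hb; have a0 : 0 < a by exact: expR_gt0.
  have b0 : 0 < b by exact: expR_gt0.
  have -> : expR u + expR (- u) - 2 = (a - b) ^+ 2 by rewrite aa bb; nra.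
  have [u0|u0] := leP 0 u.
    have b1 : b <= 1 by nra.
    have : 0 <= u / 2 <= a - b by apply/andP; split; lra.
    by move=> /andP[? ?]; nra.
  have a1 : a <= 1 by nra.
  by nra.
have [h0|h0] := ger0P h; rewrite ?(ger0_norm h0) ?(ltr0_norm h0) in hc.
  have : (c - 4 - h) * (expR u + expR (- u) - 2) >= 0 by apply: mulr_ge0; lra.
  have -> : m = h + u by rewrite /u; ring.
  by nra.
have : (c - 4 + h) * (expR u + expR (- u) - 2) >= 0 by apply: mulr_ge0; lra.
have -> : m = h + u by rewrite /u; ring.
by nra.
Qed.

(* Klein's inequality for ln^2; the last summand makes up for the failure of
   convexity, and is of second order in the distance of the two matrices. *)
Lemma klein_log_sq (U V : 'M[C]_d) (m h : 'I_d -> R) (c a1 a2 a3 a4 : R) :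
  U \is unitarymx -> V \is unitarymx -> (forall i, 4 + `|h i| <= c) ->
  a1 = Re (\tr (U *m rdiag (fun i => expR (m i)) *m U^t* *m
      (V *m rdiag (fun i => h i * expR (- h i)) *m V^t*))) ->
  a2 = Re (\tr (U *m rdiag (fun i => expR (- m i)) *m U^t* *m
      (V *m rdiag (fun i => h i * expR (h i)) *m V^t*))) ->
  a3 = Re (\tr (U *m rdiag (fun i => expR (m i)) *m U^t* *m
      (V *m rdiag (fun i => expR (- h i)) *m V^t*))) ->
  a4 = Re (\tr (U *m rdiag (fun i => expR (- m i)) *m U^t* *m
      (V *m rdiag (fun i => expR (h i)) *m V^t*))) ->
  \sum_i m i ^+ 2 <= \sum_i h i ^+ 2 + (a1 - a2) + c * (a3 + a4 - 2 * d%:R).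
Proof.
move=> Uu Vu hc e1 e2 e3 e4.
rewrite {e1}(etrans e1 (tr_two_spec U V _ _)) {e2}(etrans e2 (tr_two_spec U V _ _)).
rewrite {e3}(etrans e3 (tr_two_spec U V _ _)) {e4}(etrans e4 (tr_two_spec U V _ _)).
have Nu : U^t* *m V \is unitarymx := mul_unitarymx (unit_adj Uu) Vu.
move: (U^t* *m V) Nu => N Nu.
have em : \sum_i m i ^+ 2 = \sum_i \sum_j nsq (N i j) * m i ^+ 2.
  by apply: eq_bigr => i _; rewrite -mulr_suml unit_row_sum // mul1r.
have eh : \sum_i h i ^+ 2 = \sum_i \sum_j nsq (N i j) * h j ^+ 2.
  by rewrite exchange_big; apply: eq_bigr => i _; rewrite -mulr_suml unit_col_sum // mul1r.
have e2 : 2 * d%:R = \sum_i \sum_j nsq (N i j) * 2.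
  rewrite mulr_natr -[d in LHS]card_ord -sumr_const; apply: eq_bigr => i _.
  by rewrite -mulr_suml unit_row_sum // mul1r.
rewrite em eh e2 -!big_split /= -!sumrB -!big_split /= mulr_sumr -big_split /=.
apply: ler_sum => i _; rewrite -!big_split /= -!sumrB -!big_split /= mulr_sumr -big_split /=.
apply: ler_sum => j _.
have := ler_wpM2l (nsq_ge0 (N i j)) (log_sq_scalar (m i) (hc j)).
move/le_trans; apply; rewrite le_eqVlt; apply/orP; left; apply/eqP; ring.
Qed.

End KarcherEquation.

(** * The Karcher equation as first-order condition *)

Section KarcherMinimizer.
Variable R : realType.
Local Notation C := R[i].
Local Notation Re := (@complex.Re R).
Variable d : nat.

Lemma pd_inv n (A : 'M[C]_n) : posdefmx A -> posdefmx (invmx A).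
Proof.
by move=> /pd_desc [V [h [Vu _ ->]]]; rewrite (invmx_ray h Vu); exact: ray_pd.
Qed.

Lemma pd_congr n (A N : 'M[C]_n) :
  N \in unitmx -> posdefmx A -> posdefmx (N *m A *m N^t*).
Proof. by move=> Nu pA; have := pd_congu (unitmx_adj Nu) pA; rewrite trmxCK. Qed.

Lemma pd_gram n (A : 'M[C]_n) : A \in unitmx -> posdefmx (A^t* *m A).
Proof. by move=> Au; have := pd_congu Au (pd1 R n); rewrite mulmx1. Qed.

Lemma pd_sqrt n (A : 'M[C]_n) : posdefmx A ->
  exists (h : 'I_n -> R) (V : 'M[C]_n), V \is unitarymx /\
  (rdiag (fun i => expR (h i)) *m V)^t* *m (rdiag (fun i => expR (h i)) *m V) = A.
Proof.
move=> /pd_desc [V [h [Vu _ ->]]]; exists (fun i => h i / 2), (V^t*).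
split; first exact: unit_adj.
rewrite adjM trmxCK adj_rdiag -mulmxA [rdiag _ *m (_ *m _)]mulmxA rdiagM mulmxA.
by apply: spec_ext => i; rewrite -expRD; congr expR; lra.
Qed.

Lemma rdiag_unitary_unit n (h : 'I_n -> R) (V : 'M[C]_n) : V \is unitarymx ->
  rdiag (fun i => expR (h i)) *m V \in unitmx.
Proof.
move=> Vu; rewrite unitmx_mul; apply/andP; split; last exact: unitarymx_unit.
by apply: pd_unit; apply: pd_rdiag => i; exact: expR_gt0.
Qed.

Lemma jet_sandwich n (E : R -> 'M[C]_n) (K Y A H : 'M[C]_n) :
  mjet E 1%:M K -> Y *m A = H -> A *m Y = H ->
  rjet (fun s => Re (\tr (E s *m Y *m E s *m A))) (Re (\tr H)) (2 * Re (\tr (K *m H))).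
Proof.
move=> Ej YA AY.
have J := mjet_tr (mjetM (mjetM (mjetM Ej (mjet_cst Y)) Ej) (mjet_cst A)).
apply: (rjet_eq J); first by rewrite mul1mx mulmx1 YA.
rewrite !mulmx0 add0r mulmxDl !mul1mx add0r mulmx1 mxtraceD ReD.
rewrite -[Y *m K *m A]mulmxA mxtrace_mulC -[K *m A *m Y]mulmxA AY.
by rewrite -[K *m Y *m A]mulmxA YA mulr_natl mulr2n.
Qed.

Lemma sandwich_inv n (A Ai B Bi : 'M[C]_n) : A *m Ai = 1%:M -> B *m Bi = 1%:M ->
  A *m B *m A *m (Ai *m Bi *m Ai) = 1%:M.
Proof.
move=> AA BB; rewrite !mulmxA -[_ *m A *m Ai]mulmxA AA mulmx1.
by rewrite -[_ *m B *m Bi]mulmxA BB mulmx1.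
Qed.

(** Put the inverse of M in the form Z^* Z and perturb Z to exp(sK) Z. By [klein_log_sq] each
    squared distance grows by at most [F t s], a combination of traces whose expansion at s = 0 is
    explicit, so the logarithm of the perturbed matrix is never expanded. *)
Lemma karcher_equation n (w : 'I_n -> R) (X : 'I_n -> 'M[C]_d) (M : 'M[C]_d) :
  (forall t, 0 <= w t) -> (forall t, posdefmx (X t)) -> karcher_argmin w X M ->
  exists (T : 'M[C]_d) (Z : 'I_n -> 'M[C]_d) (z : 'I_n -> 'I_d -> R),
    [/\ T \in unitmx, forall t, Z t \is unitarymx, M = T *m T^t*,
      forall t, X t = T *m (Z t *m rdiag (fun i => expR (z t i)) *m (Z t)^t*) *m T^t* &
      \sum_t (w t)%:C *: (Z t *m rdiag (z t) *m (Z t)^t*) = 0].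
Proof.
move=> w0 pX [pM Mmin].
have [h0 [V0 [V0u ZM]]] := pd_sqrt (pd_inv pM).
have Zu := rdiag_unitary_unit h0 V0u.
move: (rdiag _ *m V0) ZM Zu => Z ZM Zu.
have /choice [We hWe] : forall t, exists We : 'M[C]_d * ('I_d -> R),
    We.1 \is unitarymx /\
    Z *m X t *m Z^t* = We.1 *m rdiag (fun i => expR (We.2 i)) *m We.1^t*.
  move=> t; have [W [e [h1 _ h2]]] := pd_desc (pd_congr Zu (pX t)).
  by exists (W, e).
pose W t := (We t).1; pose e t := (We t).2.
have Wu t : W t \is unitarymx := (hWe t).1.
have We' t : Z *m X t *m Z^t* = W t *m rdiag (fun i => expR (e t i)) *m (W t)^t* := (hWe t).2.
clearbody W e; clear We hWe.
pose H t := W t *m rdiag (e t) *m (W t)^t*.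
exists (invmx Z), W, e; split => //.
- by rewrite unitmx_inv.
- rewrite -[LHS]invmxK -ZM; apply: inv_unique.
  rewrite mulmxA -[_ *m Z *m invmx Z]mulmxA mulmxV // mulmx1 -adjM mulVmx //.
  exact: adj1.
- move=> t; rewrite -We' !mulmxA mulVmx // mul1mx -mulmxA -adjM mulVmx //.
  by rewrite adj1 mulmx1.
rewrite -/(\sum_t (w t)%:C *: H t).
(* Minus the sum that has to vanish: the derivative of the upper bound is then - 4 tr(K^* K). *)
pose K := - \sum_t (w t)%:C *: H t.
have Kad : K^t* = K.
  rewrite /K -scaleN1r adjZ rmorphN1 adj_sum; congr (_ *: _).
  by apply: eq_bigr => t _; rewrite adjZr /H !adjM trmxCK adj_rdiag mulmxA.
have [P [kap [Pu _ KE]]] := herm_desc ((hermP K).2 Kad).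
have Ejet : mjet (ray P kap) 1%:M K by rewrite KE; exact: mjet_exp.
have ENjet : mjet (fun s => ray P kap (- s)) 1%:M (- K).
  have -> : (fun s => ray P kap (- s)) = ray P (fun i => - kap i).
    by apply/funext => s; apply: spec_ext => i; rewrite mulrN mulNr.
  by rewrite KE -mulNmx -mulmxN rdiagN; exact: mjet_exp.
have EE s : ray P kap s *m ray P kap (- s) = 1%:M by rewrite rayM // subrr ray0.
have Ead s := ray_adj P kap s.
move: (ray P kap) Ejet ENjet EE Ead => E Ejet ENjet EE Ead; clear KE.
have KN A : Re (\tr (- K *m A)) = - Re (\tr (K *m A)) by rewrite mulNmx trN ReN.
pose Y t := W t *m rdiag (fun i => expR (e t i)) *m (W t)^t*.
pose Yi t := W t *m rdiag (fun i => expR (- e t i)) *m (W t)^t*.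
pose A1 t := W t *m rdiag (fun i => e t i * expR (- e t i)) *m (W t)^t*.
pose A2 t := W t *m rdiag (fun i => e t i * expR (e t i)) *m (W t)^t*.
(* Large enough for the scalar inequality at every eigenvalue of the t-th matrix. The size of c does
   not matter for the derivative, since the factor of c has zero first-order term: the contributions
   of K and - K cancel. *)
pose c t := 4 + \sum_i `|e t i|.
pose F t s :=
  Re (\tr (E s *m Y t *m E s *m A1 t)) - Re (\tr (E (- s) *m Yi t *m E (- s) *m A2 t)) +
  c t * (Re (\tr (E s *m Y t *m E s *m Yi t)) +
         Re (\tr (E (- s) *m Yi t *m E (- s) *m Y t)) - 2 * d%:R).
have Fjet t : rjet (F t) 0 (4 * Re (\tr (K *m H t))).
  have YYi : Y t *m Yi t = 1%:M by exact: (spec_exp_inv (e t) (Wu t)).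
  have YiY : Yi t *m Y t = 1%:M by exact: mulmx1C.
  have ex i : expR (- e t i) * expR (e t i) = 1 by rewrite mulrC expRxMexpNx_1.
  have ex' i : expR (e t i) * expR (- e t i) = 1 by rewrite expRxMexpNx_1.
  have q1 : Y t *m A1 t = H t.
    apply: (etrans (spec_mul (fun i => expR (e t i)) (fun i => e t i * expR (- e t i)) (Wu t))).
    by apply: spec_ext => i; rewrite mulrCA ex' mulr1.
  have q1' : A1 t *m Y t = H t.
    apply: (etrans (spec_mul (fun i => e t i * expR (- e t i)) (fun i => expR (e t i)) (Wu t))).
    by apply: spec_ext => i; rewrite -mulrA ex mulr1.
  have q2 : Yi t *m A2 t = H t.
    apply: (etrans (spec_mul (fun i => expR (- e t i)) (fun i => e t i * expR (e t i)) (Wu t))).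
    by apply: spec_ext => i; rewrite mulrCA ex mulr1.
  have q2' : A2 t *m Yi t = H t.
    apply: (etrans (spec_mul (fun i => e t i * expR (e t i)) (fun i => expR (- e t i)) (Wu t))).
    by apply: spec_ext => i; rewrite -mulrA ex' mulr1.
  have j1 := jet_sandwich Ejet q1 q1'; have j2 := rjet_eq (jet_sandwich ENjet q2 q2') erefl
    (congr1 (fun x => 2 * x) (KN (H t))).
  have j3 := jet_sandwich Ejet YYi YiY.
  have j4 := rjet_eq (jet_sandwich ENjet YiY YYi) erefl
    (congr1 (fun x => 2 * x) (KN 1%:M)).
  have J := rjetD (rjetD j1 (rjetN j2)) (rjetM (rjet_cst (c t))
    (rjetD (rjetD j3 j4) (rjet_cst (- (2 * d%:R))))).
  apply: (rjet_eq J).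
    by rewrite mxtrace1 -(rmorph_nat (@real_complex_def R _)) /=; ring.
  move: (Re (\tr (K *m H t))) (Re (\tr (K *m 1%:M))).
  by move: (_ + _ - 2 * d%:R) => a b b'; ring.
pose Phi s := \sum_t w t * F t s.
have PhiJ : rjet Phi 0 (4 * Re (\tr (K *m (\sum_t (w t)%:C *: H t)))).
  have J := rjet_sum (fun t => rjetM (rjet_cst (w t)) (Fjet t)).
  apply: (rjet_eq J); first by rewrite big1 // => t _; rewrite mulr0.
  rewrite mulmx_sumr tr_sum Re_sum mulr_sumr; apply: eq_bigr => t _.
  by rewrite -scalemxAr mxtraceZ ReZ; ring.
have costM : karcher_cost w X M = \sum_t w t * \sum_i e t i ^+ 2.
  apply: eq_bigr => t _; congr (_ * _).
  exact: (pd_dist_sq pM ZM (Wu t) (We' t)).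
have Phi0 s : 0 <= Phi s.
  have Esu : E s \in unitmx by have [] := mulmx1_unit (EE s).
  have Au : E s *m Z \in unitmx by rewrite unitmx_mul Esu.
  have pN := pd_inv (pd_gram Au).
  suff hN : karcher_cost w X (invmx ((E s *m Z)^t* *m (E s *m Z))) <=
      \sum_t w t * \sum_i e t i ^+ 2 + Phi s.
    by have := le_trans (Mmin _ pN) hN; rewrite costM lerDl.
  rewrite /karcher_cost /Phi -big_split /=; apply: ler_sum => t _.
  rewrite -mulrDr; apply: ler_wpM2l => //.
  have [U [m [Uu _ UE]]] := pd_desc (pd_congr Au (pX t)).
  rewrite (pd_dist_sq pN _ Uu UE) ?invmxK //.
  have UE1 : U *m rdiag (fun i => expR (m i)) *m U^t* = E s *m Y t *m E s.
    by rewrite -UE adjM Ead /Y -We' !mulmxA.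
  have UE2 : U *m rdiag (fun i => expR (- m i)) *m U^t* = E (- s) *m Yi t *m E (- s).
    rewrite -rayN1 -(invmx_ray m Uu) UE1; apply: inv_unique.
    have YYi : Y t *m Yi t = 1%:M by exact: (spec_exp_inv (e t) (Wu t)).
    exact: sandwich_inv.
  have hc i : 4 + `|e t i| <= c t.
    by rewrite lerD2l (bigD1 i) //= lerDl; apply: sumr_ge0.
  rewrite addrA.
  apply: (klein_log_sq Uu (Wu t) hc); rewrite ?UE1 ?UE2 //.
have := rjet_ge0 PhiJ (fun s _ => Phi0 s).
have -> : \sum_t (w t)%:C *: H t = - K^t* by rewrite Kad opprK.
rewrite mulmxN trN ReN mulrN oppr_ge0 pmulr_rle0 // mxtrace_mulC => /adjM_eq0 ->.
by rewrite trmx0 map_mx0 oppr0.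
Qed.

End KarcherMinimizer.

(** * Existence of the minimizer *)

Section KarcherExistence.
Variable R : realType.
Local Notation C := R[i].
Local Notation Re := (@complex.Re R).
Variable d : nat.

(** With Z = e^h V, the traces of Z Z^* and Z X Z^* differ at most by the factor e^xi, as X lies
    between e^(-xi) and e^xi. A sum of exponentials controls each exponent from above. Lower bounds
    come from the same lemma for the inverse of X, through [congruence_inv]. *)
Lemma congruence_bounds (X : 'M[C]_d) : posdefmx X -> exists b : R,
  forall (h e : 'I_d -> R) (V W : 'M[C]_d) (r : R),
  V \is unitarymx -> W \is unitarymx ->
  (rdiag (fun i => expR (h i)) *m V) *m X *m (rdiag (fun i => expR (h i)) *m V)^t* =
    W *m rdiag (fun i => expR (e i)) *m W^t* ->
  ((forall i, e i <= r) -> forall i, 2 * h i <= b + r) /\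
  ((forall i, 2 * h i <= r) -> forall i, e i <= b + r).
Proof.
move=> /pd_desc [P [x [Pu _ XE]]]; have [P1 P2] := unitP Pu.
pose xi := \sum_j `|x j|.
have xb j : - xi <= x j <= xi.
  by rewrite -ler_norml /xi (bigD1 j) //= lerDl; apply: sumr_ge0.
(* Bounding a sum of d exponentials by its largest possible term costs ln d, for which d is a crude
   bound. *)
exists (xi + d%:R) => h e V W r Vu Wu ZE.
have [V1 V2] := unitP Vu; have [W1 W2] := unitP Wu.
pose Z := rdiag (fun i => expR (h i)) *m V.
have ZZ : Z *m Z^t* = rdiag (fun i => expR (2 * h i)).
  rewrite /Z adjM adj_rdiag -mulmxA [V *m _]mulmxA V1 mul1mx rdiagM.
  by apply: rdiag_ext => i; rewrite -expRD; congr expR; ring.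
rewrite -/Z in ZE; clearbody Z.
pose N := P^t* *m Z^t*.
have T1 : \sum_i expR (e i) = \sum_i \sum_j nsq (N i j) * expR (x i).
  have := tr_qf_rdiag N (fun i => expR (x i)).
  have -> : N^t* *m rdiag (fun i => expR (x i)) *m N = Z *m X *m Z^t*.
    by rewrite /N XE adjM !trmxCK !mulmxA.
  by rewrite ZE mxtrace_mulC mulmxA W2 mul1mx tr_rdiag => -[].
have T2 : \sum_i expR (2 * h i) = \sum_i \sum_j nsq (N i j).
  have := tr_adjM N.
  have -> : N^t* *m N = Z *m Z^t*.
    by rewrite /N adjM !trmxCK mulmxA -[_ *m P *m _]mulmxA P1 mulmx1.
  by rewrite ZZ tr_rdiag => -[].
have B1 : \sum_i expR (2 * h i) <= expR xi * \sum_i expR (e i).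
  rewrite T1 T2 mulr_sumr; apply: ler_sum => i _; rewrite mulr_sumr.
  apply: ler_sum => j _; rewrite mulrCA -expRD ler_peMr ?nsq_ge0 //.
  by rewrite -[1](@expR0 R) ler_expR; have := xb i; lra.
have B2 : \sum_i expR (e i) <= expR xi * \sum_i expR (2 * h i).
  rewrite T1 T2 mulr_sumr; apply: ler_sum => i _; rewrite mulr_sumr.
  apply: ler_sum => j _; rewrite [leRHS]mulrC ler_wpM2l ?nsq_ge0 // ler_expR.
  by have := xb i; lra.
have key (u v : 'I_d -> R) : \sum_i expR (u i) <= expR xi * \sum_i expR (v i) ->
    (forall i, v i <= r) -> forall i, u i <= xi + d%:R + r.
  move=> uv vr i; rewrite -ler_expR.
  have : expR (u i) <= \sum_i expR (u i).
    by rewrite [leRHS](bigD1 i) //= lerDl; apply: sumr_ge0 => j _; exact: expR_ge0.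
  move=> /le_trans /(_ uv) /le_trans; apply; rewrite -addrA expRD.
  apply: ler_wpM2l; first exact: expR_ge0.
  apply: (@le_trans _ _ (\sum_(i < d) expR r)).
    by apply: ler_sum => j _; rewrite ler_expR.
  rewrite sumr_const card_ord -(mulr_natl (expR r)) expRD.
  apply: ler_wpM2r; first exact: expR_ge0.
  by have := expR_ge1Dx (d%:R : R); lra.
by split; [apply: (key (fun i => 2 * h i) e B1) | apply: (key e (fun i => 2 * h i) B2)].
Qed.

Lemma congruence_inv (X : 'M[C]_d) h e (V W : 'M[C]_d) :
  posdefmx X -> V \is unitarymx -> W \is unitarymx ->
  (rdiag (fun i => expR (h i)) *m V) *m X *m (rdiag (fun i => expR (h i)) *m V)^t* =
    W *m rdiag (fun i => expR (e i)) *m W^t* ->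
  (rdiag (fun i => expR (- h i)) *m V) *m invmx X *m
    (rdiag (fun i => expR (- h i)) *m V)^t* = W *m rdiag (fun i => expR (- e i)) *m W^t*.
Proof.
move=> pX Vu Wu ZE; have [V1 V2] := unitP Vu.
pose Zi := V^t* *m rdiag (fun i => expR (- h i)).
have Zia : rdiag (fun i => expR (- h i)) *m V = Zi^t*.
  by rewrite /Zi adjM trmxCK adj_rdiag.
have ZiZ : Zi *m (rdiag (fun i => expR (h i)) *m V) = 1%:M.
  rewrite /Zi -mulmxA [rdiag _ *m (_ *m V)]mulmxA rdiagM.
  rewrite (@rdiag_ext _ _ _ (fun=> 1)) => [|i]; last by rewrite mulrC expRxMexpNx_1.
  by rewrite rdiag1 mul1mx V2.
have := inv_congr ZiZ (mulVmx (pd_unit pX)); rewrite ZE Zia trmxCK => hh.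
by rewrite -rayN1 -(invmx_ray e Wu) (inv_unique (mulmx1C hh)).
Qed.

Variables (n : nat) (w : 'I_n -> R) (X : 'I_n -> 'M[C]_d).
Hypothesis w0 : forall t, 0 <= w t.
Hypothesis w1 : \sum_t w t = 1.
Hypothesis pX : forall t, posdefmx (X t).

(* A point M of the cone is encoded by invmx M = Z^* Z with Z = e^h V, together
   with spectral decompositions of all the Z X_t Z^*; on these data the cost is
   visibly continuous. *)
Definition datum := (('I_d -> R) * 'M[C]_d * (('I_n -> 'M[C]_d) * ('I_n -> 'I_d -> R)))%type.

Definition root_of (x : datum) := rdiag (fun i => expR (x.1.1 i)) *m x.1.2.

Definition valid (x : datum) : Prop :=
  [/\ x.1.2 \is unitarymx, forall t, x.2.1 t \is unitarymx &
   forall t, root_of x *m X t *m (root_of x)^t* =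
     x.2.1 t *m rdiag (fun i => expR (x.2.2 t i)) *m (x.2.1 t)^t*].

Definition dcost (x : datum) : R := \sum_t w t * \sum_i x.2.2 t i ^+ 2.

Lemma datum_of_pd M : posdefmx M ->
  exists2 x, valid x & karcher_cost w X M = dcost x.
Proof.
move=> pM; have [h [V [Vu ZM]]] := pd_sqrt (pd_inv pM).
have Zu := rdiag_unitary_unit h Vu.
have /choice [We hWe] : forall t, exists We : 'M[C]_d * ('I_d -> R),
    We.1 \is unitarymx /\ (rdiag (fun i => expR (h i)) *m V) *m X t *m
      (rdiag (fun i => expR (h i)) *m V)^t* =
      We.1 *m rdiag (fun i => expR (We.2 i)) *m We.1^t*.
  move=> t; have [W [e [h1 _ h2]]] := pd_desc (pd_congr Zu (pX t)).
  by exists (W, e).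
exists ((h, V), (fun t => (We t).1, fun t => (We t).2)).
  by split; [exact: Vu | move=> t; case: (hWe t) | move=> t; case: (hWe t)].
apply: eq_bigr => t _; congr (_ * _); have [h1 h2] := hWe t.
exact: (pd_dist_sq pM ZM h1 h2).
Qed.

Lemma pd_of_datum x : valid x ->
  exists2 M, posdefmx M & karcher_cost w X M = dcost x.
Proof.
move=> [Vu Wu xE]; have Zu := rdiag_unitary_unit x.1.1 Vu.
have pM := pd_inv (pd_gram Zu).
exists (invmx ((root_of x)^t* *m root_of x)) => //.
apply: eq_bigr => t _; congr (_ * _).
by apply: (pd_dist_sq pM _ (Wu t) (xE t)); rewrite invmxK.
Qed.

Lemma karcher_exists : exists M, karcher_argmin w X M.
Proof.
have [U [UF UI]] := exists_ultra.
have [t0 wt0] : exists t0, 0 < w t0.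
  apply: contrapT => /forallNP nw.
  have : \sum_t w t <= 0 by apply: sumr_le0 => t _; rewrite leNgt; apply/negP/nw.
  by rewrite w1 ler10.
have [|x seqx [m hm]|x vx xmin] := @attain_min R U datum valid dcost UF UI.
- by have [x vx _] := datum_of_pd (pd1 R d); exists x.
(* The cost controls the exponents e only for an index t0 of positive weight; |a| <= a^2 + 1 turns
   the bound on squares into this one. *)
- have et0 k i : `|(x k).2.2 t0 i| <= m / w t0 + 1.
    have : (x k).2.2 t0 i ^+ 2 <= m / w t0.
      rewrite ler_pdivlMr // mulrC; apply: le_trans (hm k).
      rewrite /dcost (bigD1 t0) //=; apply: ler_wpDr.
        by apply: sumr_ge0 => t _; rewrite mulr_ge0 // sumr_ge0 // => j _; exact: sqr_ge0.
      apply: ler_wpM2l => //; rewrite (bigD1 i) //= lerDl.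
      by apply: sumr_ge0 => j _; exact: sqr_ge0.
    set a := (x k).2.2 t0 i; have : 0 <= (`|a| - 1) ^+ 2 by exact: sqr_ge0.
    rewrite -[a ^+ 2]real_normK ?num_real //; have := normr_ge0 a; nra.
  have seqxi k t := let: And3 a b c := seqx k in congruence_inv (pX t) a (b t) (c t).
  have [b1 hb1] := congruence_bounds (pX t0).
  have [b2 hb2] := congruence_bounds (pd_inv (pX t0)).
  pose r := m / w t0 + 1.
  have hbd k i : - (b2 + r) <= 2 * (x k).1.1 i <= b1 + r.
    have [a b c] := seqx k; apply/andP; split.
      rewrite lerNl -mulrN; apply: (hb2 _ _ _ _ r a (b t0) (seqxi k t0)).1 => j.
      by have := et0 k j; rewrite ler_norml -/r => /andP[]; lra.
    apply: (hb1 _ _ _ _ r a (b t0) (c t0)).1 => j.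
    by have := et0 k j; rewrite ler_norml -/r => /andP[]; lra.
  have /choice [B1 hB1] := fun t => congruence_bounds (pX t).
  have /choice [B2 hB2] := fun t => congruence_bounds (pd_inv (pX t)).
  (* The exponents h, bounded through t0, bound in turn the exponents for every t, also where w t =
     0; all parts of the datum then have limits. *)
  have ebd t k i : `|(x k).2.2 t i| <= `|B1 t + (b1 + r)| + `|B2 t + (b2 + r)|.
    have [a b c] := seqx k.
    have h1 : (x k).2.2 t i <= B1 t + (b1 + r).
      apply: (hB1 t _ _ _ _ (b1 + r) a (b t) (c t)).2 => j.
      by case/andP: (hbd k j).
    have h2 : - (x k).2.2 t i <= B2 t + (b2 + r).
      apply: (hB2 t _ _ _ _ (b2 + r) a (b t) (seqxi k t)).2 => j.
      by rewrite mulrN lerNl; case/andP: (hbd k j).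
    have := ler_norm (B1 t + (b1 + r)); have := ler_norm (B2 t + (b2 + r)).
    have := normr_ge0 (B1 t + (b1 + r)); have := normr_ge0 (B2 t + (b2 + r)).
    by rewrite ler_norml; lra.
  have hbd' k i : `|(x k).1.1 i| <= `|b1 + r| + `|b2 + r|.
    have := ler_norm (b1 + r); have := ler_norm (b2 + r).
    have := normr_ge0 (b1 + r); have := normr_ge0 (b2 + r).
    by have := hbd k i; rewrite ler_norml; lra.
  have [h hh] := @rcv_vec R U UF d (fun k => (x k).1.1) _ hbd'.
  have sV k : (x k).1.2 \is unitarymx by have [h1 _ _] := seqx k; exact: h1.
  have sW k t : (x k).2.1 t \is unitarymx.
    by have [_ h1 _] := seqx k; exact: h1.
  have [V Vu hV] := @mcv_unitary R U UF d (fun k => (x k).1.2) sV.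
  have /choice [W hW] : forall t, exists W, W \is unitarymx /\ mcv U (fun k => (x k).2.1 t) W.
    move=> t; have [W h1 h2] := @mcv_unitary R U UF d (fun k => (x k).2.1 t) (sW^~ t).
    by exists W.
  have /choice [e he] : forall t, exists e : 'I_d -> R, forall i,
      rcv U (fun k => (x k).2.2 t i) (e i).
    by move=> t; exact: (@rcv_vec R U UF d (fun k => (x k).2.2 t) _ (ebd t)).
  exists ((h, V), (W, e)).
    split; [exact: Vu | by move=> t; have [h1 _] := hW t; exact: h1 | move=> t].
    have cZ : mcv U (fun k => root_of (x k)) (root_of ((h, V), (W, e))).
      by apply: (mcvM UF) => //; apply: mcv_rdiag => i; exact: rcv_exp.
    have c1 := mcvM UF (mcvM UF cZ (mcv_cst UF (X t))) (mcv_adj UF cZ).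
    have [_ hWt] := hW t.
    have c2 : mcv U (fun k => (x k).2.1 t *m rdiag (fun i => expR ((x k).2.2 t i)) *m
        ((x k).2.1 t)^t*) (W t *m rdiag (fun i => expR (e t i)) *m (W t)^t*).
      apply: (mcvM UF); last exact: mcv_adj.
      by apply: (mcvM UF) => //; apply: mcv_rdiag => i; exact: rcv_exp.
    apply: (mcv_uniq UF c1).
    move: c2; congr (mcv _ _ _); apply/funext => k.
    by have [_ _ ->] := seqx k.
  apply: (rcv_sum UF) => t; apply: (rcvM UF); first exact: rcv_cst.
  apply: (rcv_sum UF) => i; rewrite expr2; under eq_fun do rewrite expr2.
  by apply: (rcvM UF); exact: he.
have [M pM cM] := pd_of_datum vx; exists M; split; first exact: pM.
move=> N pN; have [y vy cN] := datum_of_pd pN.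
by rewrite cM cN; exact: (xmin y vy).
Qed.

End KarcherExistence.

(** * Horn inequalities *)

Section Horn.
Variable R : realType.
Local Notation C := R[i].
Local Notation Re := (@complex.Re R).

Variable d' : nat.
Local Notation d := d'.+1.

(** The passage from the subspaces in the definition of Horn tuples to the orthonormal frames used
    by the trace estimates. *)
Lemma vspace_frame (L : {vspace 'cV[C]_d}) : exists Q : 'M[C]_(d, \dim L),
  [/\ Q^t* *m Q = 1%:M, forall v, v \in L -> Q *m (Q^t* *m v) = v &
   forall u, Q *m u \in L].
Proof.
pose b := vbasis L; have bb : basis_of L b := vbasisP L.
pose N : 'M[C]_(d, \dim L) := \matrix_(i, j) (tnth b j) i 0.
have NE (u : 'cV_(\dim L)) : N *m u = \sum_j u j 0 *: b`_j.
  apply/matrixP => i k; rewrite !mxE summxE; apply: eq_bigr => j _.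
  by rewrite !mxE ord1 mulrC (tnth_nth 0).
have NL (u : 'cV_(\dim L)) : N *m u \in L.
  rewrite NE; apply: memv_suml => j _; apply: memvZ.
  by apply: vbasis_mem; apply: mem_nth; rewrite size_tuple.
have Nfree : row_free (N^T).
  rewrite -kermx_eq0; apply/rowV0P => u /sub_kermxP uN.
  have : N *m u^T = 0 by rewrite -[N]trmxK -trmx_mul uN trmx0.
  rewrite NE => h; apply/rowP => j; rewrite mxE.
  have /freeP := basis_free bb; move=> /(_ (fun j => u^T j 0) h j).
  by rewrite mxE.
have [D DN] : exists D : 'M[C]_(\dim L, d), D *m N = 1%:M.
  case/row_freeP : Nfree => D hD; exists (D^T).
  by rewrite -[N]trmxK -trmx_mul hD trmx1.
have [Q [T [Q1 Tu e]]] := on_frame DN.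
have QE : Q = N *m invmx T by rewrite e mulmxK.
exists Q; split => // [v vL|u]; last by rewrite QE -mulmxA.
have [u ->] : exists u, v = N *m u.
  exists (\col_j coord b j v); rewrite NE {1}(coord_basis bb vL).
  by apply: eq_bigr => j _; rewrite mxE.
by rewrite e !mulmxA -[Q *m _ *m Q]mulmxA Q1 mulmx1.
Qed.

Definition span_lead (V : 'M[C]_d) (i : 'I_d) : {vspace 'cV[C]_d} :=
  limg (linfun (mulmx (V *m lead R d i.+1) : 'cV[C]_i.+1 -> 'cV[C]_d)).

Lemma span_leadP (V : 'M[C]_d) (i : 'I_d) v :
  reflect (exists u : 'cV[C]_i.+1, v = V *m lead R d i.+1 *m u) (v \in span_lead V i).
Proof.
apply: (iffP memv_imgP) => [[u _ ->]|[u ->]].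
  by exists u; rewrite lfunE.
by exists u; rewrite ?memvf // lfunE.
Qed.

Lemma span_lead_flag (V : 'M[C]_d) : V \is unitarymx ->
  complete_flag (span_lead V).
Proof.
move=> Vu; split=> [i|i j ij].
  rewrite limg_dim_eq.
    by rewrite dimvf /dim /= muln1.
  rewrite capfv; apply/eqP/lker0P => u v; rewrite !lfunE /= => h.
  by rewrite -[u]mul1mx -(flag_iso Vu (ltn_ord i)) -mulmxA h mulmxA flag_iso // mul1mx.
apply/subvP => v /span_leadP [u ->]; apply/span_leadP.
exists ((pid_mx i.+1 : 'M_(j.+1, i.+1)) *m u).
rewrite !mulmxA; congr (_ *m _); rewrite -mulmxA; congr (_ *m _).
rewrite /lead mul_pid_mx (_ : minn _ _ = i.+1) //.
by move: ij; lia.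
Qed.

(** An orthonormal frame B of the intersection is fixed by both projections. In the coordinates of L
    it is the isometry Q^* B, and compressing to it can only decrease the trace. *)
Lemma dim_cap_le_tr (V : 'M[C]_d) (i : 'I_d) (L : {vspace 'cV[C]_d})
    (Q : 'M[C]_(d, \dim L)) : V \is unitarymx -> Q^t* *m Q = 1%:M ->
  (forall v, v \in L -> Q *m (Q^t* *m v) = v) ->
  (\dim (L :&: span_lead V i))%:R <=
  Re (\tr (Q^t* *m (V *m lead R d i.+1 *m (V *m lead R d i.+1)^t*) *m Q)).
Proof.
move=> Vu Q1 QL; have E1 := flag_iso Vu (ltn_ord i).
set E := V *m lead R d i.+1 in E1 *.
have [B [B1 _ BU]] := vspace_frame (L :&: span_lead V i).
have colB (P : 'M[C]_d) : (forall v, v \in (L :&: span_lead V i)%VS -> P *m v = v) ->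
    P *m B = B.
  move=> h; apply/matrixP => a b.
  have /h := BU (delta_mx b 0); rewrite mulmxA => /matrixP/(_ a 0).
  by rewrite -!colE !mxE.
have QB : Q *m Q^t* *m B = B.
  by apply: colB => v; rewrite memv_cap => /andP[vL _]; rewrite -mulmxA QL.
have EB : E *m E^t* *m B = B.
  apply: colB => v; rewrite memv_cap => /andP[_ /span_leadP [u ->]].
  by rewrite -/E mulmxA -[_ *m E^t* *m E]mulmxA E1 mulmx1.
pose S := Q^t* *m B.
have S1 : S^t* *m S = 1%:M.
  by rewrite /S adjM trmxCK mulmxA -[_ *m Q *m Q^t*]mulmxA -mulmxA QB B1.
have SE : (E^t* *m Q) *m S = E^t* *m B.
  by rewrite /S -mulmxA [Q *m _]mulmxA QB.
have e1 : (\dim (L :&: span_lead V i))%:R = Re (\tr ((E^t* *m B)^t* *m (E^t* *m B))).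
  rewrite adjM trmxCK -mulmxA [E *m _]mulmxA EB B1 mxtrace1.
  by rewrite -(rmorph_nat (@real_complex_def R _)).
have := iso_contr ((E^t* *m Q)^t*) S1.
rewrite -adjM SE !trmxCK [X in Re X <= _]mxtrace_mulC -e1.
by rewrite [X in _ <= Re X]mxtrace_mulC adjM trmxCK !mulmxA.
Qed.

(** The definition constrains L only at the elements of I. If c + 1 of them are at most k, the one
    of rank c, counted from 0, is at most k, and the condition there already gives dimension greater
    than c. *)
Lemma schubert_count (I : {set 'I_d}) (E : 'I_d -> {vspace 'cV[C]_d})
    (L : {vspace 'cV[C]_d}) (k : 'I_d) : schubert I E L -> complete_flag E ->
  (#|[set i in I | (i <= k)%N]| <= \dim (L :&: E k))%N.
Proof.
move=> [_ sch] [_ Esub].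
have evm (p q : 'I_#|I|) : (p <= q)%N -> (enum_val p <= enum_val q)%N.
  move=> pq; rewrite (enum_val_nth k) [in leqRHS](enum_val_nth k).
  have srt : sorted (fun i j : 'I_d => (i <= j)%N) (enum I).
    rewrite /enum_mem -enumT; apply: sorted_filter; first by move=> ? ? ?; exact: leq_trans.
    by have := iota_sorted 0 d; rewrite -val_enum_ord sorted_map.
  apply: (sorted_leq_nth _ _ k srt) => //; rewrite ?inE -?cardE ?ltn_ord //.
  by move=> ? ? ?; exact: leq_trans.
have cE : #|[set i in I | (i <= k)%N]| = #|[set q : 'I_#|I| | (enum_val q <= k)%N]|.
  rewrite -(card_imset _ (@enum_val_inj _ (mem I))); apply: eq_card => i.
  rewrite inE; apply/andP/imsetP => [[iI ik]|[q]].
    by exists (enum_rank_in iI i); rewrite ?inE enum_rankK_in.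
  by rewrite inE => qk ->; split => //; exact: enum_valP.
rewrite cE; case c0: #|[set q : 'I_#|I| | (enum_val q <= k)%N]| => [|c] //.
have cI : (c < #|I|)%N.
  by rewrite -c0 -[X in (_ <= X)%N]card_ord max_card.
have qk : (enum_val (Ordinal cI) <= k)%N.
  rewrite leqNgt; apply/negP => kq.
  have : (c.+1 <= c)%N; last by rewrite ltnn.
  have winj : injective (widen_ord (ltnW cI)).
    by move=> a b /(congr1 val) /= ab; exact: val_inj.
  rewrite -c0 -[X in (_ <= X)%N]card_ord -(card_imset _ winj).
  apply: subset_leq_card; apply/fintype.subsetP => q; rewrite inE => qk.
  have qc : (q < c)%N.
    rewrite ltnNge; apply/negP => cq.
    by have := leq_ltn_trans (leq_trans (evm (Ordinal cI) q cq) qk) kq; rewrite ltnn.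
  by apply/imsetP; exists (Ordinal qc) => //; exact/val_inj.
apply: (leq_trans (sch (Ordinal cI))).
by apply: dimvS; apply: capvS => //; exact: Esub.
Qed.

(** Both sides are expanded over the gaps of a: the number of elements of I up to k is at most the
    dimension of the intersection with the k-th flag member, which is at most the trace of the
    compressed projection. *)
Lemma schubert_trace (V : 'M[C]_d) (a : 'I_d -> R) (I : {set 'I_d})
    (L : {vspace 'cV[C]_d}) (Q : 'M[C]_(d, \dim L)) : V \is unitarymx ->
  (forall i j : 'I_d, (i <= j)%N -> a j <= a i) ->
  Q^t* *m Q = 1%:M -> (forall v, v \in L -> Q *m (Q^t* *m v) = v) ->
  schubert I (span_lead V) L ->
  \sum_(i in I) a i <= Re (\tr (Q^t* *m (V *m rdiag a *m V^t*) *m Q)).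
Proof.
move=> Vu ad Q1 QL sch; have [dimL _] := sch.
rewrite spec_gap // mulmxDr mulmxDl mxtraceD ReD.
have -> : Re (\tr (Q^t* *m (a ord_max)%:C%:M *m Q)) = a ord_max * #|I|%:R.
  rewrite mul_mx_scalar -scalemxAl Q1 mxtraceZ ReZ mxtrace1 -dimL.
  by rewrite -(rmorph_nat (@real_complex_def R _)).
have -> : \sum_(i in I) a i =
    \sum_k gap a k * #|[set i in I | (i <= k)%N]|%:R + a ord_max * #|I|%:R.
  under eq_bigr do rewrite -sum_gap.
  rewrite big_split /= sumr_const -[a ord_max *+ _]mulr_natr; congr (_ + _).
  rewrite (exchange_big_dep xpredT) //=; apply: eq_bigr => k _.
  rewrite sumr_const -[LHS]mulr_natr; congr (_ * _%:R).
  by apply: eq_card => i; rewrite !inE.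
rewrite lerD2r mulmx_sumr mulmx_suml tr_sum Re_sum; apply: ler_sum => k _.
rewrite -scalemxAr -scalemxAl mxtraceZ ReZ; apply: ler_wpM2l; first exact: gap_ge0.
apply: le_trans (dim_cap_le_tr k Vu Q1 QL); rewrite ler_nat.
exact: (schubert_count k sch (span_lead_flag Vu)).
Qed.

Lemma mxlog_of_eq n (A V : 'M[C]_n) (a : 'I_n -> R) : V \is unitarymx ->
  A = V *m rdiag a *m V^t* -> mxlog A = V *m rdiag (fun i => ln (a i)) *m V^t*.
Proof. by move=> Vu ->; exact: mxfunE. Qed.

Theorem horn_of_log_sum n (w : 'I_n -> R) (X : 'I_n -> 'M[C]_d) (M : 'M[C]_d)
    (U : 'I_n -> 'M[C]_d) (I : 'I_n -> {set 'I_d}) (K : {set 'I_d}) :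
  (forall t, 0 <= w t) -> (forall t, posdefmx (X t)) -> posdefmx M ->
  (forall t, U t \is unitarymx) ->
  mxlog M = \sum_t (w t)%:C *: (U t *m mxlog (X t) *m (U t)^t*) ->
  horn_tuple R I K ->
  \prod_(t < n) (\prod_(i in I t) lambda_up (X t) i) `^ (w t) <=
  \prod_(k in K) lambda_up M k.
Proof.
move=> w0 pX pM Uu logE [r [_ [Ir Kr H]]].
have spec A : posdefmx A -> exists V : 'M[C]_d, [/\ V \is unitarymx,
    forall i, 0 < lambda_up A i &
    mxlog A = V *m rdiag (fun i => ln (lambda_up A i)) *m V^t*].
  move=> pA; have [V Vu e] := herm_lambda_up pA.1.
  have pA' : posdefmx (V *m rdiag (lambda_up A) *m V^t*) by rewrite -e.
  exists V; split; [exact: Vu | by move=> i; exact: (pd_eig_gt0 i Vu pA') |].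
  exact: mxlog_of_eq Vu e.
have [V0 [V0u M0 logM]] := spec M pM.
have /choice [V hV] := fun t => spec (X t) (pX t).
pose g i := ln (lambda_up M i); pose l t i := ln (lambda_up (X t) i).
(* The eigenvalues of X t are increasing while [schubert_trace] wants decreasing weights. Reversal
   by p supplies them, and matches the dual sets in the definition of a Horn tuple. *)
pose p := perm (@rev_ord_inj d).
have pE i : p i = rev_ord i by rewrite permE.
have rot t := spectral_perm (l t) p (mul_unitarymx (Uu t) (let: And3 a _ _ := hV t in a)).
pose V' t := col_perm p (U t *m V t).
have [L [sL sK]] := H (fun t => span_lead (V' t)) (span_lead V0)
  (fun t => span_lead_flag (rot t).1) (span_lead_flag V0u).
have [Q [Q1 QL _]] := vspace_frame L.
(* Here the weights - g are already decreasing, so K enters without dualization, and the sign turns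
   the lower bound into an upper one. *)
have gK : Re (\tr (Q^t* *m mxlog M *m Q)) <= \sum_(k in K) g k.
  have gd (i j : 'I_d) : (i <= j)%N -> - g j <= - g i.
    by move=> ij; rewrite lerN2 /g ler_ln ?posrE // lambda_up_homo.
  have := schubert_trace V0u gd Q1 QL sK.
  by rewrite -rdiagN mulmxN mulNmx mulmxN mulNmx trN ReN sumrN lerN2 logM.
have lI t : \sum_(i in I t) l t i <=
    Re (\tr (Q^t* *m (U t *m mxlog (X t) *m (U t)^t*) *m Q)).
  have [_ X0 logX] := hV t.
  have ld (i j : 'I_d) : (i <= j)%N -> l t (p j) <= l t (p i).
    move=> ij; rewrite /l ler_ln ?posrE // lambda_up_homo // !pE /=.
    by move: ij; lia.
  have := schubert_trace (rot t).1 ld Q1 QL (sL t).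
  rewrite -(rot t).2 logX -/(l t).
  have -> : U t *m V t *m rdiag (l t) *m (U t *m V t)^t* =
      U t *m (V t *m rdiag (l t) *m (V t)^t*) *m (U t)^t* by rewrite adjM !mulmxA.
  apply: le_trans; rewrite /dual_set big_imset /=; last first.
    by move=> ? ? _ _; exact: rev_ord_inj.
  by under [leRHS]eq_bigr do rewrite pE rev_ordK.
have lam t : \prod_(i in I t) lambda_up (X t) i = expR (\sum_(i in I t) l t i).
  rewrite expR_sum; apply: eq_bigr => i _; rewrite /l lnK ?posrE //.
  by have [_ h _] := hV t; exact: h.
have -> : \prod_(k in K) lambda_up M k = expR (\sum_(k in K) g k).
  by rewrite expR_sum; apply: eq_bigr => k _; rewrite /g lnK ?posrE.
under eq_bigr do rewrite lam -expRM.
rewrite -expR_sum ler_expR; apply: le_trans gK.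
rewrite logE mulmx_sumr mulmx_suml tr_sum Re_sum; apply: ler_sum => t _.
rewrite -scalemxAr -scalemxAl mxtraceZ ReZ mulrC.
by apply: ler_wpM2l.
Qed.

End Horn.

(** * The geometric mean and the final assembly *)

Lemma geomean_log (R : realType) (d' : nat) (X Y : 'M[R[i]]_d'.+1) (a : R) :
  posdefmx X -> posdefmx Y -> 0 <= a <= 1 ->
  exists U V : 'M[R[i]]_d'.+1, [/\ U \is unitarymx, V \is unitarymx &
    mxlog (geomean a X Y) = (1 - a)%:C *: (U *m mxlog X *m U^t*) +
      a%:C *: (V *m mxlog Y *m V^t*)].
Proof.
move=> pX pY a01; have [W [h [Wu _ XE]]] := pd_desc pX.
have SM u v := rayM h u v Wu; have S0 := ray0 h Wu; have Sad := ray_adj W h.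
have S1 : X = ray W h 1 by rewrite ray1.
have SP u : mxpow X u = ray W h u by rewrite XE; exact: mxpow_spec.
have Sp u := ray_pd h u Wu.
rewrite /geomean !SP; move: (ray W h) SM S0 Sad S1 Sp => S SM S0 Sad S1 Sp.
have pY0 : posdefmx (S (- 2^-1) *m Y *m S (- 2^-1)).
  by have := pd_congu (pd_unit (Sp (- 2^-1))) pY; rewrite Sad.
have [P [z [Pu _ YE]]] := pd_desc pY0.
have TP u : mxpow (S (- 2^-1) *m Y *m S (- 2^-1)) u = ray P z u.
  by rewrite YE; exact: mxpow_spec.
have TM u v := rayM z u v Pu; have T0 := ray0 z Pu; have Tad := ray_adj P z.
have Tp u := ray_pd z u Pu.
have T1 : S (- 2^-1) *m Y *m S (- 2^-1) = ray P z 1 by rewrite ray1.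
have Tspec u : ray P z u = P *m rdiag (fun i => expR (u * z i)) *m P^t* by [].
rewrite TP; move: (ray P z) TM T0 Tad T1 Tp Tspec => E EM E0 Ead E1 Ep Espec.
pose T := S 2^-1 *m E (a / 2).
have Tu : T \in unitmx.
  by rewrite unitmx_mul; apply/andP; split; [exact: pd_unit (Sp _) | exact: pd_unit (Ep _)].
have Tadj : T^t* = E (a / 2) *m S 2^-1 by rewrite adjM Ead Sad.
have TET u : T *m E u *m T^t* = S 2^-1 *m E (a + u) *m S 2^-1.
  rewrite Tadj /T !mulmxA -[_ *m E _ *m E u]mulmxA EM -[_ *m E _ *m E _]mulmxA EM.
  by congr (_ *m E _ *m _); lra.
have GE : S 2^-1 *m E a *m S 2^-1 = T *m T^t*.
  by rewrite -[a in LHS]addr0 -TET E0 mulmx1.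
have h2 : 2^-1 + 2^-1 = 1 :> R by lra.
have TX : T *m E (- a) *m T^t* = X by rewrite TET subrr E0 mulmx1 SM S1 h2.
have TY : T *m E (1 - a) *m T^t* = Y.
  rewrite TET addrC subrK -E1 !mulmxA SM subrr S0 mul1mx -mulmxA SM addNr S0.
  by rewrite mulmx1.
rewrite GE.
pose w (t : 'I_2) := if t == ord0 then 1 - a else a.
(* X and Y are T E(- a) T^* and T E(1 - a) T^*; the Karcher equation is (1 - a)(- a) + a (1 - a) =
   0. *)
pose u (t : 'I_2) := if t == ord0 then - a else 1 - a.
have [|||||U [Uu UE]] := @log_karcher R d' 2 w T (fun=> P) (fun t i => u t * z i).
- by move=> t; rewrite /w; case: ifP; lra.
- by rewrite !big_ord_recl big_ord0 /w /=; lra.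
- exact: Tu.
- by [].
- rewrite !big_ord_recl big_ord0 /w /u /= addr0.
  have rE (b : R) : P *m rdiag (fun i => b * z i) *m P^t* =
      b%:C *: (P *m rdiag z *m P^t*).
    by rewrite -rdiagZ -scalemxAr -scalemxAl.
  rewrite !rE !scalerA -scalerDl -!CrM -CrD (_ : _ + _ = 0 :> R) ?scale0r //.
  by ring.
exists (U ord0), (U (lift ord0 ord0)); split; [exact: Uu | exact: Uu |].
rewrite UE !big_ord_recl big_ord0 addr0 -!Espec /w /u /=.
by rewrite TX TY.
Qed.

Lemma karcher_log_sum (R : realType) (d' n : nat) (w : 'I_n -> R)
    (X : 'I_n -> 'M[R[i]]_d'.+1) :
  (forall t, 0 <= w t) -> \sum_(t < n) w t = 1 -> (forall t, posdefmx (X t)) ->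
  posdefmx (karcher_mean w X) /\
  exists U : 'I_n -> 'M[R[i]]_d'.+1, (forall t, U t \is unitarymx) /\
    mxlog (karcher_mean w X) =
      \sum_(t < n) (w t)%:C *: (U t *m mxlog (X t) *m (U t)^t*).
Proof.
move=> w0 w1 pX.
have Mmin : karcher_argmin w X (karcher_mean w X).
  by apply: xgetPex; exact: karcher_exists.
split; first by case: Mmin.
have [T [Z [z [Tu Zu -> XE kar]]]] := karcher_equation w0 pX Mmin.
have [U [Uu UE]] := log_karcher w0 w1 Tu Zu kar.
exists U; split; first exact: Uu.
by rewrite UE; apply: eq_bigr => t _; rewrite -(XE t).
Qed.

Theorem corollary24 (R : realType) (d : nat) :
  (forall (n : nat) (w : 'I_n -> R) (X : 'I_n -> 'M[R[i]]_d),
     (forall t, 0 <= w t) -> \sum_(t < n) w t = 1 ->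
     (forall t, posdefmx (X t)) ->
     let horn_inequalities :=
       forall (I : 'I_n -> {set 'I_d}) (K : {set 'I_d}),
         horn_tuple R I K ->
         \prod_(k in K) lambda_up (karcher_mean w X) k >=
         \prod_(t < n) (\prod_(i in I t) lambda_up (X t) i) `^ (w t) in
     [/\ horn_inequalities,
         horn_inequalities <->
         (exists U : 'I_n -> 'M[R[i]]_d,
            (forall t, U t \is unitarymx) /\
            loewner_le
              (\sum_(t < n) (w t)%:C *: (U t *m mxlog (X t) *m (U t)^t*))
              (mxlog (karcher_mean w X))) &
         exists U : 'I_n -> 'M[R[i]]_d,
           (forall t, U t \is unitarymx) /\
           mxlog (karcher_mean w X) =
             \sum_(t < n) (w t)%:C *: (U t *m mxlog (X t) *m (U t)^t*)]) /\
  (forall (X Y : 'M[R[i]]_d) (alpha : R),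
     posdefmx X -> posdefmx Y -> 0 <= alpha <= 1 ->
     exists U V : 'M[R[i]]_d,
       [/\ U \is unitarymx, V \is unitarymx &
           mxlog (geomean alpha X Y) =
             (1 - alpha)%:C *: (U *m mxlog X *m U^t*) +
             alpha%:C *: (V *m mxlog Y *m V^t*)]).
Proof.
have one_unitary : (1%:M : 'M[R[i]]_d) \is unitarymx.
  by apply/unitarymxP; rewrite adj1 mulmx1.
split=> [n w X w0 w1 pX horn|X Y a pX pY a01]; last first.
  case: d X Y pX pY one_unitary => [|d'] X Y pX pY u1; last exact: geomean_log.
  by exists 1%:M, 1%:M; split => //; apply/matrixP => -[].
have eq_part : exists U : 'I_n -> 'M[R[i]]_d, (forall t, U t \is unitarymx) /\
    mxlog (karcher_mean w X) =
      \sum_(t < n) (w t)%:C *: (U t *m mxlog (X t) *m (U t)^t*).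
  (* In dimension 0 any two matrices coincide; the results above are stated for d'.+1. *)
  case: d X {horn} pX one_unitary => [|d'] X pX u1.
    by exists (fun=> 1%:M); split => //; apply/matrixP => -[].
  by have [] := karcher_log_sum w0 w1 pX.
have horn_ok : horn.
  move=> I K; case: eq_part => U [Uu UE].
  (* There is no Horn tuple in dimension 0, since its rank would satisfy 1 <= r <= 0. *)
  case: d X {horn one_unitary} pX U Uu UE I K => [|d'] X pX U Uu UE I K ht.
    by case: ht => r [/andP[r1]]; rewrite leqn0 => /eqP r0; rewrite r0 in r1.
  exact: (horn_of_log_sum w0 pX (karcher_log_sum w0 w1 pX).1 Uu UE ht).
split; [exact: horn_ok | | exact: eq_part].
(* Both sides follow from the equality of logarithms; for the Loewner inequality the difference is
   the zero matrix. *)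
split=> [_|_]; last exact: horn_ok.
case: eq_part => U [Uu UE]; exists U; split; first exact: Uu.
rewrite /loewner_le UE subrr; split.
  by apply/hermP; rewrite trmx0 map_mx0.
by move=> v; rewrite mulmx0 mul0mx mxE.
Qed.
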